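(* Let $G$ be a topological group. An equivariant Lefschetz number is uniquely determined by its values on $G$-self maps of finite wedge sums of equivariant $1$-spheres ${G/H_i}_+\wedge\mathbb{S}^1$. In particular, if $(L^1_G,B)$ is an equivariant Lefschetz number and $L^2_G$ is an assignment of an element $L^2_G(f)\in B$ to every $G$-self map $f:X\to X$ of a finite $G$-CW complex, then $L^1_G(f)=L^2_G(f)$ for every self map $f$ if and only if $L^2_G$ satisfies the following axioms: 1. If $f:X\to X$ is equivariantly homotopic to $h:X\to X$, then $L^2_G(f)=L^2_G(h)$. 2. If $f:X\to Y$ and $h:Y\to X$ are $G$-maps, then $L^2_G(f\circ h)=L^2_G(h\circ f)$. 3. If $A\subseteq X$ is a subcomplex, $f:X\to X$ is a $G$-map with $f(A)\subseteq A$ and $\hat f:X/A\to X/A$ is the induced map, then $L^2_G(f)=L^2_G(f|_A)+L^2_G(\hat f)$. 4. If $X=\bigvee {G/H_i}_+\wedge\mathbb{S}^1$ is a finite wedge sum and $f:X\to X$ is a $G$-map, then $L^2_G(f)=L^1_G(f)$.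
   Context: All $G$-CW complexes are pointed with a $G$-fixed base point (cells are of the form $G/H\times D^n$ with $H$ closed in $G$; ''finite'' means finitely many equivariant cells); all $G$-maps and $G$-homotopies preserve base points, and subcomplexes are $G$-invariant. ${G/H}_+$ is $G/H$ with a disjoint base point, and $\mathbb{S}^1$ carries the trivial action. The complexes $X,Y$ in the axioms are finite. Equivariant Lefschetz number: a pair $(\ell_G,B)$ with $B$ an abelian group and $\ell_G$ an assignment of an element $\ell_G(f)\in B$ to every $G$-self map $f:X\to X$ of a finite $G$-CW complex such that: (Homotopy invariance) if $k:X\to Y$ is a $G$-homotopy equivalence of finite $G$-CW complexes, $f:X\to X$, $h:Y\to Y$ and $k\circ f\simeq_G h\circ k$, then $\ell_G(f)=\ell_G(h)$; (Cofibration) if $A\subseteq X$ is an invariant subcomplex with $f(A)\subseteq A$ and $\hat f:X/A\to X/A$ is the induced map, then $\ell_G(f)=\ell_G(f|_A)+\ell_G(\hat f)$; (Commutativity) for $G$-maps $f:X\to Y$, $h:Y\to X$, $\ell_G(h\circ f)=\ell_G(f\circ h)$. *)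

(* Defs.v *)
From HB Require Import structures.
From mathcomp Require Import all_boot all_order all_algebra.
From mathcomp Require Import all_classical reals topology homotopy.

Set Implicit Arguments.
Unset Strict Implicit.
Unset Printing Implicit Defensive.

Import Order.TTheory GRing.Theory Num.Theory.
Import numFieldTopology.Exports.

Local Open Scope classical_set_scope.
Local Open Scope quotient_scope.
Local Open Scope group_scope.

HB.mixin Record isTopologicalGroup G of Group G & Topological G := {
  mulg_continuous : continuous (fun p : G * G => p.1 * p.2);
  invg_continuous : continuous (fun x : G => x^-1)
}.

#[short(type="topGroupType")]
HB.structure Definition TopologicalGroup :=
  {G of Group G & Topological G & isTopologicalGroup G}.

Record closed_subgroup (G : topGroupType) := ClosedSubgroup {
  csg_set :> groupClosed G;
  csg_closed : closed [set x | x \in csg_set]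
}.

Section Orbit.
Context {G : topGroupType} (H : closed_subgroup G).

Definition coset_rel (x y : G) : bool := x^-1 * y \in (csg_set H).

Lemma coset_rel_refl : reflexive coset_rel.
Proof. by move=> x; rewrite /coset_rel mulVg gpred1. Qed.

Lemma coset_rel_sym : symmetric coset_rel.
Proof.
by move=> x y; rewrite /coset_rel -gpredV invgM invgK.
Qed.

Lemma coset_rel_trans : transitive coset_rel.
Proof.
move=> y x z; rewrite /coset_rel => xy yz.
by rewrite -(mulgK y x^-1) -mulgA gpredM.
Qed.

Canonical coset_equiv := EquivRel coset_rel
  coset_rel_refl coset_rel_sym coset_rel_trans.

(** G/H (left cosets) *)
Definition orbit := {eq_quot coset_equiv}.

HB.instance Definition _ := Topological.copy orbit (quotient_topology orbit).
HB.instance Definition _ := Quotient.on orbit.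

Definition orbit_act (g : G) (c : orbit) : orbit := \pi_orbit (g * repr c).

End Orbit.

Section OrbitTheory.
Context {G : topGroupType} (H : closed_subgroup G).

Lemma orbit_piE (x y : G) :
  (\pi_(orbit H) x = \pi_(orbit H) y) <-> x^-1 * y \in csg_set H.
Proof. by split => [/eqmodP//|xy]; apply/eqmodP. Qed.

Lemma orbit_act_pi g x :
  orbit_act g (\pi_(orbit H) x) = \pi_(orbit H) (g * x).
Proof.
apply/orbit_piE; rewrite invgM -mulgA mulKg; apply/orbit_piE.
by rewrite reprK.
Qed.

Lemma orbit_act1 (c : orbit H) : orbit_act 1 c = c.
Proof. by rewrite /orbit_act mul1g reprK. Qed.

Lemma orbit_actM g h (c : orbit H) :
  orbit_act (g * h) c = orbit_act g (orbit_act h c).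
Proof. by rewrite [orbit_act h c]/orbit_act orbit_act_pi mulgA. Qed.

Lemma mulg_left_continuous (g : G) : continuous (fun x : G => g * x).
Proof.
move=> x; apply: (@continuous_comp _ _ _ (fun x : G => (g, x))
  (fun p : G * G => p.1 * p.2)); last exact: mulg_continuous.
by apply: cvg_pair => //=; exact: cvg_cst.
Qed.

Lemma orbit_act_continuous g : continuous (@orbit_act G H g).
Proof.
apply: (@repr_comp_continuous G (orbit H) (orbit H)
  (fun x => \pi_(orbit H) (g * x))).
  move=> x; apply: continuous_comp; first exact: mulg_left_continuous.
  exact: pi_continuous.
move=> a b /eqP/orbit_piE ab; apply/eqP/orbit_piE.
by rewrite invgM -mulgA mulKg.
Qed.

End OrbitTheory.

(** Each group element acts by a homeomorphism, but joint continuity of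
    G * X -> X for the product topology is not a field: for a general
    topological group it already fails for the cell complex G/H_+ /\ S^1
    (e.g. G the rationals, H trivial), because G * - need not preserve quotient
    maps. The topology of a G-CW complex is determined by its cells G/H * D^n,
    on which G acts jointly continuously; [gcw_act_joint_continuous] below
    recovers joint continuity on the whole complex when G is locally compact
    Hausdorff. *)
Record gspace (G : topGroupType) := GSpace {
  gcarrier :> topologicalType;
  gact : G -> gcarrier -> gcarrier;
  gpt : gcarrier;
  gact1 : forall x, gact 1 x = x;
  gactM : forall g h x, gact (g * h) x = gact g (gact h x);
  gact_continuous : forall g, continuous (gact g);
  gact_pt : forall g, gact g gpt = gpt
}.
Arguments gact {G X} : rename.
Arguments gpt {G X} : rename.

Record gmap (G : topGroupType) (X Y : gspace G) := GMap {
  gmap_fun :> X -> Y;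
  gmap_continuous : continuous gmap_fun;
  gmap_equivariant : forall g x, gmap_fun (gact g x) = gact g (gmap_fun x);
  gmap_pt : gmap_fun gpt = gpt
}.

Section GMaps.
Context {G : topGroupType}.
Implicit Types X Y Z : gspace G.

Program Definition gid X : gmap X X := @GMap G X X id _ _ _.
Next Obligation. by move=> X x. Qed.
Next Obligation. by []. Qed.
Next Obligation. by []. Qed.

Program Definition gcomp X Y Z (h : gmap Y Z) (f : gmap X Y) : gmap X Z :=
  @GMap G X Z (h \o f) _ _ _.
Next Obligation.
move=> X Y Z h f x; apply: continuous_comp; exact: gmap_continuous.
Qed.
Next Obligation. by move=> X Y Z h f g x /=; rewrite !gmap_equivariant. Qed.
Next Obligation. by move=> X Y Z h f /=; rewrite !gmap_pt. Qed.

Definition ghomeomorphic X Y :=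
  exists (f : gmap X Y) (h : gmap Y X), cancel f h /\ cancel h f.

End GMaps.

Section Homotopy.
Context (R : realType) {G : topGroupType}.
Implicit Types X Y : gspace G.

Definition ghomotopic X Y (f h : gmap X Y) : Prop :=
  exists K : R * X -> Y,
  [/\ {within `[0%R, 1%R] `*` [set: X], continuous K},
      (forall x, K (0%R, x) = f x),
      (forall x, K (1%R, x) = h x),
      (forall t g x, `[0%R, 1%R] t -> K (t, gact g x) = gact g (K (t, x)))
    & (forall t, `[0%R, 1%R] t -> K (t, gpt) = gpt)].

Definition ghomotopy_equivalence X Y (k : gmap X Y) : Prop :=
  exists k' : gmap Y X,
    ghomotopic (gcomp k' k) (gid X) /\ ghomotopic (gcomp k k') (gid Y).

End Homotopy.

Record invariant_subset (G : topGroupType) (X : gspace G) := InvariantSubset {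
  inv_set :> set X;
  inv_pt : inv_set gpt;
  inv_act : forall g x, inv_set x -> inv_set (gact g x)
}.

Section SubSpace.
Context {G : topGroupType} {X : gspace G} (A : invariant_subset X).

Definition sub_act (g : G) (x : set_type A) : set_type A :=
  exist _ (gact g (val x)) (mem_set (inv_act g (set_mem (valP x)))).

Definition sub_pt : set_type A := exist _ gpt (mem_set (inv_pt A)).

Lemma sub_val_continuous : continuous (val : set_type A -> X).
Proof. exact: initial_continuous. Qed.

Lemma sub_continuous (Z : topologicalType) (f : Z -> set_type A) :
  continuous ((val : set_type A -> X) \o f) -> continuous f.
Proof. exact: continuous_comp_initial. Qed.

Program Definition sub_gspace : gspace G :=
  @GSpace G (set_type A) sub_act sub_pt _ _ _ _.
Next Obligation. by move=> x; apply: val_inj; rewrite /= gact1. Qed.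
Next Obligation. by move=> g h x; apply: val_inj; rewrite /= gactM. Qed.
Next Obligation.
move=> g; apply: sub_continuous => x.
apply: (@continuous_comp _ _ _ (val : set_type A -> X) (gact g)).
  exact: sub_val_continuous.
exact: gact_continuous.
Qed.
Next Obligation. by move=> g; apply: val_inj; rewrite /= gact_pt. Qed.

Program Definition gmap_restrict (f : gmap X X)
    (fA : set_fun A A f) : gmap sub_gspace sub_gspace :=
  @GMap G sub_gspace sub_gspace
    (fun x => exist _ (f (val x)) (mem_set (fA _ (set_mem (valP x))))) _ _ _.
Next Obligation.
move=> f fA; apply: sub_continuous => x.
apply: (@continuous_comp _ _ _ (val : set_type A -> X) f).
  exact: sub_val_continuous.
exact: gmap_continuous.
Qed.
Next Obligation.
by move=> f fA g x; apply: val_inj; rewrite /= gmap_equivariant.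
Qed.
Next Obligation. by move=> f fA; apply: val_inj; rewrite /= gmap_pt. Qed.

End SubSpace.

Section QuotientSpace.
Context {G : topGroupType} {X : gspace G} (A : invariant_subset X).

Definition collapse_rel (x y : X) : bool :=
  (x == y) || (x \in inv_set A) && (y \in inv_set A).

Lemma collapse_rel_refl : reflexive collapse_rel.
Proof. by move=> x; rewrite /collapse_rel eqxx. Qed.

Lemma collapse_rel_sym : symmetric collapse_rel.
Proof. by move=> x y; rewrite /collapse_rel eq_sym andbC. Qed.

Lemma collapse_rel_trans : transitive collapse_rel.
Proof.
move=> y x z; rewrite /collapse_rel.
move=> /predU1P[->//|/andP[xA yA]] /predU1P[<-|/andP[_ zA]].
  by rewrite xA yA orbT.
by rewrite xA zA orbT.
Qed.

Canonical collapse_equiv := EquivRel collapse_rel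
  collapse_rel_refl collapse_rel_sym collapse_rel_trans.

(** X/A *)
Definition collapse := {eq_quot collapse_equiv}.

HB.instance Definition _ :=
  Topological.copy collapse (quotient_topology collapse).
HB.instance Definition _ := Quotient.on collapse.

Lemma collapse_piP (x y : X) :
  \pi_collapse x = \pi_collapse y <-> x = y \/ inv_set A x /\ inv_set A y.
Proof.
split.
  move=> /eqmodP/predU1P[->|/andP[xA yA]]; first by left.
  by right; split; exact: set_mem.
case=> [->//|[xA yA]]; apply/eqmodP/predU1P; right.
by apply/andP; split; exact: mem_set.
Qed.

Lemma collapse_pi_continuous : continuous (\pi_collapse : X -> collapse).
Proof. exact: pi_continuous. Qed.

Definition collapse_act (g : G) (c : collapse) : collapse :=
  \pi_collapse (gact g (repr c)).

Lemma collapse_act_pi g x :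
  collapse_act g (\pi_collapse x) = \pi_collapse (gact g x).
Proof.
apply/collapse_piP; have : \pi_collapse (repr (\pi_collapse x)) = \pi_collapse x.
  by rewrite reprK.
move/collapse_piP => [->|[xA yA]]; first by left.
by right; split; exact: inv_act.
Qed.

Lemma collapse_repr_continuous (Z : topologicalType) (f : X -> Z) :
  continuous f -> (forall x y, inv_set A x -> inv_set A y -> f x = f y) ->
  continuous (f \o repr : collapse -> Z).
Proof.
move=> cf fA; apply: repr_comp_continuous => //.
by move=> x y /eqP/collapse_piP[->//|[xA yA]]; apply/eqP/fA.
Qed.

Program Definition quot_gspace : gspace G :=
  @GSpace G collapse collapse_act (\pi_collapse gpt) _ _ _ _.
Next Obligation. by move=> c; rewrite /collapse_act gact1 reprK. Qed.
Next Obligation.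
move=> g h c; rewrite [collapse_act h c]/collapse_act collapse_act_pi.
by rewrite /collapse_act gactM.
Qed.
Next Obligation.
move=> g; apply: (@collapse_repr_continuous _
  (fun x => \pi_collapse (gact g x))).
  move=> x; apply: continuous_comp; first exact: gact_continuous.
  exact: collapse_pi_continuous.
by move=> x y xA yA; apply/collapse_piP; right; split; exact: inv_act.
Qed.
Next Obligation. by move=> g; rewrite collapse_act_pi gact_pt. Qed.

Program Definition gmap_induced (f : gmap X X)
    (fA : set_fun A A f) : gmap quot_gspace quot_gspace :=
  @GMap G quot_gspace quot_gspace
    (fun c : collapse => \pi_collapse (f (repr c)) : collapse) _ _ _.
Next Obligation.
move=> f fA; apply: (@collapse_repr_continuous _ (fun x => \pi_collapse (f x))).
  move=> x; apply: continuous_comp; first exact: gmap_continuous.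
  exact: collapse_pi_continuous.
by move=> x y xA yA; apply/collapse_piP; right; split; exact: fA.
Qed.
Next Obligation.
move=> f fA g c /=; rewrite -[c in LHS]reprK collapse_act_pi.
rewrite collapse_act_pi -gmap_equivariant; apply/collapse_piP.
have : \pi_collapse (repr (\pi_collapse (gact g (repr c)))) =
   \pi_collapse (gact g (repr c)) by rewrite reprK.
move/collapse_piP => [->|[xA yA]]; first by left.
by right; split; exact: fA.
Qed.
Next Obligation.
move=> f fA /=; apply/collapse_piP.
have : \pi_collapse (repr (\pi_collapse gpt)) = \pi_collapse gpt.
  by rewrite reprK.
move/collapse_piP => [->|[xA yA]]; first by left; rewrite gmap_pt.
by right; split; [exact: fA | exact: inv_pt].
Qed.

End QuotientSpace.

Section DisjointBasePoint.
Context (T : topologicalType).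

(** T with a disjoint (isolated) base point [None]. *)
Definition add_point := option T.
HB.instance Definition _ := Choice.on add_point.

Definition add_point_open (U : set add_point) : Prop :=
  open ((Some : T -> add_point) @^-1` U).

Lemma add_point_openT : add_point_open setT.
Proof. exact: openT. Qed.

Lemma add_point_openI (U V : set add_point) :
  add_point_open U -> add_point_open V -> add_point_open (U `&` V).
Proof. exact: openI. Qed.

Lemma add_point_open_bigU (I : Type) (F : I -> set add_point) :
  (forall i, add_point_open (F i)) -> add_point_open (\bigcup_i F i).
Proof. by move=> oF; apply: bigcup_open => i _; exact: oF. Qed.

HB.instance Definition _ := isOpenTopological.Build add_point
  add_point_openT add_point_openI add_point_open_bigU.

End DisjointBasePoint.

Section EquivariantSpheres.
Context {G : topGroupType}.

Program Definition orbit_plus (H : closed_subgroup G) : gspace G :=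
  @GSpace G (add_point (orbit H)) (fun g => omap (@orbit_act G H g)) None
    _ _ _ _.
Next Obligation. by move=> H [c|] //=; rewrite orbit_act1. Qed.
Next Obligation. by move=> H g h [c|] //=; rewrite orbit_actM. Qed.
Next Obligation.
move=> H g; apply/continuousP => U oU.
suff : open (@orbit_act G H g @^-1` (Some @^-1` U)) by [].
by have /continuousP := @orbit_act_continuous G H g; apply.
Qed.
Next Obligation. by []. Qed.

Program Definition trivial_gspace (T : topologicalType) (x : T) : gspace G :=
  @GSpace G T (fun _ => id) x _ _ _ _.
Next Obligation. by []. Qed.
Next Obligation. by []. Qed.
Next Obligation. by move=> T x g y. Qed.
Next Obligation. by []. Qed.

Section Smash.
Context (X Y : gspace G).

Program Definition prod_gspace : gspace G :=
  @GSpace G (X * Y)%type (fun g p => (gact g p.1, gact g p.2)) (gpt, gpt)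
    _ _ _ _.
Next Obligation. by move=> [x y] /=; rewrite !gact1. Qed.
Next Obligation. by move=> g h [x y] /=; rewrite !gactM. Qed.
Next Obligation.
move=> g [x y]; apply: cvg_pair => /=.
  apply: (@cvg_comp _ _ _ fst (gact g)); first exact: cvg_fst.
  exact: gact_continuous.
apply: (@cvg_comp _ _ _ snd (gact g)); first exact: cvg_snd.
exact: gact_continuous.
Qed.
Next Obligation. by move=> g /=; rewrite !gact_pt. Qed.

Program Definition smash_axes : invariant_subset prod_gspace :=
  @InvariantSubset G prod_gspace [set p | p.1 = gpt \/ p.2 = gpt] _ _.
Next Obligation. by left. Qed.
Next Obligation.
by move=> g [x y] /= [->|->]; rewrite gact_pt; [left | right].
Qed.

Definition smash : gspace G := quot_gspace smash_axes.

End Smash.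

Section Wedge.
Context (n : nat) (X : 'I_n.+1 -> gspace G).

Definition wedge_carrier := wedge (fun i => @gpt G (X i)).

Definition wedge_incl i (x : X i) : wedge_carrier :=
  @wedge_lift _ X (fun i => @gpt G (X i)) i x.

Lemma wedge_incl_pt i j : wedge_incl (@gpt G (X i)) = wedge_incl (@gpt G (X j)).
Proof. exact: (@wedge_liftE _ _ (fun i => @gpt G (X i)) j gpt i gpt). Qed.

Definition wedge_act (g : G) : wedge_carrier -> wedge_carrier :=
  wedge_fun (fun i x => wedge_incl (gact g x)).

Lemma wedge_act_incl g i (x : X i) :
  wedge_act g (wedge_incl x) = wedge_incl (gact g x).
Proof.
rewrite /wedge_act /wedge_incl wedge_lift_funE // => k l.
by rewrite !gact_pt; exact: wedge_incl_pt.
Qed.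

Lemma wedge_inclP (w : wedge_carrier) : exists i (x : X i), w = wedge_incl x.
Proof.
have : [set: wedge_carrier] w by [].
by rewrite -wedgeTE => -[i _ [x _ <-]]; exists i, x.
Qed.

Program Definition wedge_gspace : gspace G :=
  @GSpace G wedge_carrier wedge_act (wedge_incl (@gpt G (X ord0))) _ _ _ _.
Next Obligation.
by move=> w; have [i [x ->]] := wedge_inclP w; rewrite wedge_act_incl gact1.
Qed.
Next Obligation.
move=> g h w; have [i [x ->]] := wedge_inclP w.
by rewrite !wedge_act_incl gactM.
Qed.
Next Obligation.
move=> g; apply: wedge_fun_continuous.
  move=> i x; apply: continuous_comp; first exact: gact_continuous.
  exact: wedge_lift_continuous.
by move=> i j; rewrite !gact_pt; exact: wedge_incl_pt.
Qed.
Next Obligation. by move=> g; rewrite wedge_act_incl gact_pt. Qed.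

End Wedge.
End EquivariantSpheres.

Section Disk.
Context (R : realType).

Definition sqnorm n (v : 'rV[R]_n) : R := (\sum_(i < n) v ord0 i ^+ 2)%R.

Definition disk_set n : set 'rV[R]_n := [set v | (sqnorm v <= 1)%R].
Arguments disk_set : clear implicits.
Definition disk n : Type := set_type (disk_set n).
HB.instance Definition _ n :=
  Topological.copy (disk n) (set_type (disk_set n)).

Definition sphere_set n : set 'rV[R]_n.+1 := [set v | sqnorm v = 1%R].
Arguments sphere_set : clear implicits.
Definition sphere n : Type := set_type (sphere_set n).
HB.instance Definition _ n :=
  Topological.copy (sphere n) (set_type (sphere_set n)).

Lemma sphere_pt_subproof n : (delta_mx ord0 ord0 : 'rV[R]_n.+1) \in sphere_set n.
Proof.
apply/mem_set; rewrite /sphere_set /= /sqnorm big_ord_recl /= mxE !eqxx expr1n.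
by rewrite big1 ?addr0 // => i _; rewrite mxE andbF expr0n.
Qed.

Definition sphere_pt n : sphere n :=
  exist (fun v => v \in sphere_set n) _ (sphere_pt_subproof n).

End Disk.
Arguments disk_set R n : clear implicits.
Arguments sphere_set R n : clear implicits.

Section CW.
Context (R : realType) {G : topGroupType}.

(** The base point is a 0-cell G/G * D^0; it is not listed in [cell] but belongs
    to every skeleton. [cell_map i] is the characteristic map
    G/H_i * D^(n_i) -> X. *)
Record cw_data (X : gspace G) := CWData {
  cell : finType;
  cell_dim : cell -> nat;
  cell_stab : cell -> closed_subgroup G;
  cell_map : forall i : cell, orbit (cell_stab i) * disk R (cell_dim i) -> X
}.
Arguments cell {X}.
Arguments cell_dim {X c}.
Arguments cell_stab {X c}.
Arguments cell_map {X c}.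

Section Skeleta.
Context {X : gspace G} (D : cw_data X).

Definition cell_interior (i : cell D) :
    set (orbit (cell_stab i) * disk R (cell_dim i)) :=
  [set p | (sqnorm (val p.2) < 1)%R].
Arguments cell_interior : clear implicits.

Definition cell_boundary (i : cell D) :
    set (orbit (cell_stab i) * disk R (cell_dim i)) :=
  [set p | sqnorm (val p.2) = 1%R].
Arguments cell_boundary : clear implicits.

Definition open_cell (i : cell D) : set X := cell_map i @` cell_interior i.
Arguments open_cell : clear implicits.

Definition closed_cell (i : cell D) : set X := range (cell_map i).
Arguments closed_cell : clear implicits.

(** [skeleton n] is the union of the base point and the cells of dimension < n,
    i.e. X^(n-1). *)
Definition skeleton (n : nat) : set X :=
  [set gpt] `|` \bigcup_(i in [set i : cell D | (cell_dim i < n)%N]) open_cell i.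
Arguments skeleton : clear implicits.

(** Equivalent to X^n being the pushout of X^(n-1) along the attaching maps
    G/H_i * S^(n-1) -> X^(n-1): the open cells and the base point partition X,
    cell boundaries lie in lower skeleta, and every skeleton is a closed subspace
    carrying the final topology of its own cells. Requiring [cw_coherent] for all
    n, and not only for X itself, is what makes the attaching maps continuous into
    the CW topology of X^(n-1). *)
Record is_cw : Prop := IsCW {
  cell_map_continuous : forall i : cell D, continuous (cell_map i);
  cell_map_equivariant : forall (i : cell D) g c v,
    cell_map i (orbit_act g c, v) = gact g (cell_map i (c, v));
  cell_map_inj : forall i : cell D, set_inj (cell_interior i) (cell_map i);
  open_cell_disjoint : trivIset [set: cell D] open_cell;
  open_cell_pt : forall i : cell D, ~ open_cell i gpt;
  cw_cover : [set gpt] `|` \bigcup_(i in [set: cell D]) open_cell i = [set: X];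
  cell_map_boundary : forall i : cell D,
    cell_map i @` cell_boundary i `<=` skeleton (cell_dim i);
  cw_coherent : forall n (C : set X), C `<=` skeleton n ->
    (forall i : cell D, (cell_dim i < n)%N -> closed (cell_map i @^-1` C)) ->
    closed C
}.

End Skeleta.
Arguments cell_interior {X D} i.
Arguments cell_boundary {X D} i.
Arguments open_cell {X D} i.
Arguments closed_cell {X D} i.
Arguments skeleton {X} D n.

Record finite_gcw := FiniteGCW {
  gcw_space :> gspace G;
  gcw_data : cw_data gcw_space;
  gcw_axioms : is_cw gcw_data
}.

Section CWTheory.
Context {X : finite_gcw}.
Local Notation D := (gcw_data X).
Let ax := gcw_axioms X.

Lemma interior_or_boundary (i : cell D) p :
  cell_interior i p \/ cell_boundary i p.
Proof.
case: p => c [v vP]; rewrite /cell_interior /cell_boundary /=.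
have : (sqnorm v <= 1)%R := set_mem vP.
by rewrite le_eqVlt => /orP[/eqP|]; [right | left].
Qed.

Lemma closed_cell_skeleton (i : cell D) n p :
  (cell_dim i < n)%N -> skeleton D n (cell_map i p).
Proof.
move=> lin; have [pI|pB] := interior_or_boundary p.
  by right; exists i => //; exists p.
have [->|[j /= lji jx]] : skeleton D (cell_dim i) (cell_map i p).
- by apply: (cell_map_boundary ax); exists p.
- by left.
- by right; exists j => //=; exact: ltn_trans lin.
Qed.

Lemma cells_closed (P : cell D -> Prop) (C : set X) :
  (forall i, P i -> closed (cell_map i @^-1` C)) ->
  (forall i x, ~ P i -> C x -> ~ open_cell i x) -> closed C.
Proof.
move=> PC nPC.
have clC n : closed (C `&` skeleton D n).
  have [m] := ubnP n; elim: m n => // m IH n ltnm.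
  apply: (cw_coherent ax (n := n)); first by move=> x [].
  move=> i lin; have [Pi|nPi] := pselect (P i).
    suff -> : cell_map i @^-1` (C `&` skeleton D n) = cell_map i @^-1` C.
      exact: PC.
    apply/seteqP; split => p /=; first by case.
    by move=> Cp; split => //; exact: closed_cell_skeleton.
  suff -> : cell_map i @^-1` (C `&` skeleton D n) =
            cell_map i @^-1` (C `&` skeleton D (cell_dim i)).
    apply: preimage_closed; first by move=> p _; exact: (cell_map_continuous ax).
    by apply: IH; rewrite (leq_trans lin).
  apply/seteqP; split => p /= [Cp skp]; split => //.
    have [pI|pB] := interior_or_boundary p.
      by have := nPC i _ nPi Cp; case; exists p.
    by apply: (cell_map_boundary ax); exists p.
  exact: closed_cell_skeleton.
suff -> : C = C `&` skeleton D (\max_(i : cell D) cell_dim i).+1 by [].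
apply/seteqP; split => x; last by case.
move=> Cx; split => //.
have [->|[i _ ix]] :
    ([set gpt] `|` \bigcup_(i in [set: cell D]) open_cell i) x.
- by rewrite (cw_cover ax).
- by left.
- by right; exists i => //=; rewrite ltnS; exact: leq_bigmax.
Qed.

End CWTheory.

(** A union of cells containing the closure of each of them. Since there are
    finitely many cells such a set is automatically closed ([sc_closed]), and it
    is G-invariant ([sc_act]). *)
Record subcomplex (X : finite_gcw) := Subcomplex {
  sc_set :> set X;
  sc_pt : sc_set gpt;
  sc_cells : forall x, sc_set x -> x = gpt \/
    exists i : cell (gcw_data X), open_cell i x /\ closed_cell i `<=` sc_set
}.

Section SubcomplexTheory.
Context {X : finite_gcw} (A : subcomplex X).
Local Notation D := (gcw_data X).
Let ax := gcw_axioms X.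

Lemma open_cell_closed_cell (i : cell D) : open_cell i `<=` closed_cell i.
Proof. by move=> x [p _ <-]; exists p. Qed.

Lemma open_cell_inj (i j : cell D) x : open_cell i x -> open_cell j x -> i = j.
Proof. by move=> ix jx; apply: (open_cell_disjoint ax) => //; exists x. Qed.

Lemma sc_open_cell (i : cell D) x :
  sc_set A x -> open_cell i x -> closed_cell i `<=` sc_set A.
Proof.
move=> Ax ix; have [xpt|[j [jx jA]]] := sc_cells Ax.
  by have := open_cell_pt ax (i := i); rewrite -xpt.
by rewrite (open_cell_inj ix jx).
Qed.

Lemma open_cell_act (i : cell D) g x : open_cell i x -> open_cell i (gact g x).
Proof.
move=> [[c v] vI <-]; exists (orbit_act g c, v) => //.
exact: (cell_map_equivariant ax).
Qed.

Lemma sc_act g x : sc_set A x -> sc_set A (gact g x).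
Proof.
move=> Ax; have [->|[i [ix iA]]] := sc_cells Ax.
  by rewrite gact_pt; exact: sc_pt.
exact/iA/open_cell_closed_cell/open_cell_act.
Qed.

Definition sc_invariant : invariant_subset X :=
  InvariantSubset (sc_pt A) sc_act.

Lemma sc_closed : closed (sc_set A).
Proof.
apply: (cells_closed (P := fun i => closed_cell i `<=` sc_set A)).
  move=> i iA; suff -> : cell_map i @^-1` sc_set A = setT by exact: closedT.
  by apply/seteqP; split => // p _; apply: iA; exists p.
by move=> i x niA Ax ix; apply: niA; exact: sc_open_cell ix.
Qed.

Definition in_sc (i : cell D) : bool := `[< closed_cell i `<=` sc_set A >].

Definition sub_cell : finType := {i : cell D | in_sc i}.

Lemma sub_cellP (i : sub_cell) p : cell_map (val i) p \in sc_set A.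
Proof. by apply/mem_set; move/asboolP: (valP i); apply; exists p. Qed.

Arguments sub_cellP : clear implicits.

Definition sub_cw_data : cw_data (sub_gspace sc_invariant) :=
  @CWData (sub_gspace sc_invariant) sub_cell
    (fun i => cell_dim (val i)) (fun i => cell_stab (val i))
    (fun i p => exist (fun x => x \in inv_set sc_invariant) _ (sub_cellP i p)).

Lemma sub_open_cell (i : cell sub_cw_data) x :
  open_cell i x <-> open_cell (val i) (val x).
Proof.
split=> [[p pI <-]|[p pI px]]; first by exists p.
by exists p => //; exact: val_inj.
Qed.

Lemma sub_skeleton n x :
  skeleton sub_cw_data n x <-> skeleton D n (val x).
Proof.
split=> [[->|[i lin ix]]|[xpt|[i lin ix]]].
- by left.
- by right; exists (val i) => //; exact/sub_open_cell.
- by left; exact: val_inj.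
- have iA : in_sc i by apply/asboolP; exact: sc_open_cell (set_mem (valP x)) ix.
  by right; exists (exist _ i iA : sub_cell) => //; apply/sub_open_cell.
Qed.

Lemma sub_is_cw : is_cw sub_cw_data.
Proof.
split.
- move=> i; apply: (@sub_continuous _ _ sc_invariant).
  exact: (cell_map_continuous ax).
- by move=> i g c v; apply: val_inj; rewrite /= (cell_map_equivariant ax).
- move=> i p q pI qI /(congr1 val) /=; exact: (cell_map_inj ax).
- move=> i j _ _ [x [/sub_open_cell ix /sub_open_cell jx]].
  exact/val_inj/(open_cell_inj ix jx).
- by move=> i /sub_open_cell; exact: (open_cell_pt ax).
- apply/seteqP; split => // x _.
  have [xpt|[i [ix iA]]] := sc_cells (set_mem (valP x)).
    by left; exact: val_inj.
  right; have iA' : in_sc i by exact/asboolP.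
  by exists (exist _ i iA' : sub_cell) => //; apply/sub_open_cell.
- move=> i x [p pB <-]; apply/sub_skeleton.
  by apply: (cell_map_boundary ax); exists p.
- move=> n C Cn Ccl.
  have clC : closed ((val : sub_gspace sc_invariant -> X) @` C).
    apply: (cells_closed (P := fun i => in_sc i /\ (cell_dim i < n)%N)).
      move=> i [iA lin]; have := Ccl (exist _ i iA : sub_cell) lin.
      congr closed; apply/seteqP; split => p /=.
        by move=> Cp; exists (exist (fun x => x \in sc_set A) _
          (sub_cellP (exist _ i iA : sub_cell) p)).
      by move=> [y Cy yp]; move: Cy; congr C; exact: val_inj.
    move=> i _ niP [x Cx <-] ix; apply: niP; split.
      by apply/asboolP; exact: sc_open_cell (set_mem (valP x)) ix.
    have [xpt|[j lj jx]] := Cn _ Cx.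
      by move: ix; rewrite xpt => /(open_cell_pt ax).
    by move/sub_open_cell : jx => /(open_cell_inj ix) ->.
  have -> : C = (val : sub_gspace sc_invariant -> X) @^-1` ((val : sub_gspace sc_invariant -> X) @` C).
    apply/seteqP; split => x; first by move=> Cx; exists x.
    by move=> [y Cy /val_inj <-].
  by apply: preimage_closed clC => x _; exact: sub_val_continuous.
Qed.

Definition sub_gcw : finite_gcw := FiniteGCW sub_is_cw.

Definition quot_cell : finType := {i : cell D | ~~ in_sc i}.

Definition quot_cw_data : cw_data (quot_gspace sc_invariant) :=
  @CWData (quot_gspace sc_invariant) quot_cell
    (fun i => cell_dim (val i)) (fun i => cell_stab (val i))
    (fun i p => \pi_(collapse sc_invariant) (cell_map (val i) p)).

Local Notation q := (\pi_(collapse sc_invariant) : X -> quot_gspace sc_invariant).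

Lemma quot_cell_notin (i : quot_cell) x : open_cell (val i) x -> ~ sc_set A x.
Proof.
move=> ix Ax; move/negP: (valP i); apply; apply/asboolP.
exact: sc_open_cell ix.
Qed.

Lemma quot_open_cell (i : cell quot_cw_data) x :
  open_cell i (q x) <-> open_cell (val i) x.
Proof.
split=> [[p pI /collapse_piP]|[p pI px]]; last by exists p => //=; rewrite px.
have ip : open_cell (val i) (cell_map (val i) p) by exists p.
by move=> [<-//|[/(quot_cell_notin ip)]].
Qed.

Lemma quot_ptP x : q x = gpt <-> sc_set A x.
Proof.
split=> [/collapse_piP[->|[]//]|Ax]; first exact: sc_pt.
by apply/collapse_piP; right; split => //; exact: sc_pt.
Qed.

Lemma quot_surj (y : quot_gspace sc_invariant) : exists x, y = q x.
Proof. by exists (repr (y : collapse sc_invariant)); rewrite reprK. Qed.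

Lemma quot_skeleton n x :
  skeleton quot_cw_data n (q x) <-> sc_set A x \/ skeleton D n x.
Proof.
split.
  move=> [/quot_ptP Ax|[i lin /quot_open_cell ix]]; first by left.
  by right; right; exists (val i).
move=> [Ax|[->|[i lin ix]]]; first by left; exact/quot_ptP.
  by left; apply/quot_ptP; exact: sc_pt.
have [iA|niA] := boolP (in_sc i).
  left; apply/quot_ptP; move/asboolP: iA; apply.
  exact: open_cell_closed_cell.
by right; exists (exist _ i niA : quot_cell) => //; apply/quot_open_cell.
Qed.

Lemma quot_is_cw : is_cw quot_cw_data.
Proof.
split.
- move=> i p; apply: (@continuous_comp _ _ _ _ q).
    exact: (cell_map_continuous ax).
  exact: collapse_pi_continuous.
- by move=> i g c v; rewrite /= (cell_map_equivariant ax) collapse_act_pi.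
- move=> i p p' pI p'I /collapse_piP[|[]].
    exact: (cell_map_inj ax).
  have ip : open_cell (val i) (cell_map (val i) p).
    by exists p => //; exact: set_mem.
  by move=> /(quot_cell_notin ip).
- move=> i j _ _ [y []]; have [x ->] := quot_surj y.
  move=> /quot_open_cell ix /quot_open_cell jx.
  exact/val_inj/(open_cell_inj ix jx).
- move=> i /quot_open_cell; exact: (open_cell_pt ax).
- apply/seteqP; split => // y _; have [x ->] := quot_surj y.
  have [Ax|nAx] := pselect (sc_set A x); first by left; exact/quot_ptP.
  have : ([set gpt] `|` \bigcup_(i in [set: cell D]) open_cell i) x.
    by rewrite (cw_cover ax).
  move=> [xpt|[i _ ix]]; first by case: nAx; rewrite xpt; exact: sc_pt.
  have niA : ~~ in_sc i.
    by apply/asboolP => iA; apply: nAx; exact/iA/open_cell_closed_cell.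
  by right; exists (exist _ i niA : quot_cell) => //; apply/quot_open_cell.
- move=> i y [p pB <-]; apply/quot_skeleton; right.
  by apply: (cell_map_boundary ax); exists p.
- move=> n C Cn Ccl.
  suff : closed (q @^-1` C).
    by move=> qC; rewrite -[C]setCK; apply: open_closedC; exact: closed_openC qC.
  apply: (cells_closed
    (P := fun i => in_sc i \/ (cell_dim i < n)%N)).
    move=> i iP; have [iA|niA] := boolP (in_sc i).
      have iAp p : q (cell_map i p) = gpt.
        by apply/quot_ptP; move/asboolP: iA; apply; exists p.
      have [Cpt|nCpt] := pselect (C gpt).
        suff -> : cell_map i @^-1` (q @^-1` C) = setT by exact: closedT.
        by apply/seteqP; split => // p _; rewrite /preimage /= iAp.
      suff -> : cell_map i @^-1` (q @^-1` C) = set0 by exact: closed0.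
      by apply/seteqP; split => // p; rewrite /preimage /= iAp.
    case: iP => [iA|lin]; first by rewrite iA in niA.
    exact: (Ccl (exist _ i niA : quot_cell) lin).
  move=> i x /not_orP[niA nlin] /= Cqx ix.
  have /quot_skeleton[Ax|[xpt|[j lj jx]]] := Cn _ Cqx.
  + by apply: niA; apply/asboolP; exact: sc_open_cell ix.
  + by move: ix; rewrite xpt; exact: (open_cell_pt ax).
  + by apply: nlin; rewrite (open_cell_inj ix jx).
Qed.

Definition quot_gcw : finite_gcw := FiniteGCW quot_is_cw.

End SubcomplexTheory.
End CW.

Arguments cell {R G X}.
Arguments cell_dim {R G X c}.
Arguments cell_stab {R G X c}.
Arguments cell_map {R G X c} i.
Arguments cell_interior {R G X D} i.
Arguments cell_boundary {R G X D} i.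
Arguments open_cell {R G X D} i.
Arguments closed_cell {R G X D} i.
Arguments skeleton {R G X} D n.
Arguments finite_gcw R G : clear implicits.
Arguments subcomplex {R G} X.

Section JointContinuity.
Context (R : realType) {G : topGroupType}.

Lemma mulg_right_continuous (h : G) : continuous (fun x : G => x * h).
Proof.
move=> x; apply: (@continuous_comp _ _ _ (fun x : G => (x, h))
  (fun p : G * G => p.1 * p.2)); last exact: mulg_continuous.
by apply: cvg_pair => //=; exact: cvg_cst.
Qed.

Lemma orbit_pi_nbhs (H : closed_subgroup G) (x : G) (U : set G) :
  nbhs x U -> nbhs (\pi_(orbit H) x) [set \pi_(orbit H) y | y in U].
Proof.
rewrite nbhsE => -[V [oV Vx] VU]; rewrite nbhsE /=; exists [set \pi_(orbit H) y | y in V].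
  split; last by exists x.
  change (open (\pi_(orbit H) @^-1` [set \pi_(orbit H) y | y in V])).
  have -> : \pi_(orbit H) @^-1` [set \pi_(orbit H) y | y in V] =
      \bigcup_(h in [set h | h \in csg_set H]) ((fun y => y * h) @^-1` V).
    apply/seteqP; split => y /=.
      move=> [z Vz zy]; exists (y^-1 * z) => /=; last by rewrite mulVKg.
      by apply/orbit_piE; exact: esym.
    move=> [h /= hH Vyh]; exists (y * h) => //; apply/orbit_piE.
    by rewrite invgM mulgVK gpredV.
  apply: bigcup_open => h _; apply: open_comp => // y _.
  exact: mulg_right_continuous.
by move=> _ [y Vy <-]; exists y => //; exact: VU.
Qed.

Lemma orbit_act_joint_continuous (H : closed_subgroup G) :
  continuous (fun p : G * orbit H => orbit_act p.1 p.2).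
Proof.
move=> [g c] W /= Wgc; rewrite -[c]reprK in Wgc *.
set x := repr c in Wgc *; rewrite orbit_act_pi in Wgc.
have : nbhs (g, x) ((fun p : G * G => p.1 * p.2) @^-1` (\pi_(orbit H) @^-1` W)).
  by apply: (mulg_continuous (g, x)); exact: pi_continuous.
move=> [[P Q] /= [Pg Qx] PQ].
exists (P, [set \pi_(orbit H) y | y in Q]); first by split => //; exact: orbit_pi_nbhs.
move=> [a _] /= [Pa [y Qy <-]]; rewrite orbit_act_pi; exact: (PQ (a, y)).
Qed.

Import ArrowAsCompactOpen.

Lemma continuous_pairing (A B C : topologicalType) (f : A -> B) (h : A -> C) :
  continuous f -> continuous h -> continuous (fun a => (f a, h a)).
Proof. by move=> cf ch a; apply: cvg_pair; [exact: cf | exact: ch]. Qed.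

Lemma continuous_comp_all (A B C : topologicalType) (f : A -> B) (h : B -> C) :
  continuous f -> continuous h -> continuous (fun a => h (f a)).
Proof. by move=> cf ch a; apply: continuous_comp; [exact: cf | exact: ch]. Qed.

Lemma continuous_fst (A B : topologicalType) : continuous (@fst A B).
Proof. by move=> a; exact: cvg_fst. Qed.

Lemma continuous_snd (A B : topologicalType) : continuous (@snd A B).
Proof. by move=> a; exact: cvg_snd. Qed.

Lemma gcw_act_joint_continuous (X : finite_gcw R G) :
  locally_compact [set: G] -> hausdorff_space G ->
  continuous (fun p : G * X => gact p.1 p.2).
Proof.
move=> lcG hG; have ax := gcw_axioms X.
pose F (i : cell (gcw_data X)) (p : (orbit (cell_stab i) * disk R (cell_dim i)) * G) : X :=
  gact p.2 (cell_map i p.1).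
have cF i : continuous (F i).
  have -> : F i = cell_map i \o (fun p => (orbit_act p.2 p.1.1, p.1.2)).
    by apply/funext => -[[c v] g]; rewrite /F /= -(cell_map_equivariant ax).
  apply: continuous_comp_all; last exact: (cell_map_continuous ax).
  apply: continuous_pairing; last first.
    by apply: continuous_comp_all; [exact: continuous_fst|exact: continuous_snd].
  apply: (@continuous_comp_all _ _ _ (fun p : (orbit (cell_stab i) * disk R (cell_dim i)) * G => (p.2, p.1.1)) (fun p => orbit_act p.1 p.2)).
    apply: continuous_pairing; first exact: continuous_snd.
    by apply: continuous_comp_all; exact: continuous_fst.
  exact: orbit_act_joint_continuous.
pose f (x : X) (g : G) : X := gact g x.
have cf : continuous (f : X -> G -> X).
  apply/continuous_closedP => C cC.
  apply: (@cells_closed _ _ X (fun _ => True)) => // i _.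
  rewrite -comp_preimage.
  have -> : f \o cell_map i = curry (F i) by [].
  have /continuous_closedP := continuous_curry_fun (cF i); exact.
have cfx x : continuous (f x).
  have [->|[i _ [p _ <-]]] :
    ([set gpt] `|` \bigcup_(i in [set: cell (gcw_data X)]) open_cell i) x.
  - by rewrite (cw_cover ax).
  - have -> : f gpt = cst gpt by apply/funext => g; exact: gact_pt.
    exact: cst_continuous.
  - by have [_ /(_ p)] := continuous_curry (cF i).
have cu := continuous_uncurry lcG hG cf cfx.
apply: (@continuous_comp_all _ _ _ (fun p : G * X => (p.2, p.1)) (uncurry f)) => //.
by apply: continuous_pairing; [exact: continuous_snd|exact: continuous_fst].
Qed.
End JointContinuity.

Section LefschetzNumber.
Context (R : realType) (G : topGroupType) (B : zmodType).

Definition assignment := forall X : finite_gcw R G, gmap X X -> B.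

Implicit Type l : assignment.

Definition homotopy_invariance l : Prop :=
  forall (X Y : finite_gcw R G) (k : gmap X Y) (f : gmap X X) (h : gmap Y Y),
    ghomotopy_equivalence R k -> ghomotopic R (gcomp k f) (gcomp h k) ->
    l X f = l Y h.

Definition cofibration_axiom l : Prop :=
  forall (X : finite_gcw R G) (A : subcomplex X) (f : gmap X X)
    (fA : set_fun (sc_set A) (sc_set A) f),
    l X f = (l (sub_gcw A) (gmap_restrict (A := sc_invariant A) fA)
             + l (quot_gcw A) (gmap_induced (A := sc_invariant A) fA))%R.

Definition commutativity l : Prop :=
  forall (X Y : finite_gcw R G) (f : gmap X Y) (h : gmap Y X),
    l X (gcomp h f) = l Y (gcomp f h).

Record equivariant_lefschetz_number l : Prop := EquivariantLefschetzNumber {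
  eln_homotopy : homotopy_invariance l;
  eln_cofibration : cofibration_axiom l;
  eln_commutativity : commutativity l
}.

End LefschetzNumber.

Definition equivariant_1sphere (R : realType) (G : topGroupType)
    (H : closed_subgroup G) : gspace G :=
  smash (orbit_plus H) (trivial_gspace (sphere_pt R 1)).

(** Up to pointed G-homeomorphism, hence independent of the chosen models of
    smash product, circle and wedge, and for any cell structure on X. *)
Definition wedge_of_1spheres (R : realType) (G : topGroupType)
    (X : gspace G) : Prop :=
  exists (n : nat) (H : 'I_n.+1 -> closed_subgroup G),
    ghomeomorphic X (wedge_gspace (fun i => equivariant_1sphere R (H i))).

(* Main.v *)
(** The difference [l] of two Lefschetz numbers is additive, commutative and
    homotopy invariant, and vanishes on wedges of 1-spheres; we show that it
    vanishes identically.  Cellular approximation and additivity reduce this to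
    complexes all of whose cells have the same dimension [k].  To deform a map
    below dimension [k], its coordinates on the open [k]-cells are made
    Lipschitz on lower cells, where they miss a point by counting grid points;
    the [k]-cells are then blown up around that point.
    For [k = 1] the complex is a wedge of 1-spheres, and a complex of dimension
    [0] is the top of its cone, which is contractible with a quotient of
    dimension [1].  For [k >= 2] cut every cell along its equator into two
    halves.  Any self-map is homotopic to one that respects both halves: after
    a perturbation, the points sent near the centres of upper halves and those
    sent near the centres of lower halves lie on distinct vertical lines, and
    can be pushed vertically to the correct side.  The halves are contractible,
    so the value of [l] is minus its value on the equators, of dimension
    [k - 1]. *)
Require Import Defs.
From mathcomp Require Import all_boot all_order all_algebra.
From mathcomp Require Import all_classical reals topology.
From mathcomp Require Import normedtype realfun homotopy numfun interval_inference.
From mathcomp Require Import ring lra zify.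

Set Implicit Arguments.
Unset Strict Implicit.
Unset Printing Implicit Defensive.

Import Order.TTheory GRing.Theory Num.Theory.
Import numFieldNormedType.Exports.

Local Open Scope classical_set_scope.
Local Open Scope quotient_scope.
Local Open Scope ring_scope.

(** The orbits [G/H] carry an arbitrary topology, so the proof uses neither homotopy groups nor
    desuspension, and every deformation acts on disk coordinates alone. The coordinate of a point in
    the top cells, damped to 0 near their boundary, is a [G]-invariant function, and changing it by
    an invariant amount is an equivariant move. It is therefore enough to approximate functions with
    values in a vector space on one disk per cell; equivariance comes for free. Cutting along
    equators takes the place of desuspension, since it only asks the map to preserve two
    subcomplexes. The price is the bound [k >= 2]: two points of a [k]-disk on a common vertical
    line depend on [k + 1] parameters, their two images on [2 k], and missing a point requires
    [k + 1 < 2 k]. This is why the induction starts at [k = 1], where the prescribed values enter,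
    and why dimension 0, which lies below the start, is reached from dimension 1 through the
    cone. *)

Section ContinuityToolkit.
Context {T : topologicalType}.

Lemma cont_cst (U : topologicalType) (u : U) : continuous (fun _ : T => u).
Proof. by move=> x; exact: cvg_cst. Qed.

Lemma contD (R : numFieldType) (V : normedModType R) (f g : T -> V) :
  continuous f -> continuous g -> continuous (fun x => f x + g x).
Proof. by move=> cf cg x; apply: cvgD; [exact: cf | exact: cg]. Qed.

Lemma contN (R : numFieldType) (V : normedModType R) (f : T -> V) :
  continuous f -> continuous (fun x => - f x).
Proof. by move=> cf x; apply: cvgN; exact: cf. Qed.

Lemma contZ (R : numFieldType) (V : normedModType R) (k : T -> R) (f : T -> V) :
  continuous k -> continuous f -> continuous (fun x => k x *: f x).
Proof. by move=> ck cf x; apply: cvgZ; [exact: ck | exact: cf]. Qed.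

Lemma cont_norm (R : numFieldType) (V : normedModType R) (f : T -> V) :
  continuous f -> continuous (fun x => `|f x|).
Proof. by move=> cf x; apply: cvg_norm; exact: cf. Qed.

Context {R : realType}.

Lemma contM (f g : T -> R) :
  continuous f -> continuous g -> continuous (fun x => f x * g x).
Proof. by move=> cf cg x; apply: cvgM; [exact: cf | exact: cg]. Qed.

Lemma cont_max (f g : T -> R) :
  continuous f -> continuous g -> continuous (fun x => Num.max (f x) (g x)).
Proof. by move=> cf cg x; apply: continuous_max; [exact: cf|exact: cg]. Qed.

Lemma cont_min (f g : T -> R) :
  continuous f -> continuous g -> continuous (fun x => Num.min (f x) (g x)).
Proof. by move=> cf cg x; apply: continuous_min; [exact: cf|exact: cg]. Qed.

Lemma contX (f : T -> R) n : continuous f -> continuous (fun x => f x ^+ n).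
Proof.
move=> cf; elim: n => [|n IH].
  by under eq_fun do rewrite expr0; exact: cst_continuous.
by under eq_fun do rewrite exprS; apply: contM.
Qed.

Lemma cont_sqrt (f : T -> R) :
  continuous f -> continuous (fun x => Num.sqrt (f x)).
Proof.
by move=> cf; apply: continuous_comp_all => //; exact: sqrt_continuous.
Qed.

Lemma contV (f : T -> R) : (forall x, f x != 0) ->
  continuous f -> continuous (fun x => (f x)^-1).
Proof. by move=> f0 cf x; apply: cvgV => //; exact: cf. Qed.

Lemma cont_sum (I : finType) (f : I -> T -> R) :
  (forall i, continuous (f i)) -> continuous (fun x => \sum_i f i x).
Proof.
move=> cf; elim: (index_enum I) => [|i r IH].
  by under eq_fun do rewrite big_nil; exact: cst_continuous.
by under eq_fun do rewrite big_cons; apply: contD.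
Qed.

Lemma cont_coord m n (f : T -> 'M[R]_(m, n)) i j :
  continuous f -> continuous (fun x => f x i j).
Proof.
move=> cf; apply: (continuous_comp_all (h := fun M : 'M[R]_(m, n) => M i j)) => //.
exact: coord_continuous.
Qed.

Lemma cont_mx m n (f : T -> 'M[R]_(m, n)) :
  (forall i j, continuous (fun x => f x i j)) -> continuous f.
Proof.
move=> cf x A /= [P Pf PA].
apply: (@filterS _ _ _ [set y | forall i j, P i j (f y i j)]).
  by move=> y Py; apply: PA.
apply: filter_forall => i; apply: filter_forall => j.
by apply: cf; exact: Pf.
Qed.

End ContinuityToolkit.

(** * Euclidean vectors and the radial projection onto the disk *)

Section Vectors.
Context {R : realType}.
Implicit Types n : nat.

Lemma sqnorm_ge0 n (v : 'rV[R]_n) : 0 <= sqnorm v.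
Proof. by apply: sumr_ge0 => i _; exact: sqr_ge0. Qed.

Lemma sqnormZ n a (v : 'rV[R]_n) : sqnorm (a *: v) = a ^+ 2 * sqnorm v.
Proof.
by rewrite /sqnorm mulr_sumr; apply: eq_bigr => i _; rewrite mxE exprMn.
Qed.

Lemma sqnorm0 n : sqnorm (0 : 'rV[R]_n) = 0.
Proof. by rewrite -(scale0r 0) sqnormZ expr0n mul0r. Qed.

Lemma sqnorm_continuous n : continuous (@sqnorm R n).
Proof.
by apply: cont_sum => i; apply: contX; exact: coord_continuous.
Qed.

Lemma le_coord_norm n (v : 'rV[R]_n) j : `|v ord0 j| <= `|v|.
Proof.
by rewrite [leRHS]/Num.norm /= mx_normrE; apply/bigmax_geP; right => /=; exists (ord0, j).
Qed.

Lemma norm_le_coord n (v : 'rV[R]_n) e :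
  0 <= e -> (forall j, `|v ord0 j| <= e) -> `|v| <= e.
Proof.
move=> e0 ve; rewrite [leLHS]/Num.norm /= mx_normrE; apply/bigmax_leP; split => //.
by move=> [i j] _ /=; rewrite ord1.
Qed.

(** The norm of a row vector is the maximum norm, which suits grids and Lipschitz bounds, while
    disks and spheres are Euclidean. This bound and [norm_le_sqnorm] pass between the two. *)
Lemma sqnorm_le_norm n (v : 'rV[R]_n) : sqnorm v <= n%:R * `|v| ^+ 2.
Proof.
rewrite -[n in n%:R]card_ord -sum1_card natr_sum mulr_suml.
apply: ler_sum => i _; rewrite mul1r -real_normK ?num_real //.
by rewrite ler_sqr ?nnegrE ?le_coord_norm.
Qed.

Lemma norm_le_sqnorm n (v : 'rV[R]_n) : `|v| ^+ 2 <= sqnorm v.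
Proof.
suff : `|v| <= Num.sqrt (sqnorm v).
  by rewrite -ler_sqr ?nnegrE ?sqrtr_ge0 // sqr_sqrtr ?sqnorm_ge0.
apply: norm_le_coord => [|j]; first exact: sqrtr_ge0.
rewrite -(ler_sqr (normr_ge0 _)) ?nnegrE ?sqrtr_ge0 // sqr_sqrtr ?sqnorm_ge0 //.
rewrite real_normK ?num_real // /sqnorm (bigD1 j) //= lerDl.
by apply: sumr_ge0 => i _; exact: sqr_ge0.
Qed.

(** The retraction onto the unit ball. Composed with it, any vector formula defines a map into the
    disk, and a formula whose value leaves the ball ends on the sphere. *)
Definition radproj n (v : 'rV[R]_n) : 'rV[R]_n :=
  (Num.max 1 (Num.sqrt (sqnorm v)))^-1 *: v.

Lemma radproj_id n (v : 'rV[R]_n) : sqnorm v <= 1 -> radproj v = v.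
Proof.
move=> v1; rewrite /radproj max_l ?invr1 ?scale1r //.
by rewrite -sqrtr1 ler_sqrt.
Qed.

Lemma sqnorm_radproj1 n (v : 'rV[R]_n) : 1 <= sqnorm v -> sqnorm (radproj v) = 1.
Proof.
move=> v1; rewrite /radproj max_r; last by rewrite -[leLHS]sqrtr1 ler_sqrt ?sqnorm_ge0.
rewrite sqnormZ exprVn sqr_sqrtr ?sqnorm_ge0 // mulVf //.
by rewrite gt_eqF // (lt_le_trans _ v1).
Qed.

Lemma sqnorm_radproj n (v : 'rV[R]_n) : sqnorm (radproj v) <= 1.
Proof.
have [v1|/ltW v1] := leP (sqnorm v) 1; first by rewrite radproj_id.
by rewrite sqnorm_radproj1.
Qed.

Lemma sqnorm_radproj_lt1 n (v : 'rV[R]_n) :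
  sqnorm (radproj v) < 1 -> sqnorm v < 1 /\ radproj v = v.
Proof.
move=> pv; have v1 : sqnorm v < 1.
  by rewrite ltNge; apply/negP => /sqnorm_radproj1 E; rewrite E ltxx in pv.
by split => //; rewrite radproj_id // ltW.
Qed.

Lemma radproj_continuous n : continuous (@radproj n).
Proof.
apply: contZ; last by move=> x.
apply: contV => [x|]; first by rewrite gt_eqF // lt_max ltr01.
apply: cont_max; first exact: cst_continuous.
by apply: cont_sqrt; exact: sqnorm_continuous.
Qed.

Lemma radproj_disk n (v : 'rV[R]_n) : radproj v \in disk_set R n.
Proof. by apply/mem_set; exact: sqnorm_radproj. Qed.

Definition projd n (v : 'rV[R]_n) : disk R n := exist _ (radproj v) (radproj_disk v).

Lemma disk_val_continuous n : continuous (val : disk R n -> 'rV[R]_n).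
Proof. exact: initial_continuous. Qed.

Lemma cont_disk (T : topologicalType) n (f : T -> disk R n) :
  continuous (fun x => val (f x)) -> continuous f.
Proof. exact: continuous_comp_initial. Qed.

Lemma projd_continuous n : continuous (@projd n).
Proof. apply: cont_disk; exact: radproj_continuous. Qed.

Lemma diskP n (v : disk R n) : sqnorm (val v) <= 1.
Proof. by case: v => v vP; exact: set_mem. Qed.

Lemma projdK n (v : disk R n) : projd (val v) = v.
Proof. by apply: val_inj; apply: radproj_id; exact: diskP. Qed.

End Vectors.

(** * Lipschitz maps on disks *)

Section Compactness.
Context {R : realType}.

Lemma disk_set_compact n : compact (disk_set R n).
Proof.
apply: bounded_closed_compact.
  exists 1; split => // M M1 v /= v1; rewrite ltW // (le_lt_trans _ M1) //.
  by rewrite -(@ler_pXn2r _ 2) ?nnegrE // expr1n (le_trans (norm_le_sqnorm v)).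
have -> : disk_set R n = @sqnorm R n @^-1` [set t | t <= 1] by [].
apply: closed_comp => [v _|]; first exact: sqnorm_continuous.
exact: closed_le.
Qed.

Lemma locally_compact_rV n : locally_compact [set: 'rV[R]_n].
Proof.
move=> x _; rewrite withinET; exists (closed_ball x 1).
  by apply/nbhs_closedballP; exists (PosNum (@ltr01 R)).
split; last exact: closed_ball_closed.
apply: bounded_closed_compact; last exact: closed_ball_closed.
exists (`|x| + 1); split => [|M M1 v]; first exact: num_real.
rewrite closed_ballE // /closed_ball_ /= => xv.
rewrite ltW // (le_lt_trans _ M1) //.
have -> : v = x - (x - v) by rewrite opprB addrC subrK.
by rewrite (le_trans (ler_normB _ _)) // lerD2l.
Qed.

Lemma compact_uniform_continuity (V W : normedModType R) (K : set V) (g : V -> W) (e : R) :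
  compact K -> continuous g -> 0 < e ->
  exists2 eta, 0 < eta & forall x y, K x -> `|x - y| < eta -> `|g x - g y| < e.
Proof.
move=> cK cg e0.
have /compact_near_coveringP/(_ R 0^'+ (fun eta x =>
    forall y, `|x - y| < eta -> `|g x - g y| < e) _) := cK.
case=> [x Kx|eta/= eta0 etaP].
  have e20 : 0 < e / 2 by rewrite divr_gt0.
  have /cvgrPdist_lt/(_ _ e20)/nbhs_ballP[d /= d0 dP] := cg x.
  have d20 : 0 < d / 2 by rewrite divr_gt0.
  near=> z eta => y zy.
  have xz : `|x - z| < d / 2.
    by near: z; apply/nbhs_ballP; exists (d / 2) => //= z; rewrite -ball_normE.
  have etad : eta < d / 2 by near: eta; exact: nbhs_right_lt.
  have gz : `|g x - g z| < e / 2.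
    by apply: dP; rewrite -ball_normE /= (lt_le_trans xz) // ler_pdivrMr // ler_peMr ?ler1n // ltW.
  have gy : `|g x - g y| < e / 2.
    apply: dP; rewrite -ball_normE /= -[x - y](subrKA z).
    rewrite (le_lt_trans (ler_normD _ _)) // [ltRHS]splitr ltrD //.
    exact: lt_trans zy _.
  rewrite -[g z - g y](subrKA (g x)) (le_lt_trans (ler_normD _ _)) //.
  by rewrite [ltRHS]splitr ltrD // distrC.
exists (eta / 2); first by rewrite divr_gt0.
move=> x y Kx xy; apply: (etaP (eta / 2)) => //=; last by rewrite divr_gt0.
by rewrite sub0r normrN gtr0_norm ?divr_gt0 // ltr_pdivrMr // ltr_pMr // ltr1n.
Unshelve. all: by end_near. Qed.

(** Compactness of the disk, in near-covering form: around an interior point the condition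
    [r <= sqnorm v] fails for [r] close to 1, around a boundary point [g] is small by continuity. *)
Lemma disk_collar n (g : disk R n -> R) (e : R) : continuous g -> 0 < e ->
  (forall v : disk R n, sqnorm (val v) = 1 -> g v = 0) ->
  exists r, [/\ 0 <= r, r < 1 & forall v : disk R n, r <= sqnorm (val v) -> `|g v| < e].
Proof.
move=> cg e0 gb.
have /compact_near_coveringP/(_ R 1^'- (fun r (v : 'rV[R]_n) =>
    r <= sqnorm v -> `|g (projd v)| < e) _) := @disk_set_compact n.
case=> [v Kv|r/= r0 rP].
  have [v1|v1] := ltP (sqnorm v) 1.
    have [s vs s1] : exists2 s, sqnorm v < s & s < 1.
      by exists ((sqnorm v + 1) / 2); lra.
    near=> w r => rw.
    have : s < r by near: r; exact: nbhs_left_gt.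
    have : sqnorm w < s.
      by near: w; apply: (cvgr_lt (sqnorm v)) => //; exact: sqnorm_continuous.
    by move=> ws sr; have := lt_trans (lt_le_trans sr rw) ws; rewrite ltxx.
  have vE : sqnorm (val (projd v)) = 1 by exact: sqnorm_radproj1.
  have gw : \forall w \near v, `|g (projd w)| < e.
    have cgp : continuous (g \o @projd R n).
      exact: continuous_comp_all (@projd_continuous R n) cg.
    have := cgp v; move=> /cvgrPdist_lt/(_ _ e0); apply: filterS => w.
    by rewrite /= (gb _ vE) sub0r normrN.
  near=> w r => _.
  have : `|g (projd w)| < e by near: w.
  by [].
(* Here [r] is a distance to 1 that may exceed 2, hence the truncation at 0. *)
pose s := Num.max (1 - r / 2) 0.
exists s; split; first by rewrite le_max lexx orbT.
  by rewrite gt_max ltr01 andbT ltrBlDr ltrDl divr_gt0.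
have [s' [s's s'1 s'r]] : exists s', [/\ s' <= s, s' < 1 & `|1 - s'| < r].
  exists (1 - r / 2); split; first by rewrite le_max lexx.
    by rewrite ltrBlDr ltrDl divr_gt0.
  rewrite opprB addrCA subrr addr0 gtr0_norm ?divr_gt0 //.
  by rewrite ltr_pdivrMr // ltr_pMr // ltr1n.
move=> v sv; have := rP s' s'r s'1 (val v) (diskP v) (le_trans s's sv).
by rewrite projdK.
Unshelve. all: by end_near. Qed.

Lemma inf_lipschitz (V : normedModType R) (Y : Type) (K : set Y) (F : Y -> V -> R) C :
  K !=set0 -> (forall x, has_lbound [set F y x | y in K]) ->
  (forall y x x', K y -> F y x <= F y x' + C * `|x - x'|) ->
  forall x x', `|inf [set F y x | y in K] - inf [set F y x' | y in K]| <= C * `|x - x'|.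
Proof.
move=> [y0 Ky0] lb FC.
have H x x' : inf [set F y x | y in K] <= inf [set F y x' | y in K] + C * `|x - x'|.
  rewrite -lerBlDr; apply: lb_le_inf; first by exists (F y0 x'), y0.
  move=> _ [y Ky <-]; rewrite lerBlDr (le_trans _ (FC y _ _ Ky)) //.
  by apply: ge_inf => //; exists y.
move=> x x'; have h1 := H x x'; have h2 := H x' x; rewrite distrC in h2.
by rewrite ler_norml; lra.
Qed.

Definition lipschitz_map (V W : normedModType R) (C : R) (f : V -> W) :=
  forall x y, `|f x - f y| <= C * `|x - y|.

(** Each coordinate of [L] is an inf-convolution: the infimum over [y] of [g y + C * |x - y|] is
    [C]-Lipschitz and at most [g x]. Points [y] within [eta] of [x] lower it by at most [e], by
    uniform continuity, and more distant ones cannot lower it at all. *)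
Lemma lipschitz_approx (m n : nat) (K : set 'rV[R]_m) (g : 'rV[R]_m -> 'rV[R]_n) (e : R) :
  compact K -> K !=set0 -> continuous g -> 0 < e ->
  exists L C, [/\ 0 <= C, lipschitz_map C (L : 'rV[R]_m -> 'rV[R]_n)
    & forall x, K x -> `|L x - g x| <= e].
Proof.
move=> cK K0 cg e0.
have [eta eta0 etaP] := compact_uniform_continuity cK cg e0.
have [M M0 MP] : exists2 M, 0 <= M & forall x, K x -> `|g x| <= M.
  have : compact (g @` K).
    by apply: continuous_compact cK; apply: continuous_subspaceT.
  move=> /compact_bounded[M [Mr MP]].
  exists (`|M| + 1); first by rewrite addr_ge0.
  by move=> x Kx; apply: MP; [rewrite (le_lt_trans (ler_norm _)) // ltrDl|exists x].
(* Beyond distance [eta] the penalty is at least [2 * M], which bounds the oscillation of [g] on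
   [K]. *)
pose C := 2 * M / eta; have C0 : 0 <= C by rewrite divr_ge0 ?mulr_ge0 // ltW.
pose F (k : 'I_n) (y x : 'rV[R]_m) := g y ord0 k + C * `|x - y|.
have FK : forall k x y, K y -> - M <= F k y x.
  move=> k x y Ky; rewrite -[leLHS]addr0 lerD ?(mulr_ge0 C0) //.
  have := le_trans (le_coord_norm (g y) k) (MP _ Ky).
  by rewrite ler_norml => /andP[].
have lbF : forall (k : 'I_n) z, has_lbound [set F k y z | y in K].
  by move=> k z; exists (- M) => _ [y Ky <-]; exact: FK.
exists (fun x => \row_j inf [set F j y x | y in K]), C; split => //.
  move=> x y; apply: norm_le_coord => [|j]; first by rewrite mulr_ge0.
  rewrite !mxE; apply: inf_lipschitz => //.
  move=> z {}x {}y Kz; by rewrite /F -addrA lerD2l -mulrDr ler_wpM2l // [leRHS]addrC -[x - z](subrKA y) ler_normD.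
move=> x Kx; apply: norm_le_coord => [|j]; first exact: ltW.
rewrite !mxE ler_norml; apply/andP; split.
  rewrite lerBrDr; apply: lb_le_inf; first by case: K0 => y Ky; exists (F j y x), y.
  move=> _ [y Ky <-]; rewrite /F.
  have [xy|xy] := ltP `|x - y| eta.
    have /ltW := le_lt_trans (le_coord_norm _ j) (etaP _ _ Kx xy).
    rewrite !mxE ler_norml => /andP[_ H].
    have : 0 <= C * `|x - y| by rewrite mulr_ge0.
    lra.
  have Cxy : 2 * M <= C * `|x - y|.
    by rewrite /C -mulrA ler_peMr ?mulr_ge0 // mulrC ler_pdivlMr // mul1r.
  have := le_trans (le_coord_norm (g y) j) (MP _ Ky).
  have := le_trans (le_coord_norm (g x) j) (MP _ Kx).
  by rewrite !ler_norml; lra.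
rewrite (@le_trans _ _ 0) ?(ltW e0) // subr_le0.
by apply: ge_inf => //; exists x => //; rewrite /F subrr normr0 mulr0 addr0.
Qed.

End Compactness.

Section Miss.
Context {R : realType}.

(* Pigeonhole: a grid of mesh 1/N in the source has about N^m points, too few
   to come close to every node of a grid of mesh proportional to 1/N in the
   target, which has about N^n of them. *)
Lemma lipschitz_miss m n (L : 'rV[R]_m -> 'rV[R]_n) (C : R) (z : 'rV[R]_n) (d : R) :
  (m < n)%N -> 0 <= C -> lipschitz_map C L -> 0 < d ->
  exists z' e, [/\ `|z' - z| <= d, 0 < e
    & forall x, `|x| <= 1 -> e <= `|L x - z'|].
Proof.
move=> ltmn C0 LC d0.
pose c := (Num.trunc (8 * C / d)).+1.
have cP : 8 * C <= c%:R * d.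
  rewrite -ler_pdivrMr // ltW //.
  have /truncn_itv/andP[] // : 0 <= 8 * C / d by rewrite divr_ge0 ?mulr_ge0 // ltW.
(* Since [(2 * c).+1 ^ m < M], the number of source cells, at most [(M * (2 * c).+1) ^ m], is less
   than [M ^ m.+1], hence less than the number [M ^ n] of nodes. *)
pose M := ((2 * c).+1 ^ m).+1; pose N := (c * M)%N.
have M0 : 0 < M%:R :> R by rewrite ltr0n.
have N0 : 0 < N%:R :> R by rewrite ltr0n muln_gt0.
(* Distinct nodes are at least [8 * e] apart. Two points in one source cell have images within
   [C / N <= e], so nodes within [e] of these images are less than [3 * e] apart and must
   coincide. *)
pose e : R := d / (8 * M%:R); have e0 : 0 < e by rewrite divr_gt0 ?mulr_gt0.
have eM : 8 * (e * M%:R) = d.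
  by rewrite /e; field; rewrite gt_eqF.
apply: contrapT => Nmiss.
pose zz (k : {ffun 'I_n -> 'I_M}) : 'rV[R]_n := z + \row_j (d * (k j)%:R / M%:R).
have hit k : exists x : 'rV[R]_m, `|x| <= 1 /\ `|L x - zz k| < e.
  apply: contrapT => nhit; apply: Nmiss; exists (zz k), e; split => //.
    rewrite /zz addrC addKr; apply: norm_le_coord => [|j]; first exact: ltW.
    rewrite mxE ger0_norm; last by rewrite divr_ge0 ?mulr_ge0 // ltW.
    rewrite ler_pdivrMr // ler_pM2l // ler_nat; exact/ltnW/ltn_ord.
  by move=> x x1; rewrite leNgt; apply/negP => H; apply: nhit; exists x.
have [x xP] := choice hit.
pose t (v : 'rV[R]_m) j := Num.trunc (N%:R * (v ord0 j + 1)).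
pose cl k : {ffun 'I_m -> 'I_(2 * N).+1} := [ffun j => inord (t (x k) j)].
have x1 k j : - 1 <= x k ord0 j <= 1.
  by rewrite -ler_norml (le_trans (le_coord_norm _ _)) //; case: (xP k).
have tN k j : (t (x k) j < (2 * N).+1)%N.
  rewrite ltnS -(ler_nat R); have := x1 k j => /andP[xl xu].
  have : (t (x k) j)%:R <= N%:R * (x k ord0 j + 1).
    by rewrite truncn_le mulr_ge0 ?ler0n //; lra.
  move=> /le_trans; apply; rewrite natrM mulrC ler_pM2r //; lra.
have tP k j : (t (x k) j)%:R <= N%:R * (x k ord0 j + 1) < (t (x k) j).+1%:R.
  by apply: truncn_itv; rewrite mulr_ge0 ?ler0n //; have /andP[] := x1 k j; lra.
have cl_inj : injective cl.
  move=> k l kl.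
  have xkl : `|x k - x l| <= N%:R^-1.
    apply: norm_le_coord => [|j]; first by rewrite invr_ge0 ltW.
    have /(congr1 val) := congr1 (fun h : {ffun _} => h j) kl.
    rewrite /cl !ffunE /= !inordK // => tkl.
    have /andP[h1 h2] := tP k j; have /andP[h3 h4] := tP l j.
    rewrite tkl -natr1 in h1 h2 *; rewrite -natr1 in h4.
    rewrite !mxE -(ler_pM2l N0) mulfV ?gt_eqF // -{1}(gtr0_norm N0) -normrM.
    by rewrite ler_norml; apply/andP; split; lra.
  have Lkl : `|L (x k) - L (x l)| * M%:R <= e * M%:R.
    rewrite ler_pM2r //; apply: le_trans (LC _ _) _.
    apply: le_trans (ler_wpM2l C0 xkl) _.
    rewrite ler_pdivrMr // /N natrM mulrCA; nra.
  have zkl : `|zz k - zz l| * M%:R < d.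
    have [_ h1] := xP k; have [_ h2] := xP l.
    have h3 : `|zz k - zz l| <= `|L (x k) - zz k| + `|L (x k) - L (x l)| + `|L (x l) - zz l|.
      have -> : zz k - zz l = - (L (x k) - zz k) + (L (x k) - L (x l)) + (L (x l) - zz l).
        by rewrite opprB !addrA !subrK.
      by rewrite (le_trans (ler_normD _ _)) // lerD2r (le_trans (ler_normD _ _)) // normrN.
    have : `|zz k - zz l| * M%:R <= (`|L (x k) - zz k| + `|L (x k) - L (x l)| + `|L (x l) - zz l|) * M%:R.
      by rewrite ler_pM2r.
    move: h1 h2; rewrite -(ltr_pM2r M0) => h1; rewrite -(ltr_pM2r M0) => h2.
    by rewrite 2!mulrDl; have := mulr_gt0 e0 M0; lra.
  apply/ffunP => j; apply: val_inj => /=.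
  have := le_lt_trans (ler_wpM2r (ltW M0) (le_coord_norm _ j)) zkl.
  rewrite /zz !mxE opprD addrACA subrr add0r -mulrBl normrM normfV (gtr0_norm M0).
  rewrite divfK ?gt_eqF // -mulrBr normrM (gtr0_norm d0) -[ltRHS]mulr1 ltr_pM2l //.
  rewrite ltr_norml => /andP[h1 h2].
  have h3 : (k j < (l j).+1)%N by rewrite -(ltr_nat R) -natr1; lra.
  have h4 : (l j < (k j).+1)%N by rewrite -(ltr_nat R) -natr1; lra.
  by apply/eqP; rewrite eqn_leq -ltnS h3 -ltnS h4.
have := leq_card cl cl_inj; rewrite !card_ffun !card_ord leqNgt => /negP; apply.
have M_gt0 : (0 < M)%N by [].
apply: (@leq_ltn_trans ((M * (2 * c).+1) ^ m)).
  have [m0|m0] := posnP m; first by rewrite [in leqLHS]m0 [in leqRHS]m0 !expn0.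
  by rewrite leq_exp2r // /N; move: M_gt0; move: (M) => K; nia.
apply: (@leq_trans (M ^ m.+1)); last by rewrite leq_pexp2l.
by rewrite expnMn expnS [ltnRHS]mulnC ltn_pmul2l ?expn_gt0.
Qed.

End Miss.

(** * Gluing maps along cells *)

Section Glue.
Context {R : realType} {G : topGroupType} (X : finite_gcw R G).
Local Notation D := (gcw_data X).
Let ax := gcw_axioms X.
Local Notation pts i := (Defs.orbit (cell_stab i) * disk R (cell_dim i))%type.

Lemma cw_pointP (x : X) :
  x = gpt \/ exists (i : cell D) (p : pts i), cell_interior (D := D) i p /\ x = cell_map i p.
Proof.
have : ([set gpt] `|` \bigcup_(i in [set: cell D]) open_cell i) x.
  by rewrite (cw_cover ax).
by move=> [->|[i _ [p pI <-]]]; [left | right; exists i, p].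
Qed.

Lemma cw_continuous (Z : topologicalType) (g : X -> Z) :
  (forall i : cell D, continuous (fun p => g (cell_map i p))) -> continuous g.
Proof.
move=> cg; apply/continuous_closedP => C cC.
apply: (cells_closed (P := fun _ => True)) => // i _.
by have /continuous_closedP := cg i; apply.
Qed.

Import ArrowAsCompactOpen.

(* By the exponential law, [X] is coherent with its cells even after
   multiplication by a locally compact Hausdorff parameter space. *)
Lemma cw_param_continuous (L Z : topologicalType) (K : L -> X -> Z) :
  locally_compact [set: L] -> hausdorff_space L ->
  (forall i : cell D, continuous (fun q : L * pts i => K q.1 (cell_map i q.2))) ->
  continuous (K ^~ gpt) ->
  continuous (fun q : L * X => K q.1 q.2).
Proof.
move=> lcL hL cK cK0.
pose F (i : cell D) (q : pts i * L) := K q.2 (cell_map i q.1).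
have cF i : continuous (F i).
  apply: (continuous_comp_all (f := fun q : pts i * L => (q.2, q.1)) _ (cK i)).
  by apply: continuous_pairing; [exact: continuous_snd|exact: continuous_fst].
pose f (x : X) (l : L) : Z := K l x.
have cf : continuous (f : X -> L -> Z).
  apply: cw_continuous => i; exact: (continuous_curry_fun (cF i)).
have cfx x : continuous (f x).
  have [->//|[i [p [_ ->]]]] := cw_pointP x.
  by have [_ /(_ p)] := continuous_curry (cF i).
have cu := continuous_uncurry lcL hL cf cfx.
apply: (continuous_comp_all (f := fun q : L * X => (q.2, q.1)) _ cu).
by apply: continuous_pairing; [exact: continuous_snd|exact: continuous_fst].
Qed.

Section GlueFunction.
Context (S : cell D -> Prop) (Z : Type) (g : forall i : cell D, pts i -> Z)
  (g0 : X -> Z).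

Definition in_cells (x : X) :=
  exists s : {i : cell D & pts i},
    [/\ S (projT1 s), cell_interior (D := D) (projT1 s) (projT2 s)
      & cell_map (projT1 s) (projT2 s) = x].

(** Open cells are disjoint and characteristic maps are injective on interiors, so the chosen
    preimage is the only one. The fallback [g0] makes this a function on all of [X]. *)
Definition cell_glue (x : X) : Z :=
  if pselect (in_cells x) is left h then g (projT2 (projT1 (cid h))) else g0 x.

Lemma cell_glue_in (i : cell D) (p : pts i) :
  S i -> cell_interior (D := D) i p -> cell_glue (cell_map i p) = g p.
Proof.
move=> Si pI; rewrite /cell_glue; case: pselect => [h|[]]; last first.
  by exists (existT _ i p).
case: (cid h) => -[j q] /= [Sj qI E].
have ji : j = i.
  by apply: (open_cell_inj (x := cell_map i p)); [exists q|exists p].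
by subst j; rewrite (cell_map_inj ax (mem_set qI) (mem_set pI) E).
Qed.

Lemma cell_glue_out x : (forall i, S i -> ~ open_cell i x) -> cell_glue x = g0 x.
Proof.
move=> xS; rewrite /cell_glue; case: pselect => // -[[i p] /= [Si pI E]].
by case: (xS i Si); exists p.
Qed.

Context (n : nat) (S_dim : forall i, S i -> cell_dim i = n).

Lemma boundary_not_open (i j : cell D) (p : pts i) : (cell_dim i <= n)%N ->
  cell_boundary (D := D) i p -> S j -> ~ open_cell j (cell_map i p).
Proof.
move=> lein pB Sj jp.
have [E|[k lki kp]] : skeleton D (cell_dim i) (cell_map i p).
- by apply: (cell_map_boundary ax); exists p.
- by apply: (open_cell_pt ax (i := j)); rewrite -E.
- have kj := open_cell_inj kp jp.
  by move: lki; rewrite /= kj (S_dim Sj) ltnNge lein.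
Qed.

(** The interior of such a cell is disjoint from the open cells in [S], and its boundary lies in
    cells of dimension below [n]; hence the closed cell never sees [g]. *)
Lemma cell_glue_other (j : cell D) (p : pts j) : ~ S j -> (cell_dim j <= n)%N ->
  cell_glue (cell_map j p) = g0 (cell_map j p).
Proof.
move=> nSj lejn; apply: cell_glue_out => i Si ip.
have [pI|pB] := interior_or_boundary p; last exact: boundary_not_open ip.
by apply: nSj; rewrite (open_cell_inj (x := cell_map j p) (i := j) (j := i)) //; exists p.
Qed.

Lemma cell_glue_pt : cell_glue gpt = g0 gpt.
Proof. by apply: cell_glue_out => i _; exact: (open_cell_pt ax). Qed.

Context (g_g0 : forall i (p : pts i), S i -> cell_boundary (D := D) i p ->
  g p = g0 (cell_map i p)).

Lemma cell_glue_cell (i : cell D) (p : pts i) : S i -> cell_glue (cell_map i p) = g p.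
Proof.
move=> Si; have [pI|pB] := interior_or_boundary p; first exact: cell_glue_in.
rewrite g_g0 //; apply: cell_glue_out => j Sj; apply: boundary_not_open => //.
by rewrite S_dim.
Qed.

End GlueFunction.

End Glue.

(** * Equivariant families of maps *)

Section Families.
Context {R : realType} {G : topGroupType}.

(** The parameter space is [R] for homotopies and a vector space for perturbations. Homotopies run
    over all of [R], so that continuity holds on the full product; only the parameters 0 and 1 are
    read off. *)
Record gfamily (L : topologicalType) (X Y : gspace G) := GFamily {
  gfam :> L -> X -> Y;
  gfam_continuous : continuous (fun q : L * X => gfam q.1 q.2);
  gfam_equivariant : forall l a x, gfam l (gact a x) = gact a (gfam l x);
  gfam_pt : forall l, gfam l gpt = gpt
}.

Program Definition gfam_map L X Y (K : gfamily L X Y) (l : L) : gmap X Y :=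
  @GMap G X Y (K l) _ _ _.
Next Obligation.
move=> L X Y K l; apply: (continuous_comp_all (f := fun x : X => (l, x)) _
  (@gfam_continuous _ _ _ K)).
by apply: continuous_pairing; [exact: cont_cst | move=> x].
Qed.
Next Obligation. by move=> *; exact: gfam_equivariant. Qed.
Next Obligation. by move=> *; exact: gfam_pt. Qed.

Program Definition gfam_pre L X Y Z (K : gfamily L Y Z) (f : gmap X Y) : gfamily L X Z :=
  @GFamily L X Z (fun l x => K l (f x)) _ _ _.
Next Obligation.
move=> L X Y Z K f; apply: (continuous_comp_all (f := fun q : L * X => (q.1, f q.2)) _
  (@gfam_continuous _ _ _ K)).
apply: continuous_pairing; first exact: continuous_fst.
by apply: continuous_comp_all; [exact: continuous_snd|exact: gmap_continuous].
Qed.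
Next Obligation. by move=> * /=; rewrite gmap_equivariant gfam_equivariant. Qed.
Next Obligation. by move=> * /=; rewrite gmap_pt gfam_pt. Qed.

Program Definition gfam_post L X Y Z (f : gmap Y Z) (K : gfamily L X Y) : gfamily L X Z :=
  @GFamily L X Z (fun l x => f (K l x)) _ _ _.
Next Obligation.
move=> L X Y Z f K; apply: continuous_comp_all; last exact: gmap_continuous.
exact: gfam_continuous.
Qed.
Next Obligation. by move=> * /=; rewrite gfam_equivariant gmap_equivariant. Qed.
Next Obligation. by move=> * /=; rewrite gfam_pt gmap_pt. Qed.

Lemma gfam_homotopic (X Y : gspace G) (K : gfamily R X Y) (f h : gmap X Y) :
  f =1 K 0 -> h =1 K 1 -> ghomotopic R f h.
Proof.
move=> fK hK; exists (fun q => K q.1 q.2); split => //=.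
- exact/continuous_subspaceT/gfam_continuous.
- by move=> *; exact: gfam_equivariant.
- by move=> *; exact: gfam_pt.
Qed.

Lemma eqfun_homotopic (X Y : gspace G) (f h : gmap X Y) : f =1 h -> ghomotopic R f h.
Proof.
move=> fh; exists (fun q => f q.2); split => //=.
- apply/continuous_subspaceT; apply: continuous_comp_all; first exact: continuous_snd.
  exact: gmap_continuous.
- by move=> *; exact: gmap_equivariant.
- by move=> *; exact: gmap_pt.
Qed.

Section GlueMap.
Context (X : finite_gcw R G).
Local Notation D := (gcw_data X).
Let ax := gcw_axioms X.
Local Notation pts i := (Defs.orbit (cell_stab i) * disk R (cell_dim i))%type.

(** The cells in [S] have the top dimension, so redefining a family on them leaves all other closed
    cells alone, and agreement with [g0] on their boundaries is the only compatibility to check. *)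
Lemma cell_glue_family (L : topologicalType) (Y : gspace G) (S : cell D -> Prop) n
    (g : forall i : cell D, L -> pts i -> Y) (g0 : gfamily L X Y) :
  locally_compact [set: L] -> hausdorff_space L ->
  (forall i, S i -> cell_dim i = n) ->
  (forall i : cell D, (cell_dim i <= n)%N) ->
  (forall i, S i -> continuous (fun q : L * pts i => g i q.1 q.2)) ->
  (forall i l a c v, S i -> g i l (orbit_act a c, v) = gact a (g i l (c, v))) ->
  (forall i l (p : pts i), S i -> cell_boundary (D := D) i p ->
    g i l p = g0 l (cell_map i p)) ->
  exists K : gfamily L X Y,
    (forall i l (p : pts i), S i -> K l (cell_map i p) = g i l p) /\
    (forall l x, (forall i, S i -> ~ open_cell i x) -> K l x = g0 l x).
Proof.
move=> lcL hL S_dim X_dim cg eg gg0.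
pose K l := cell_glue S (fun i p => g i l p) (g0 l).
have Kcell i l (p : pts i) : S i -> K l (cell_map i p) = g i l p.
  by move=> Si; apply: (cell_glue_cell S_dim) => // j q; exact: gg0.
have Kout l x : (forall i, S i -> ~ open_cell i x) -> K l x = g0 l x.
  by move=> xS; exact: cell_glue_out.
have Kother i l (p : pts i) : ~ S i -> K l (cell_map i p) = g0 l (cell_map i p).
  by move=> nSi; apply: (cell_glue_other _ _ S_dim).
have Kpt l : K l gpt = gpt.
  by rewrite Kout ?gfam_pt // => i _; exact: (open_cell_pt ax).
have cK : continuous (fun q : L * X => K q.1 q.2).
  apply: cw_param_continuous => // [i|].
    have [Si|nSi] := pselect (S i).
      by under eq_fun do rewrite (Kcell i _ _ Si); exact: cg.
    under eq_fun do rewrite (Kother i _ _ nSi).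
    apply: (continuous_comp_all (f := fun q : L * pts i => (q.1, cell_map i q.2)) _
      (@gfam_continuous _ _ _ g0)).
    apply: continuous_pairing; first exact: continuous_fst.
    apply: continuous_comp_all; first exact: continuous_snd.
    exact: (cell_map_continuous ax).
  by under eq_fun do rewrite Kpt; exact: cont_cst.
have eK l a x : K l (gact a x) = gact a (K l x).
  have [->|[i [[c v] [pI ->]]]] := cw_pointP x; first by rewrite gact_pt !Kpt gact_pt.
  rewrite -(cell_map_equivariant ax).
  have [Si|nSi] := pselect (S i); first by rewrite !Kcell // eg.
  by rewrite !Kother // (cell_map_equivariant ax) gfam_equivariant.
by exists (GFamily cK eK Kpt).
Qed.

Program Definition const_family (L : topologicalType) (Y Z : gspace G) (f : gmap Y Z) :
  gfamily L Y Z := @GFamily L Y Z (fun _ => f) _ _ _.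
Next Obligation.
move=> L Y Z f; apply: continuous_comp_all; first exact: continuous_snd.
exact: gmap_continuous.
Qed.
Next Obligation. by move=> *; exact: gmap_equivariant. Qed.
Next Obligation. by move=> *; exact: gmap_pt. Qed.

(* Deforms the [n]-cells in [S] through maps of disks that fix the attaching
   map. *)
Lemma move_cells (L : topologicalType) (S : cell D -> Prop) n
    (phi : forall i : cell D, L -> disk R (cell_dim i) -> disk R (cell_dim i)) :
  locally_compact [set: L] -> hausdorff_space L ->
  (forall i, S i -> cell_dim i = n) ->
  (forall i : cell D, (cell_dim i <= n)%N) ->
  (forall i, S i ->
    continuous (fun q : L * disk R (cell_dim i) => phi i q.1 q.2)) ->
  (forall i l c v, S i -> sqnorm (val v) = 1 ->
    cell_map i (c, phi i l v) = cell_map i (c, v)) ->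
  exists K : gfamily L X X,
    (forall i l c v, S i -> K l (cell_map i (c, v)) = cell_map i (c, phi i l v)) /\
    (forall l x, (forall i, S i -> ~ open_cell i x) -> K l x = x).
Proof.
move=> lcL hL S_dim X_dim cphi phib.
have [|||K [KS Kout]] := @cell_glue_family L X S n
  (fun i l p => cell_map i (p.1, phi i l p.2)) (const_family L (gid X)) lcL hL S_dim X_dim.
- move=> i Si; apply: continuous_comp_all; last exact: (cell_map_continuous ax).
  apply: continuous_pairing.
    by apply: continuous_comp_all; [exact: continuous_snd|exact: continuous_fst].
  apply: (continuous_comp_all (f := fun q : L * pts i => (q.1, q.2.2)) _ (cphi i Si)).
  apply: continuous_pairing; first exact: continuous_fst.
  by apply: continuous_comp_all; exact: continuous_snd.
- by move=> i l a c v Si /=; rewrite (cell_map_equivariant ax).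
- by move=> i l [c v] Si /= vB; rewrite phib.
by exists K; split => // i l c v Si; rewrite KS.
Qed.

End GlueMap.
End Families.

(** * Cellular approximation *)

Section DiskMoves.
Context {R : realType}.

Lemma radproj_scale m (s : R) (v : 'rV[R]_m) : 1 <= s -> sqnorm v = 1 ->
  radproj (s *: v) = v.
Proof.
move=> s1 v1; have s0 : 0 <= s by rewrite (le_trans ler01).
rewrite /radproj sqnormZ v1 mulr1 sqrtr_sqr ger0_norm // max_r // scalerA.
by rewrite mulVf ?scale1r // gt_eqF // (lt_le_trans ltr01).
Qed.

Lemma sqnorm_ge1 m (v : 'rV[R]_m) : 1 <= `|v| -> 1 <= sqnorm v.
Proof. by move=> v1; rewrite (le_trans _ (norm_le_sqnorm v)) // expr_ge1. Qed.

(** Reads a vector of length [m] as one of length [n]: the identity up to the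
    equation [m = n], and zero otherwise. *)
Definition resize m n (v : 'rV[R]_m) : 'rV[R]_n := conform_mx 0 v.

Lemma resize_id m (v : 'rV[R]_m) : resize m v = v.
Proof. exact: conform_mx_id. Qed.

Lemma resize_continuous m n : continuous (@resize m n).
Proof.
have [E|mn] := eqVneq m n.
  subst n; rewrite (_ : @resize m m = id); first by move=> v.
  by apply/funext => v; exact: resize_id.
rewrite (_ : @resize m n = fun=> 0); first exact: cont_cst.
by apply/funext => v; rewrite /resize nonconform_mx // mn orbT.
Qed.

Lemma resize0 m n : resize n (0 : 'rV[R]_m) = 0.
Proof.
have [E|mn] := eqVneq n m; first by subst n; rewrite resize_id.
by rewrite /resize nonconform_mx // eq_sym mn orbT.
Qed.

Definition clamp (t : R) : R := Num.max 0 (Num.min 1 t).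

Lemma clamp_itv t : 0 <= clamp t <= 1.
Proof. by rewrite /clamp le_max lexx ge_max ler01 ge_min lexx. Qed.

Lemma clamp_ge1 t : 1 <= t -> clamp t = 1.
Proof. by move=> t1; rewrite /clamp min_l // max_r. Qed.

Lemma clamp_le0 t : t <= 0 -> clamp t = 0.
Proof. by move=> t0; rewrite /clamp min_r ?(le_trans t0) // max_l. Qed.

Lemma cont_clamp (T : topologicalType) (f : T -> R) :
  continuous f -> continuous (fun x => clamp (f x)).
Proof.
move=> cf; apply: cont_max; first exact: cont_cst.
by apply: cont_min => //; exact: cont_cst.
Qed.

(** Two nested cutoffs: [inner] is 1 for [sqnorm v <= 1/4] and 0 from 1/2 on, [outer] is 1 up to 3/4
    and 0 on the sphere. Where [inner] lets points move, the damped coordinate [outer v *: v] is the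
    true one. *)
Definition inner m (v : 'rV[R]_m) : R := clamp (2 - 4 * sqnorm v).
Definition outer m (v : 'rV[R]_m) : R := clamp (4 - 4 * sqnorm v).

Lemma inner_continuous m : continuous (@inner m).
Proof.
apply: cont_clamp; apply: contD; first exact: cont_cst.
apply: contN; apply: contM; first exact: cont_cst.
exact: sqnorm_continuous.
Qed.

Lemma outer_continuous m : continuous (@outer m).
Proof.
apply: cont_clamp; apply: contD; first exact: cont_cst.
apply: contN; apply: contM; first exact: cont_cst.
exact: sqnorm_continuous.
Qed.

Definition shift m n (v : 'rV[R]_m) (a : 'rV[R]_n) : 'rV[R]_m :=
  radproj (v + inner v *: resize m a).

(** Chosen such that maximum norm at most [k * margin n] forces [sqnorm] to be at most
    [k ^+ 2 / 16]; for [k = 2] this is 1/4, where both cutoffs are 1. *)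
Definition margin (n : nat) : R := (4 * n.+1%:R)^-1.

Lemma margin_gt0 n : 0 < margin n.
Proof. by rewrite invr_gt0 mulr_gt0. Qed.

Lemma sqnorm_margin n (v : 'rV[R]_n) k : `|v| <= k * margin n -> 0 <= k ->
  sqnorm v <= k ^+ 2 / 16.
Proof.
move=> vk k0; have n1 : 0 < n.+1%:R :> R by rewrite ltr0n.
have h : `|v| ^+ 2 <= (k * margin n) ^+ 2.
  have km : 0 <= k * margin n by rewrite mulr_ge0 // ltW // margin_gt0.
  by rewrite ler_sqr ?nnegrE.
apply: le_trans (sqnorm_le_norm v) _.
apply: le_trans (ler_wpM2l (ler0n _ _) h) _.
rewrite exprMn mulrCA ler_wpM2l ?sqr_ge0 // /margin exprVn exprMn.
rewrite ler_pdivrMr ?mulr_gt0 ?exprn_gt0 //.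
have : n%:R <= n.+1%:R :> R by rewrite ler_nat.
have : 1 <= n.+1%:R :> R by rewrite ler1n.
nra.
Qed.

(** A point that ends within [margin n] of the centre was moved by at most [margin n], so it started
    within twice that. There both cutoffs are 1, and the shift is the plain translation from [v] to
    [w]. *)
Lemma shift_coord m n (v : 'rV[R]_m) (w : 'rV[R]_n) : m = n -> sqnorm v <= 1 ->
  `|w - outer v *: resize n v| <= margin n ->
  `|shift v (w - outer v *: resize n v)| < margin n ->
  resize n (shift v (w - outer v *: resize n v)) = w.
Proof.
move=> E; subst n; rewrite !resize_id => v1 wu.
set a := w - _; rewrite /shift resize_id => small.
have p1 : sqnorm (radproj (v + inner v *: a)) < 1.
  apply: (@le_lt_trans _ _ (1 ^+ 2 / 16)); last by lra.
  by apply: sqnorm_margin; rewrite ?mul1r ?ltW.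
have [_ E] := sqnorm_radproj_lt1 p1; rewrite E in small *.
have v2 : `|v| <= 2 * margin m.
  have -> : v = v + inner v *: a - inner v *: a by rewrite addrK.
  have /andP[i0 i1] := clamp_itv (2 - 4 * sqnorm v).
  have : `|inner v *: a| <= margin m.
    rewrite normrZ ger0_norm // (le_trans _ wu) // -[leRHS]mul1r.
    by rewrite ler_wpM2r.
  have := ler_normB (v + inner v *: a) (inner v *: a); lra.
have v4 : sqnorm v <= 2 ^+ 2 / 16 by exact: sqnorm_margin.
have i1 : inner v = 1 by apply: clamp_ge1; lra.
have o1 : outer v = 1 by apply: clamp_ge1; lra.
by rewrite i1 scale1r /a o1 scale1r addrC subrK.
Qed.

End DiskMoves.

Section CellMoves.
Context {R : realType} {G : topGroupType} (X : finite_gcw R G) (n : nat).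
Local Notation D := (gcw_data X).
Let ax := gcw_axioms X.
Context (X_dim : forall i : cell D, (cell_dim i <= n)%N).

Lemma skeleton_notin (i : cell D) x : skeleton D n x -> cell_dim i = n ->
  ~ open_cell i x.
Proof.
move=> [->|[j jn jx]] lin ix; first exact: (open_cell_pt ax) ix.
by move: jn; rewrite /= (open_cell_inj jx ix) lin ltnn.
Qed.

Lemma cell_expansion (e : R) : 0 < e -> e <= 1 ->
  exists E : gfamily R X X, [/\ (forall x, E 0 x = x),
    (forall x, skeleton D n x -> E 1 x = x)
    & forall (i : cell D) c v, cell_dim i = n -> exists v',
      E 1 (cell_map i (c, v)) = cell_map i (c, v') /\
      (e <= `|val v| -> sqnorm (val v') = 1)].
Proof.
move=> e0 e1; pose s (t : R) := 1 + Num.max 0 t * (e^-1 - 1).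
have ev1 : 1 <= e^-1 by rewrite invf_ge1.
have s1 t : 1 <= s t by rewrite lerDl mulr_ge0 ?subr_ge0 // le_max lexx.
have cs : continuous s.
  apply: contD; first exact: cont_cst.
  apply: contM; last exact: cont_cst.
  by apply: cont_max; [exact: cont_cst | move=> x].
have [||||||K [KS Kout]] := @move_cells R G X R (fun i => cell_dim i = n) n
  (fun i t v => projd (s t *: val v)).
- exact: locally_compactR.
- exact: norm_hausdorff.
- by [].
- by [].
- move=> i _; apply: continuous_comp_all; last exact: projd_continuous.
  apply: contZ; first by apply: continuous_comp_all => //; exact: continuous_fst.
  apply: continuous_comp_all; first exact: continuous_snd.
  exact: disk_val_continuous.
- move=> i t c v _ v1; congr (cell_map i (c, _)); apply: val_inj => /=.
  exact: radproj_scale.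
exists K; split.
- move=> x; have [->|[i [[c v] [pI ->]]]] := cw_pointP x; first by rewrite gfam_pt.
  have [Ei|nEi] := eqVneq (cell_dim i) n.
    rewrite KS // /s maxxx mul0r addr0 scale1r projdK //.
  rewrite Kout // => j Ej ij; move/negP: nEi; apply; apply/eqP.
  by rewrite (open_cell_inj (x := cell_map i (c, v)) (i := i) (j := j)) //; exists (c, v).
- by move=> x xn; rewrite Kout // => i Ei; exact: skeleton_notin.
move=> i c v Ei; exists (projd (s 1 *: val v)); split; first by rewrite KS.
move=> ev; apply: sqnorm_radproj1; apply: sqnorm_ge1.
rewrite /s max_r // mul1r addrC subrK normrZ gtr0_norm ?invr_gt0 //.
by rewrite ler_pdivlMl // mulr1.
Qed.

(* [u] is the coordinate on the [n]-cells in [S], damped to [0] near their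
   boundary, and [T] moves points near the centres of these cells. *)
Lemma cell_perturbation (S : cell D -> Prop) : (forall i, S i -> cell_dim i = n) ->
  exists (u : X -> 'rV[R]_n) (T : gfamily 'rV[R]_n X X),
  [/\ continuous u, (forall a x, u (gact a x) = u x),
     (forall x, T 0 x = x) /\
       (forall a x, (forall i, S i -> ~ open_cell i x) -> T a x = x),
     (forall x w (i : cell D) c v, S i -> `|w - u x| <= margin n ->
        T (w - u x) x = cell_map i (c, v) -> `|val v| < margin n ->
        resize n (val v) = w)
   & (forall (j : cell D) a x, cell_dim j = n -> ~ S j -> open_cell j (T a x) ->
        T a x = x)].
Proof.
move=> S_dim.
pose g (i : cell D) (p : Defs.orbit (cell_stab i) * disk R (cell_dim i)) : 'rV[R]_n :=
  outer (val p.2) *: resize n (val p.2).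
have cg i : continuous (@g i).
  have cv : continuous (fun p : Defs.orbit (cell_stab i) * disk R (cell_dim i) => val p.2).
    by apply: continuous_comp_all; [exact: continuous_snd|exact: disk_val_continuous].
  apply: contZ; apply: (continuous_comp_all cv); first exact: outer_continuous.
  exact: resize_continuous.
have gb i (p : Defs.orbit (cell_stab i) * disk R (cell_dim i)) :
    S i -> cell_boundary (D := D) i p -> g i p = 0.
  by move=> _ pB; rewrite /g /outer pB clamp_le0 ?scale0r // mulr1 subrr.
pose u := cell_glue S g (fun=> 0).
have uS (i : cell D) p : S i -> u (cell_map i p) = g i p.
  by move=> Si; apply: (cell_glue_cell S_dim).
have u0 (i : cell D) p : ~ S i -> u (cell_map i p) = 0.
  by move=> nSi; apply: (cell_glue_other _ _ S_dim).
have [||||||T [TS Tout]] := @move_cells R G X 'rV[R]_n S n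
  (fun i a v => projd (val v + inner (val v) *: resize _ a)).
- exact: locally_compact_rV.
- exact: norm_hausdorff.
- by [].
- by [].
- move=> i _.
  have cv : continuous (fun p : 'rV[R]_n * disk R (cell_dim i) => val p.2).
    by apply: continuous_comp_all; [exact: continuous_snd|exact: disk_val_continuous].
  apply: continuous_comp_all; last exact: projd_continuous.
  apply: contD => //; apply: contZ.
    by apply: (continuous_comp_all cv); exact: inner_continuous.
  by apply: continuous_comp_all; [exact: continuous_fst|exact: resize_continuous].
- move=> i a c v _ v1; congr (cell_map i (c, _)).
  rewrite /inner v1 clamp_le0 ?scale0r ?addr0 ?projdK //; lra.
exists u, T; split.
- apply: cw_continuous => i; have [Si|nSi] := pselect (S i).
    by under eq_fun do rewrite uS //; exact: cg.
  by under eq_fun do rewrite u0 //; exact: cont_cst.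
- move=> a x; have [->|[i [[c v] [pI ->]]]] := cw_pointP x; first by rewrite gact_pt.
  rewrite -(cell_map_equivariant ax).
  by have [Si|nSi] := pselect (S i); [rewrite !uS | rewrite !u0].
- split=> // x; have [->|[i [[c v] [pI ->]]]] := cw_pointP x; first by rewrite gfam_pt.
  have [Si|nSi] := pselect (S i).
    rewrite TS //; congr (cell_map i (c, _)); rewrite -[RHS]projdK.
    by rewrite resize0 scaler0 addr0.
  rewrite Tout // => j Sj ij; apply: nSi.
  by rewrite (open_cell_inj (x := cell_map i (c, v)) (i := i) (j := j)) //; exists (c, v).
- move=> x w i c v Si wu Tx v_small.
  have mE : margin (cell_dim i) = margin n :> R by rewrite S_dim.
  have vI : sqnorm (val v) < 1.
    apply: (@le_lt_trans _ _ (1 ^+ 2 / 16)); last by lra.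
    by apply: sqnorm_margin => //; rewrite mul1r mE ltW.
  have iTx : open_cell i (T (w - u x) x) by rewrite Tx; exists (c, v).
  (* Nothing moves outside the cells in [S], so a point that lands in an open cell of [S] came from
     an open cell of [S]; it also stays in its closed cell, whose boundary misses the open cell [i],
     which gives [j = i] below. *)
  have [j [[[c0 v0] [v0I xE]] Sj]] : exists j : cell D,
      (exists p : Defs.orbit (cell_stab j) * disk R (cell_dim j),
         cell_interior (D := D) j p /\ x = cell_map j p) /\ S j.
    apply: contrapT => nx; apply: (nx); exists i; split => //.
    have Tx' : T (w - u x) x = x.
      apply: Tout => j Sj [p pI px]; apply: nx.
      by exists j; split => //; exists p.
    by exists (c, v); split => //; rewrite -Tx.
  rewrite xE TS // in Tx iTx; rewrite xE uS // /g /= in Tx iTx wu.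
  set a := w - _ in Tx iTx wu; set v1 := projd _ in Tx iTx.
  have v1I : cell_interior (D := D) j (c0, v1).
    have [//|v1B] := interior_or_boundary (c0, v1 : disk R (cell_dim j)).
    by case: (boundary_not_open S_dim _ v1B Si iTx); rewrite S_dim.
  have ji : j = i by apply: (open_cell_inj _ iTx); exists (c0, v1).
  subst j.
  have cvI : cell_interior (D := D) i (c, v) by [].
  have [_ v1E] := cell_map_inj ax (mem_set v1I) (mem_set cvI) Tx.
  have v1_small : `|val v1| < margin n by rewrite v1E.
  rewrite -v1E; apply: (shift_coord (S_dim _ Si) (diskP v0) wu); exact: v1_small.
- move=> j a x Ej nSj jTx.
  have [[i [[c v] [Si [vI xE]]]]|nx] := pselect (exists (i : cell D)
      (p : Defs.orbit (cell_stab i) * disk R (cell_dim i)),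
      S i /\ cell_interior (D := D) i p /\ x = cell_map i p); last first.
    by apply: Tout => i Si [p pI px]; apply: nx; exists i, p.
  rewrite xE TS // in jTx; set v1 := projd _ in jTx.
  have [v1I|v1B] := interior_or_boundary (c, v1 : disk R (cell_dim i)).
    by case: nSj; rewrite (open_cell_inj jTx (j := i)) //; exists (c, v1).
  by case: (boundary_not_open (S := fun i => cell_dim i = n) (n := n) _ _ v1B Ej jTx).
Qed.

End CellMoves.

Lemma eq_continuous (T U : topologicalType) (f g : T -> U) :
  f =1 g -> continuous g -> continuous f.
Proof. by move=> /funext ->. Qed.

Section Families.
Context {R : realType}.

(** The point is adjusted for one map after the other, each time by at most half of the distance
    already gained for the maps treated before. *)
Lemma lipschitz_miss_seq (I : eqType) (m : I -> nat) n
    (L : forall i, 'rV[R]_(m i) -> 'rV[R]_n) (s : seq I) (z : 'rV[R]_n) (d : R) :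
  (forall i, i \in s -> (m i < n)%N) ->
  (forall i, exists2 C, 0 <= C & lipschitz_map C (L i)) -> 0 < d ->
  exists z' e, [/\ `|z' - z| <= d, 0 < e
    & forall i x, i \in s -> `|x| <= 1 -> e <= `|L i x - z'|].
Proof.
move=> + Llip; elim: s z d => [|i s IH] z d mn d0.
  by exists z, 1; rewrite subrr normr0; split => //; exact: ltW.
have d2 : 0 < d / 2 by rewrite divr_gt0.
have [|z1 [e1 [z1z e10 z1P]]] := IH z _ _ d2.
  by move=> j js; apply: mn; rewrite inE js orbT.
have [C C0 LC] := Llip i.
have min0 : 0 < Num.min (d / 2) (e1 / 2) by rewrite lt_min d2 divr_gt0.
have [z2 [e2 [z2z e20 z2P]]] := lipschitz_miss z1 (mn i (mem_head _ _)) C0 LC min0.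
move: z2z; rewrite le_min => /andP[z2d z2e].
exists z2, (Num.min e2 (e1 / 2)); split.
- by have := ler_normD (z2 - z1) (z1 - z); rewrite subrKA; lra.
- by rewrite lt_min e20 divr_gt0.
move=> j x; rewrite inE => /predU1P[E|js] x1; rewrite ge_min.
  by subst j; rewrite z2P.
apply/orP; right; have := z1P j x js x1.
have := ler_normD (L j x - z2) (z2 - z1); rewrite subrKA; lra.
Qed.

(** Tietze's theorem in each coordinate; the maximum norm lets the bound [e] pass unchanged.
    Continuity on the sphere is phrased by closed sets because [g] comes from a function that is
    continuous on a skeleton only. *)
Lemma sphere_extension m n (g : 'rV[R]_m -> 'rV[R]_n) (e : R) : 0 < e ->
  (forall C, closed C -> closed ([set v | sqnorm v = 1] `&` g @^-1` C)) ->
  (forall v, sqnorm v = 1 -> `|g v| <= e) ->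
  exists g' : 'rV[R]_m -> 'rV[R]_n, [/\ continuous g',
    (forall v, sqnorm v = 1 -> g' v = g v) & (forall v, `|g' v| <= e)].
Proof.
move=> e0 gC ge; pose A := [set v : 'rV[R]_m | sqnorm v = 1].
have clA : closed A.
  have -> : A = @sqnorm R m @^-1` [set 1] by [].
  apply: closed_comp => [v _|]; first exact: sqnorm_continuous.
  exact: closed_eq.
have ext j : exists g' : 'rV[R]_m -> R,
    [/\ {in A, (fun v => g v ord0 j) =1 g'}, continuous g' & forall v, `|g' v| <= e].
  apply: (@continuous_bounded_extension _ _ _ _ clA _ _ e0).
  - exact: pseudometric_normal.
  - apply/continuous_closedP => C cC; apply/closed_subspaceP.
    exists (A `&` g @^-1` ((fun w : 'rV[R]_n => w ord0 j) @^-1` C)).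
      apply: gC; apply: closed_comp => // w _; exact: coord_continuous.
    by rewrite setIC setIA setIid setIC.
  - by move=> v Av; rewrite (le_trans (le_coord_norm _ _)) // ge.
have [g' g'P] := choice ext.
exists (fun v => \row_j g' j v); split.
- apply: cont_mx => i j; under eq_fun do rewrite mxE.
  by have [] := g'P j.
- move=> v v1; apply/rowP => j; rewrite mxE; have [H _ _] := g'P j.
  by rewrite -H //; exact: mem_set.
- move=> v; apply: norm_le_coord => [|j]; first exact: ltW.
  by rewrite mxE; have [_ _] := g'P j.
Qed.

End Families.

(** * Invariant approximation by induction on skeleta *)

Section Approximation.
Context {R : realType} {G : topGroupType} (X : finite_gcw R G) (n : nat).
Local Notation D := (gcw_data X).
Let ax := gcw_axioms X.
Local Notation pts i := (Defs.orbit (cell_stab i) * disk R (cell_dim i))%type.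

Definition invariant_fun (h : X -> 'rV[R]_n) := forall a x, h (gact a x) = h x.

Definition orbit_base (i : cell D) : Defs.orbit (cell_stab i) :=
  \pi_(Defs.orbit (cell_stab i)) 1%g.

(** [G] is transitive on each orbit, so an invariant function is known on a cell once it is known on
    the disk over [orbit_base]. The constructions below take place on this one disk. *)
Lemma invariant_cell h (i : cell D) c v : invariant_fun h ->
  h (cell_map i (c, v)) = h (cell_map i (orbit_base i, v)).
Proof.
move=> hG; have -> : c = orbit_act (repr c) (orbit_base i).
  by rewrite orbit_act_pi mulg1 reprK.
by rewrite (cell_map_equivariant ax) hG.
Qed.

Lemma cell_disk_continuous (i : cell D) c :
  continuous (fun v : disk R (cell_dim i) => cell_map i (c, v)).
Proof.
apply: continuous_comp_all; last exact: (cell_map_continuous ax).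
by apply: continuous_pairing; [exact: cont_cst|move=> v].
Qed.

Lemma invariant_glue (S : cell D -> Prop) (g : forall i, disk R (cell_dim i) -> 'rV[R]_n) h :
  invariant_fun h -> invariant_fun (cell_glue S (fun i (p : pts i) => g i p.2) h).
Proof.
move=> hG a x; have [->|[i [[c v] [pI ->]]]] := cw_pointP x; first by rewrite gact_pt.
rewrite -(cell_map_equivariant ax).
have [Si|nSi] := pselect (S i); first by rewrite !cell_glue_in.
have out c' : cell_glue S (fun i (p : pts i) => g i p.2) h (cell_map i (c', v)) =
    h (cell_map i (c', v)).
  apply: cell_glue_out => j Sj ij; apply: nSi.
  by rewrite (open_cell_inj (x := cell_map i (c', v)) (i := i) (j := j)) //; exists (c', v).
by rewrite !out (cell_map_equivariant ax) hG.
Qed.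

Lemma glue_dist (S : cell D -> Prop) (g : forall i, disk R (cell_dim i) -> 'rV[R]_n) h h' (e : R) :
  (forall x, `|h x - h' x| <= e) ->
  (forall i c v, S i -> `|g i v - h' (cell_map i (c, v))| <= e) ->
  forall x, `|cell_glue S (fun i (p : pts i) => g i p.2) h x - h' x| <= e.
Proof.
move=> hh gh x.
have [[i [[c v] [Si [pI ->]]]]|nx] := pselect (exists (i : cell D) (p : pts i),
  S i /\ cell_interior (D := D) i p /\ x = cell_map i p).
  by rewrite cell_glue_in // gh.
by rewrite cell_glue_out // => i Si [p pI px]; apply: nx; exists i, p.
Qed.

(** The successive approximations are functions on all of [X], close to the given one everywhere,
    whose continuity is asked only on the cells treated so far. *)
Definition continuous_below k (h : X -> 'rV[R]_n) :=
  forall i : cell D, (cell_dim i < k)%N -> continuous (fun p => h (cell_map i p)).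

Lemma closed_below k h (C : set 'rV[R]_n) : continuous_below k h -> closed C ->
  closed (skeleton D k `&` h @^-1` C).
Proof.
move=> hk cC; apply: (cw_coherent ax (n := k)) => [x []//|i ik].
rewrite (_ : _ @^-1` _ = (fun p => h (cell_map i p)) @^-1` C).
  by have /continuous_closedP := hk i ik; apply.
apply/seteqP; split => p /=; first by case.
by move=> hC; split => //; exact: closed_cell_skeleton.
Qed.

(** It is the difference [h' - h], bounded by [e], that is extended over the [k]-cells. Adding [h]
    back yields an approximation as close to [h] as before. *)
Lemma extend_skeleton k (h h' : X -> 'rV[R]_n) (e : R) : 0 < e ->
  continuous h -> invariant_fun h -> invariant_fun h' ->
  (forall x, `|h' x - h x| <= e) -> continuous_below k h' ->
  exists h'' : X -> 'rV[R]_n, [/\ invariant_fun h'', (forall x, `|h'' x - h x| <= e),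
    continuous_below k.+1 h'' & forall x, skeleton D k x -> h'' x = h' x].
Proof.
move=> e0 ch hG h'G h'h h'k.
pose w x := h' x - h x.
have wk : continuous_below k w.
  move=> i ik; apply: contD; first exact: h'k.
  by apply: contN; apply: continuous_comp_all ch; exact: (cell_map_continuous ax).
have ext (j : cell D) : exists d : 'rV[R]_(cell_dim j) -> 'rV[R]_n, cell_dim j = k ->
    [/\ continuous d, (forall v : disk R (cell_dim j), sqnorm (val v) = 1 ->
       d (val v) = w (cell_map j (orbit_base j, v))) & (forall v, `|d v| <= e)].
  have [jk|jk] := eqVneq (cell_dim j) k; last by exists (fun=> 0) => E; rewrite E eqxx in jk.
  have [||d [cd dw de]] := @sphere_extension R (cell_dim j) n
    (fun v => w (cell_map j (orbit_base j, projd v))) _ e0.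
  - move=> C cC.
    rewrite (_ : _ `&` _ = [set v | sqnorm v = 1] `&`
      (fun v => cell_map j (orbit_base j, projd v)) @^-1` (skeleton D k `&` w @^-1` C)).
      apply: closedI.
        apply: (@closed_comp _ _ (@sqnorm R _) [set 1]); last exact: closed_eq.
        by move=> v _; exact: sqnorm_continuous.
      apply: closed_comp; last exact: closed_below.
      have cj : continuous (fun v => cell_map j (orbit_base j, projd v)).
        apply: (continuous_comp_all (f := @projd R _)
          (h := fun v => cell_map j (orbit_base j, v))).
          exact: projd_continuous.
        exact: cell_disk_continuous.
      by move=> v _; exact: cj.
    apply/seteqP; split => v /= [v1]; last by case.
    move=> wC; split => //; split => //; rewrite -jk.
    apply: (cell_map_boundary ax); exists (orbit_base j, projd v) => //.
    by rewrite /cell_boundary /= sqnorm_radproj1 // v1.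
  - by move=> v _; exact: h'h.
  by exists d => _; split => // v v1; rewrite dw // projdK.
pose d j := projT1 (cid (ext j)).
have dP (j : cell D) : cell_dim j = k -> _ := projT2 (cid (ext j)).
pose S (j : cell D) := cell_dim j = k.
pose g (j : cell D) (v : disk R (cell_dim j)) := h (cell_map j (orbit_base j, v)) + d j (val v).
pose h'' := cell_glue S (fun i (p : pts i) => g i p.2) h'.
have S_dim i : S i -> cell_dim i = k by [].
have gb i (p : pts i) : S i -> cell_boundary (D := D) i p -> g i p.2 = h' (cell_map i p).
  case: p => c v Si v1; have [_ dv _] := dP i Si.
  by rewrite /g /= /d dv // /w addrC subrK (invariant_cell c v h'G).
exists h''; split.
- exact: invariant_glue.
- apply: glue_dist => // i c v Si; rewrite (invariant_cell c v hG) /g addrC addKr.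
  by have [_ _ de] := dP i Si; exact: de.
- move=> i; rewrite ltnS leq_eqVlt => /predU1P[Si|ik].
    rewrite /h''; under eq_fun do rewrite (cell_glue_cell S_dim gb) //.
    apply: (continuous_comp_all (f := snd)); first exact: continuous_snd.
    apply: contD.
      by apply: continuous_comp_all ch; exact: cell_disk_continuous.
    apply: continuous_comp_all; first exact: disk_val_continuous.
    by have [] := dP i Si.
  have nSi : ~ S i by move=> Si; rewrite Si ltnn in ik.
  apply: eq_continuous (h'k i ik) => p.
  by apply: (cell_glue_other _ _ S_dim _ nSi); exact: ltnW.
- move=> x xk; apply: cell_glue_out => i Si ix.
  move: xk => [xpt|[j jk jx]].
    by move: ix; rewrite xpt => /(open_cell_pt ax).
  by move: jk; rewrite /= (open_cell_inj jx ix) Si ltnn.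
Qed.

End Approximation.

Lemma lipschitz_continuous (R : realType) (V W : normedModType R) (C : R) (f : V -> W) :
  0 <= C -> lipschitz_map C f -> continuous f.
Proof.
move=> C0 fC x; apply/cvgrPdist_lt => e e0.
have C1 : 0 < C + 1 by rewrite ltr_wpDl.
apply/nbhs_ballP; exists (e / (C + 1)) => /=; first by rewrite divr_gt0.
move=> y; rewrite -ball_normE /= ltr_pdivlMr // => xy.
apply: le_lt_trans xy; apply: le_trans (fC x y) _.
by rewrite mulrC ler_wpM2l // lerDl.
Qed.

Section Avoidance.
Context {R : realType} {G : topGroupType} (X : finite_gcw R G) (n : nat).
Local Notation D := (gcw_data X).
Let ax := gcw_axioms X.
Local Notation pts i := (Defs.orbit (cell_stab i) * disk R (cell_dim i))%type.

(* A map that avoids the origin on the boundaries of the [k]-cells is made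
   Lipschitz on the interior of these cells; as [k < n] it then misses a point
   near the origin, which is moved to the origin by a translation. *)
Lemma avoid_skeleton k (h : X -> 'rV[R]_n) (d e : R) : (k < n)%N -> 0 < d -> 0 < e ->
  invariant_fun h -> continuous_below k.+1 h ->
  (forall x, skeleton D k x -> e <= `|h x|) ->
  exists (h' : X -> 'rV[R]_n) (e' : R), [/\ invariant_fun h', 0 < e',
    (forall x, `|h' x - h x| <= d), continuous_below k.+1 h'
    & forall x, skeleton D k.+1 x -> e' <= `|h' x|].
Proof.
move=> kn d0 e0 hG hk he.
pose e1 := Num.min d e; have e10 : 0 < e1 by rewrite lt_min d0.
have e1d : e1 <= d by rewrite ge_min lexx.
have e1e : e1 <= e by rewrite ge_min lexx orbT.
(* In the collar [|h|] is at least [e1 / 2]; changing it by [eta] and translating by [z] with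
   [|z| <= eta] leaves [e1 / 4]. *)
pose eta := e1 / 8; have eta0 : 0 < eta by rewrite divr_gt0.
pose phi (j : cell D) v := h (cell_map j (orbit_base j, projd v)).
pose S (j : cell D) := cell_dim j = k.
have S_dim i : S i -> cell_dim i = k by [].
have cphi (j : cell D) : S j -> continuous (phi j).
  move=> Sj; apply: (continuous_comp_all (f := @projd R _)
      (h := fun v => h (cell_map j (orbit_base j, v)))).
    exact: projd_continuous.
  apply: (continuous_comp_all (f := fun v => (orbit_base j, v))
    (h := fun p => h (cell_map j p))).
    by apply: continuous_pairing; [exact: cont_cst|move=> v].
  by apply: hk; rewrite Sj.
have lip (j : cell D) : exists L : 'rV[R]_(cell_dim j) -> 'rV[R]_n,
    (exists2 C, 0 <= C & lipschitz_map C L) /\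
    (S j -> forall v, disk_set R _ v -> `|L v - phi j v| <= eta).
  have [Sj|nSj] := pselect (S j); last first.
    exists (fun=> 0); split => //; exists 0 => // v w.
    by rewrite subrr normr0 mul0r.
  have [|L [C [C0 LC Lphi]]] := lipschitz_approx (@disk_set_compact R _) _ (cphi j Sj) eta0.
    by exists 0; rewrite /disk_set /= sqnorm0.
  by exists L; split => //; exists C.
pose L j := projT1 (cid (lip j)); have LP j := projT2 (cid (lip j)).
have [|i|z [e2 [z_eta e20 z_miss]]] := lipschitz_miss_seq
  (s := [seq j <- enum (cell D) | cell_dim j == k]) (L := L) 0 _ _ eta0.
- by move=> i; rewrite mem_filter => /andP[/eqP -> _].
- by have [] := LP i.
rewrite subr0 in z_eta.
have collar (j : cell D) : exists r : R, S j -> r < 1 /\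
    forall v : disk R (cell_dim j), r <= sqnorm (val v) -> e1 / 2 <= `|phi j (val v)|.
  have [Sj|nSj] := pselect (S j); last by exists 0.
  have [|||r [r0 r1 rP]] := @disk_collar R (cell_dim j)
    (fun v => Num.max 0 (e1 - `|phi j (val v)|)) (e1 / 2).
  - apply: cont_max; first exact: cont_cst.
    apply: contD; first exact: cont_cst.
    apply: contN; apply: cont_norm.
    exact: continuous_comp_all (@disk_val_continuous _ _) (cphi j Sj).
  - by rewrite divr_gt0.
  - move=> v v1; rewrite max_l // subr_le0 (le_trans e1e) //.
    rewrite /phi projdK he // -Sj.
    by apply: (cell_map_boundary ax); exists (orbit_base j, v).
  - exists r => _; split => // v /rP; rewrite ger0_norm ?le_max ?lexx // gt_max.
    by move=> /andP[_]; lra.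
pose r j := projT1 (cid (collar j)); have rP j := projT2 (cid (collar j)).
pose mu (j : cell D) (v : 'rV[R]_(cell_dim j)) := clamp ((1 - sqnorm v) / (1 - r j)).
pose g (j : cell D) (v : disk R (cell_dim j)) :=
  phi j (val v) + mu j (val v) *: (L j (val v) - phi j (val v)).
pose h1 := cell_glue S (fun i (p : pts i) => g i p.2) h.
have gb i (p : pts i) : S i -> cell_boundary (D := D) i p -> g i p.2 = h (cell_map i p).
  case: p => c v Si; rewrite /cell_boundary /= => v1.
  rewrite /g /mu v1 subrr mul0r clamp_le0 // scale0r addr0 /phi projdK.
  by rewrite (invariant_cell c v hG).
have gphi i (v : disk R (cell_dim i)) : S i -> `|g i v - phi i (val v)| <= eta.
  move=> Si; rewrite /g addrC addKr normrZ.
  have /andP[m0 m1] := clamp_itv ((1 - sqnorm (val v)) / (1 - r i)).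
  rewrite ger0_norm // -[leRHS]mul1r.
  have [_ /(_ Si (val v) (diskP v)) H] := LP i.
  by rewrite (@le_trans _ _ (1 * `|L i (val v) - phi i (val v)|)) ?ler_wpM2r // !mul1r.
have h1G : invariant_fun h1 by exact: invariant_glue.
have h1h x : `|h1 x - h x| <= eta.
  apply: glue_dist => [y|i c v Si]; first by rewrite subrr normr0 ltW.
  by rewrite (invariant_cell c v hG); have := gphi i v Si; rewrite /phi projdK.
have nSi i : (cell_dim i < k)%N -> ~ S i by move=> ik Si; rewrite Si ltnn in ik.
exists (fun x => h1 x - z), (Num.min e2 (e1 / 4)); split.
- by move=> a x; rewrite h1G.
- by rewrite lt_min e20 divr_gt0.
- move=> x; rewrite addrAC (le_trans (ler_normB _ _)) //.
  by have := h1h x; rewrite /eta in z_eta *; lra.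
- move=> i ik; apply: contD; last exact: cont_cst.
  move: ik; rewrite ltnS leq_eqVlt => /predU1P[Si|ik].
    rewrite /h1; under eq_fun do rewrite (cell_glue_cell S_dim gb) //.
    apply: (continuous_comp_all (f := snd)); first exact: continuous_snd.
    apply: (@continuous_comp_all _ _ _ (fun v : disk R (cell_dim i) => val v)
      (fun v => phi i v + mu i v *: (L i v - phi i v))).
      exact: disk_val_continuous.
    have [[C C0 LC] _] := LP i.
    apply: contD; first exact: cphi.
    apply: contZ.
      apply: cont_clamp; apply: contM; last exact: cont_cst.
      apply: contD; first exact: cont_cst.
      by apply: contN; exact: sqnorm_continuous.
    apply: contD; last by apply: contN; exact: cphi.
    exact: lipschitz_continuous C0 LC.
  have := hk i (ltnW ik); apply: eq_continuous => p.
  by apply: (cell_glue_other _ _ S_dim _ (nSi _ ik)); exact: ltnW.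
move=> x; have [xk|nxk] := pselect (skeleton D k x).
  have E : h1 x = h x.
    by apply: cell_glue_out => i Si; apply: (skeleton_notin xk).
  move=> _; rewrite ge_min; apply/orP; right; rewrite E.
  have := he x xk; have := ler_normD (h x - z) z; rewrite subrK /eta in z_eta *; lra.
move=> [xpt|[i]]; first by case: nxk; left.
rewrite /= ltnS leq_eqVlt => /predU1P[Si|ik] ix; last by case: nxk; right; exists i.
move: ix => [[c v] vI <-]; rewrite {1}/h1 (cell_glue_cell S_dim gb) //= ge_min.
have [vr|/ltW vr] := leP (r i) (sqnorm (val v)); apply/orP.
  right; have [r1 /(_ v vr)] := rP i Si; have := gphi i v Si.
  have := ler_normD (g i v - z) z; rewrite subrK.
  have := ler_normB (g i v) (g i v - phi i (val v)); rewrite opprB addrC subrK.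
  rewrite /eta in z_eta *; lra.
left; have [r1 _] := rP i Si.
rewrite /g /mu clamp_ge1; last by rewrite ler_pdivlMr ?subr_gt0 // mul1r; lra.
rewrite scale1r [phi i _ + _]addrC subrK; apply: z_miss.
  by rewrite mem_filter Si eqxx mem_enum.
have := norm_le_sqnorm (val v); have := diskP v => v1 vn.
by rewrite -(@ler_pXn2r _ 2) ?nnegrE // expr1n (le_trans vn).
Qed.

End Avoidance.

Section CellularApproximation.
Context {R : realType} {G : topGroupType} (X : finite_gcw R G) (n : nat).
Local Notation D := (gcw_data X).
Let ax := gcw_axioms X.
Context (X_dim : forall i : cell D, (cell_dim i <= n)%N) (n_gt0 : (0 < n)%N).

Lemma skeletal_approximation k (h : X -> 'rV[R]_n) (d : R) : (k <= n)%N -> 0 < d ->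
  continuous h -> invariant_fun h ->
  exists (h' : X -> 'rV[R]_n) (e : R), [/\ invariant_fun h', 0 < e,
    (forall x, `|h' x - h x| <= d), continuous_below k h'
    & forall x, skeleton D k x -> e <= `|h' x|].
Proof.
move=> + + ch hG; elim: k d => [|k IH] d kn d0.
  have [hd|hd] := leP (d / 2) `|h gpt|.
    exists h, (d / 2); split => //; first by rewrite divr_gt0.
      by move=> x; rewrite subrr normr0 ltW.
    by move=> x [->|[]].
  (* The skeleton at [k = 0] is the base point. If its value is within [d / 2] of the origin, a
     translation by a vector of norm [d] takes it at least [d / 2] away. *)
  pose a : 'rV[R]_n := const_mx d.
  have ad : `|a| = d.
    apply/eqP; rewrite eq_le; apply/andP; split.
      by apply: norm_le_coord => [|j]; rewrite ?mxE ?gtr0_norm // ltW.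
    by have := le_coord_norm a (Ordinal n_gt0); rewrite mxE gtr0_norm.
  exists (fun x => h x - a), (d / 2); split.
  - by move=> b x; rewrite hG.
  - by rewrite divr_gt0.
  - by move=> x; rewrite addrAC subrr add0r normrN ad.
  - by [].
  - move=> x [->|[]//]; have := ler_normB (h gpt) (h gpt - a).
    by rewrite opprB addrC subrK ad; lra.
have d2 : 0 < d / 2 by rewrite divr_gt0.
have [h1 [e1 [h1G e10 h1h h1k h1e]]] := IH _ (ltnW kn) d2.
(* Continuity is first gained on the [k]-cells within the same [d / 2]; the other half of the
   tolerance pays for leaving the origin. *)
have [h2 [h2G h2h h2k h21]] := extend_skeleton d2 ch hG h1G h1h h1k.
have [x xk|h3 [e3 [h3G e30 h32 h3k h3e]]] := avoid_skeleton kn d2 e10 h2G h2k.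
  by rewrite h21 // h1e.
exists h3, e3; split => // x.
by have := ler_normD (h3 x - h2 x) (h2 x - h x); rewrite subrKA; have := h32 x; have := h2h x; lra.
Qed.

Lemma avoiding_approximation (h : X -> 'rV[R]_n) (d : R) : 0 < d ->
  continuous h -> invariant_fun h ->
  exists (h' : X -> 'rV[R]_n) (e : R), [/\ continuous h', invariant_fun h', 0 < e,
    (forall x, `|h' x - h x| <= d) & forall x, skeleton D n x -> e <= `|h' x|].
Proof.
move=> d0 ch hG.
have [h1 [e [h1G e0 h1h h1k h1e]]] := skeletal_approximation (leqnn n) d0 ch hG.
have [h2 [h2G h2h h2k h21]] := extend_skeleton d0 ch hG h1G h1h h1k.
exists h2, e; split => // [|x xn]; last by rewrite h21 // h1e.
by apply: cw_continuous => i; apply: h2k; rewrite ltnS.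
Qed.

Lemma norm_resize m (v : 'rV[R]_m) : m = n -> `|resize n v| = `|v|.
Proof. by move=> E; subst n; rewrite resize_id. Qed.

(** If [f1] sent a point [x] of the skeleton to within [e'] of the centre of an [n]-cell, the
    coordinate there would be [h' x], of norm at least [e']. So the skeleton avoids these small
    balls, and the expansion sweeps its image into the skeleton. *)
Lemma cellular_approximation (f : gmap X X) :
  exists f1 f2 : gmap X X, [/\ ghomotopic R f f1, ghomotopic R f1 f2
    & forall x, skeleton D n x -> skeleton D n (f2 x)].
Proof.
have [u [T [cu uG [T0 _] Tsmall _]]] :=
  cell_perturbation X_dim (S := fun i => cell_dim i = n) (fun i E => E).
pose h x := u (f x).
have ch : continuous h by apply: continuous_comp_all cu; exact: gmap_continuous.
have hG : invariant_fun h by move=> a x; rewrite /h gmap_equivariant uG.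
have [h' [e [ch' h'G e0 h'h h'e]]] := avoiding_approximation (margin_gt0 n) ch hG.
pose e' := Num.min (margin n) (Num.min e 1).
have e'0 : 0 < e' by rewrite !lt_min margin_gt0 e0 ltr01.
have [e'm e'e e'1] : [/\ e' <= margin n, e' <= e & e' <= 1].
  by rewrite /e' !ge_min !lexx !orbT.
have [E [E0 Esk Ecell]] := cell_expansion X_dim e'0 e'1.
have cK : continuous (fun q : R * X => T (q.1 *: (h' q.2 - h q.2)) (f q.2)).
  apply: (continuous_comp_all (f := fun q : R * X => (q.1 *: (h' q.2 - h q.2), f q.2)) _
    (@gfam_continuous _ _ _ _ T)).
  have cs := @continuous_snd R X.
  apply: continuous_pairing; last exact: continuous_comp_all cs (@gmap_continuous _ _ _ f).
  apply: contZ; first exact: continuous_fst.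
  apply: contD; first exact: continuous_comp_all cs ch'.
  by apply: contN; exact: continuous_comp_all cs ch.
have eK l a x : T (l *: (h' (gact a x) - h (gact a x))) (f (gact a x)) =
    gact a (T (l *: (h' x - h x)) (f x)).
  by rewrite h'G hG gmap_equivariant gfam_equivariant.
have pK l : T (l *: (h' gpt - h gpt)) (f gpt) = gpt by rewrite gmap_pt gfam_pt.
pose K : gfamily R X X := GFamily cK eK pK.
pose f1 := gfam_map K 1.
exists f1, (gcomp (gfam_map E 1) f1); split.
- by apply: (gfam_homotopic (K := K)) => // x /=; rewrite scale0r T0.
- by apply: (gfam_homotopic (K := gfam_pre E f1)) => // x /=; rewrite E0.
move=> x xn /=; rewrite scale1r; set y := T _ _.
have [->|[i [[c v] [pI yE]]]] := cw_pointP y; first by rewrite gfam_pt; left.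
have [Ei|nEi] := eqVneq (cell_dim i) n; last first.
  have yn : skeleton D n y.
    right; exists i; last by exists (c, v).
    by rewrite /= ltn_neqAle nEi X_dim.
  by rewrite Esk.
rewrite yE; have [v' [-> v'e]] := Ecell i c v Ei.
have [/v'e v'1|small] := leP e' `|val v|.
  by rewrite -Ei; apply: (cell_map_boundary ax); exists (c, v').
have := Tsmall (f x) (h' x) i c v Ei (h'h x) yE (lt_le_trans small e'm).
move=> vh; have := h'e x xn; rewrite -vh norm_resize // => /(le_trans e'e).
by rewrite leNgt small.
Qed.

End CellularApproximation.

(** * Consequences of the axioms *)

Section AbstractLefschetz.
Context {R : realType} {G : topGroupType}.

Program Definition gzero (X Y : gspace G) : gmap X Y := @GMap G X Y (fun=> gpt) _ _ _.
Next Obligation. by move=> X Y; exact: cont_cst. Qed.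
Next Obligation. by move=> *; rewrite gact_pt. Qed.
Next Obligation. by []. Qed.

Section Subcomplexes.
Context (X : finite_gcw R G).
Local Notation D := (gcw_data X).

Program Definition point_subcomplex : subcomplex X := @Subcomplex R G X [set gpt] _ _.
Next Obligation. by []. Qed.
Next Obligation. by move=> x ->; left. Qed.

Program Definition skeleton_subcomplex (n : nat) : subcomplex X :=
  @Subcomplex R G X (skeleton D n) _ _.
Next Obligation. by move=> n; left. Qed.
Next Obligation.
move=> n x [->|[i lin ix]]; [by left | right; exists i; split => //].
by move=> _ [p _ <-]; exact: closed_cell_skeleton.
Qed.

Definition disk_center n : disk R n := projd 0.

Lemma sqnorm_center n : sqnorm (val (disk_center n)) = 0.
Proof. by rewrite /= radproj_id sqnorm0. Qed.

Lemma open_cell_center (i : cell D) c : open_cell i (cell_map i (c, disk_center _)).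
Proof. by exists (c, disk_center _) => //=; rewrite /cell_interior /= sqnorm_center. Qed.

Lemma in_skeleton_subcomplex n (i : cell D) : (forall j : cell D, (cell_dim j <= n)%N) ->
  in_sc (skeleton_subcomplex n) i = (cell_dim i < n)%N.
Proof.
move=> X_dim; apply/asboolP/idP => [isk|lin].
  rewrite ltn_neqAle X_dim andbT; apply/eqP => Ei.
  have := skeleton_notin _ Ei (open_cell_center (orbit_base i)); apply.
  by apply: isk; exact/open_cell_closed_cell/open_cell_center.
by move=> _ [p _ <-]; exact: closed_cell_skeleton.
Qed.

End Subcomplexes.

Context {B : zmodType} (l : assignment R G B).

(** The conditions shared by a Lefschetz number and by an assignment subject to the first three
    axioms of the theorem. They are linear in [l], hence pass to differences. *)
Record lefschetz_axioms : Prop := LefschetzAxioms {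
  la_homotopy : forall (X : finite_gcw R G) (f h : gmap X X), ghomotopic R f h -> l f = l h;
  la_commutativity : commutativity l;
  la_cofibration : cofibration_axiom l
}.

Context (la : lefschetz_axioms).

Lemma la_eqfun (X : finite_gcw R G) (f h : gmap X X) : f =1 h -> l f = l h.
Proof. by move=> fh; apply: (la_homotopy la); exact: eqfun_homotopic. Qed.

(** Commutativity applied to [b] and [a \o f]. In particular the value does not depend on the cell
    structure. *)
Lemma la_conj (X Y : finite_gcw R G) (a : gmap X Y) (b : gmap Y X)
    (f : gmap X X) (h : gmap Y Y) :
  cancel a b -> cancel b a -> (forall x, a (f x) = h (a x)) -> l f = l h.
Proof.
move=> ab ba af; transitivity (l (gcomp b (gcomp a f))).
  by apply: la_eqfun => x /=; rewrite ab.
rewrite (la_commutativity la); apply: la_eqfun => y /=.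
by rewrite af ba.
Qed.

(** All one-point complexes have the same value by [la_conj], and the subcomplex and the quotient in
    the cofibration axiom are again points; it reads [l f = l f + l f]. *)
Lemma la_point (X : finite_gcw R G) (f : gmap X X) : (forall x : X, x = gpt) -> l f = 0.
Proof.
have eq_pt (Y Z : finite_gcw R G) (g : gmap Y Y) (h : gmap Z Z) :
    (forall y : Y, y = gpt) -> (forall z : Z, z = gpt) -> l g = l h.
  move=> Ypt Zpt; apply: (@la_conj _ _ (gzero Y Z) (gzero Z Y)) => //.
move=> Xpt; have fA : set_fun (sc_set (point_subcomplex X)) (sc_set (point_subcomplex X)) f.
  by move=> x _; exact: Xpt.
have := la_cofibration la fA; rewrite -[X in _ = X + _](eq_pt X _ f) //; last first.
  by move=> [y yP]; apply: val_inj; exact: Xpt.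
rewrite -[X in _ = _ + X](eq_pt X _ f) //; last first.
  by move=> y; have [x ->] := quot_surj y; rewrite [x]Xpt.
by move/eqP; rewrite -subr_eq0 opprD addNKr oppr_eq0 => /eqP.
Qed.

(** The constant map factors through a point, so commutativity moves the computation there. *)
Lemma la_zero (X : finite_gcw R G) : l (gzero X X) = 0.
Proof.
pose P := sub_gcw (point_subcomplex X).
transitivity (l (gcomp (gzero P X) (gzero X P))); first exact: la_eqfun.
rewrite (la_commutativity la); apply: la_point => -[x xP].
by apply: val_inj; exact: set_mem xP.
Qed.

Lemma la_contractible (X : finite_gcw R G) (K : gfamily R X X) (f : gmap X X) :
  (forall x, K 0 x = x) -> (forall x, K 1 x = gpt) -> l f = 0.
Proof.
move=> K0 K1; rewrite -(la_zero X); apply: (la_homotopy la).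
apply: (gfam_homotopic (K := gfam_post f K)) => x /=; first by rewrite K0.
by rewrite K1 gmap_pt.
Qed.

Lemma la_reduction :
  (forall k (X : finite_gcw R G) (f : gmap X X),
     (forall i : cell (gcw_data X), cell_dim i = k) -> l f = 0) ->
  forall (X : finite_gcw R G) (f : gmap X X), l f = 0.
Proof.
move=> l_pure X f.
suff main n : forall (Y : finite_gcw R G) (h : gmap Y Y),
    (forall i : cell (gcw_data Y), (cell_dim i < n)%N) -> l h = 0.
  apply: (main (\max_(i : cell (gcw_data X)) cell_dim i).+1) => i.
  by rewrite ltnS; exact: leq_bigmax.
elim: n => [|n IH] {X f} X f X_dim.
  apply: la_point => x; have [//|[i _]] := cw_pointP x.
  by have := X_dim i.
have [n0|n_gt0] := posnP n.
  by apply: (l_pure 0) => i; have := X_dim i; rewrite n0 ltnS leqn0 => /eqP.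
have X_le (i : cell (gcw_data X)) : (cell_dim i <= n)%N by rewrite -ltnS.
have [f1 [f2 [ff1 f12 f2n]]] := cellular_approximation X_le n_gt0 f.
rewrite (la_homotopy la ff1) (la_homotopy la f12).
have fA : set_fun (sc_set (skeleton_subcomplex X n)) (sc_set (skeleton_subcomplex X n)) f2.
  exact: f2n.
rewrite (la_cofibration la fA) IH => [|[i iA] /=].
  rewrite add0r; apply: (l_pure n) => -[i iA] /=.
  move: iA; rewrite in_skeleton_subcomplex // -leqNgt => ni.
  by apply/eqP; rewrite eqn_leq X_le.
by move: iA; rewrite in_skeleton_subcomplex.
Qed.

End AbstractLefschetz.

(** * Cutting cells in two halves *)

Section ConsVectors.
Context {R : realType}.

Definition headv p (v : 'rV[R]_p.+1) : R := v ord0 ord0.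
Definition tailv p (v : 'rV[R]_p.+1) : 'rV[R]_p := \row_j v ord0 (lift ord0 j).
Definition consv p (t : R) (w : 'rV[R]_p) : 'rV[R]_p.+1 :=
  \row_j (if unlift ord0 j is Some j' then w ord0 j' else t).

Lemma headv_cons p t (w : 'rV[R]_p) : headv (consv t w) = t.
Proof. by rewrite /headv mxE unlift_none. Qed.

Lemma tailv_cons p t (w : 'rV[R]_p) : tailv (consv t w) = w.
Proof. by apply/rowP => j; rewrite !mxE liftK. Qed.

Lemma consv_head_tail p (v : 'rV[R]_p.+1) : consv (headv v) (tailv v) = v.
Proof.
apply/rowP => j; rewrite mxE; case: unliftP => [j' ->|->] //.
by rewrite mxE.
Qed.

Lemma sqnorm_head_tail p (v : 'rV[R]_p.+1) :
  sqnorm v = headv v ^+ 2 + sqnorm (tailv v).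
Proof.
by rewrite /sqnorm big_ord_recl; congr (_ + _); apply: eq_bigr => j _; rewrite mxE.
Qed.

Lemma sqnorm_cons p t (w : 'rV[R]_p) : sqnorm (consv t w) = t ^+ 2 + sqnorm w.
Proof. by rewrite sqnorm_head_tail headv_cons tailv_cons. Qed.

Lemma headv_continuous p : continuous (@headv p).
Proof. exact: coord_continuous. Qed.

Lemma tailv_continuous p : continuous (@tailv p).
Proof.
apply: cont_mx => i j; rewrite [X in continuous X](_ : _ = fun v : 'rV[R]_p.+1 => v ord0 (lift ord0 j)).
  exact: coord_continuous.
by apply/funext => v; rewrite mxE.
Qed.

Lemma cont_consv (T : topologicalType) p (f : T -> R) (g : T -> 'rV[R]_p) :
  continuous f -> continuous g -> continuous (fun x => consv (f x) (g x)).
Proof.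
move=> cf cg; apply: cont_mx => i j; case: (unliftP ord0 j) => [j' E|E].
  rewrite [X in continuous X](_ : _ = fun x => g x ord0 j'); first exact: cont_coord.
  by apply/funext => x; rewrite mxE E liftK.
rewrite [X in continuous X](_ : _ = f) //.
by apply/funext => x; rewrite mxE E unlift_none.
Qed.

Lemma norm_consv p (t : R) (w : 'rV[R]_p) (e : R) : 0 <= e ->
  (`|consv t w| <= e) = (`|t| <= e) && (`|w| <= e).
Proof.
move=> e0; apply/idP/andP => [h|[h1 h2]].
  split; first by rewrite -(headv_cons t w) (le_trans (le_coord_norm _ _)).
  apply: norm_le_coord => // j; apply: le_trans h.
  by have := le_coord_norm (consv t w) (lift ord0 j); rewrite mxE liftK.
apply: norm_le_coord => // j; rewrite mxE; case: unlift => // j'.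
exact: le_trans (le_coord_norm _ _) h2.
Qed.

Lemma consvB p (t t' : R) (w w' : 'rV[R]_p) :
  consv t w - consv t' w' = consv (t - t') (w - w').
Proof. by apply/rowP => j; rewrite !mxE; case: unlift => // j'; rewrite !mxE. Qed.

(** Half the length of the vertical chord of the unit ball over [w]. *)
Definition chord p (w : 'rV[R]_p) : R := Num.sqrt (1 - sqnorm w).

Lemma chord_ge0 p (w : 'rV[R]_p) : 0 <= chord w.
Proof. exact: sqrtr_ge0. Qed.

Lemma chord_continuous p : continuous (@chord p).
Proof.
apply: cont_sqrt; apply: contD; first exact: cont_cst.
by apply: contN; exact: sqnorm_continuous.
Qed.

Lemma sqr_chord p (w : 'rV[R]_p) : sqnorm w <= 1 -> chord w ^+ 2 = 1 - sqnorm w.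
Proof. by move=> w1; rewrite sqr_sqrtr // subr_ge0. Qed.

Lemma sqnorm_tail_le p (v : 'rV[R]_p.+1) : sqnorm (tailv v) <= sqnorm v.
Proof. by rewrite sqnorm_head_tail lerDr sqr_ge0. Qed.

Lemma sqnorm_le1P p (v : 'rV[R]_p.+1) : sqnorm v <= 1 <->
  sqnorm (tailv v) <= 1 /\ `|headv v| <= chord (tailv v).
Proof.
have E : sqnorm (tailv v) <= 1 ->
    (`|headv v| <= chord (tailv v)) = (headv v ^+ 2 <= 1 - sqnorm (tailv v)).
  move=> t1; rewrite -(@ler_pXn2r _ 2) ?nnegrE ?chord_ge0 // sqr_chord //.
  by rewrite real_normK ?num_real.
split=> [v1|[t1]].
  have t1 := le_trans (sqnorm_tail_le v) v1; split => //.
  by rewrite E //; move: v1; rewrite sqnorm_head_tail; lra.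
by rewrite E // sqnorm_head_tail; lra.
Qed.

Lemma sqnorm_lt1P p (v : 'rV[R]_p.+1) : sqnorm (tailv v) <= 1 ->
  (sqnorm v < 1) = (`|headv v| < chord (tailv v)).
Proof.
move=> t1; rewrite -[RHS](@ltr_pXn2r _ 2) ?nnegrE ?chord_ge0 // sqr_chord //.
by rewrite real_normK ?num_real // sqnorm_head_tail; apply/idP/idP; lra.
Qed.

Definition sg (s : bool) : R := if s then 1 else -1.

Lemma sg_sqr s : sg s * sg s = 1.
Proof. by case: s; rewrite /sg ?mulr1 // mulrNN mulr1. Qed.

(** Vertical affine maps of the disk onto its half [0 <= sg s * headv]. *)
Definition fold_half s p (v : 'rV[R]_p.+1) : 'rV[R]_p.+1 :=
  consv ((headv v + sg s * chord (tailv v)) / 2) (tailv v).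

Definition unfold_half s p (v : 'rV[R]_p.+1) : 'rV[R]_p.+1 :=
  consv (2 * headv v - sg s * chord (tailv v)) (tailv v).

Lemma fold_halfK s p : cancel (@fold_half s p) (unfold_half s (p := p)).
Proof.
move=> v; rewrite /unfold_half /fold_half headv_cons tailv_cons -[RHS]consv_head_tail.
by congr (consv _ _); field.
Qed.

Lemma unfold_halfK s p : cancel (@unfold_half s p) (fold_half s (p := p)).
Proof.
move=> v; rewrite /unfold_half /fold_half headv_cons tailv_cons -[RHS]consv_head_tail.
by congr (consv _ _); field.
Qed.

Lemma fold_half_continuous s p : continuous (@fold_half s p).
Proof.
apply: cont_consv; last exact: tailv_continuous.
apply: contM; last exact: cont_cst.
apply: contD; first exact: headv_continuous.
apply: contM; first exact: cont_cst.
exact: continuous_comp_all (@tailv_continuous p) (@chord_continuous p).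
Qed.

Lemma unfold_half_continuous s p : continuous (@unfold_half s p).
Proof.
apply: cont_consv; last exact: tailv_continuous.
apply: contD; first by apply: contM; [exact: cont_cst|exact: headv_continuous].
apply: contN; apply: contM; first exact: cont_cst.
exact: continuous_comp_all (@tailv_continuous p) (@chord_continuous p).
Qed.

Lemma fold_half_disk s p (v : 'rV[R]_p.+1) : sqnorm v <= 1 ->
  sqnorm (fold_half s v) <= 1 /\ 0 <= sg s * headv (fold_half s v).
Proof.
move=> /sqnorm_le1P[t1 h]; have := chord_ge0 (tailv v); move: h; rewrite ler_norml.
move=> /andP[h1 h2] h3; split.
  apply/sqnorm_le1P; rewrite /fold_half tailv_cons headv_cons; split => //.
  by rewrite ler_norml /sg; case: s; apply/andP; lra.
by rewrite /fold_half headv_cons /sg; case: s; lra.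
Qed.

Lemma fold_half_interior s p (v : 'rV[R]_p.+1) : sqnorm v < 1 ->
  sqnorm (fold_half s v) < 1 /\ 0 < sg s * headv (fold_half s v).
Proof.
move=> v1; have t1 := le_trans (sqnorm_tail_le v) (ltW v1).
move: v1; rewrite sqnorm_lt1P // ltr_norml => /andP[h1 h2]; split.
  rewrite sqnorm_lt1P /fold_half tailv_cons ?headv_cons //.
  by rewrite ltr_norml /sg; case: s; apply/andP; lra.
by rewrite /fold_half headv_cons /sg; case: s; lra.
Qed.

(** A boundary point is an end of its vertical chord. The end on side [s] stays fixed, the other one
    goes to the midpoint. *)
Lemma fold_half_boundary s p (v : 'rV[R]_p.+1) : sqnorm v = 1 ->
  sqnorm (fold_half s v) = 1 \/ headv (fold_half s v) = 0.
Proof.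
move=> v1; have /sqnorm_le1P[t1 _] : sqnorm v <= 1 by rewrite v1.
have : (headv v - chord (tailv v)) * (headv v + chord (tailv v)) = 0.
  by rewrite -subr_sqr sqr_chord // -v1 sqnorm_head_tail; ring.
rewrite /fold_half sqnorm_cons headv_cons => /eqP; rewrite mulf_eq0.
move=> /orP[]/eqP E; case: s; rewrite /sg.
- left; have -> : headv v = chord (tailv v) by lra.
  have -> : (chord (tailv v) + 1 * chord (tailv v)) / 2 = chord (tailv v) by field.
  by rewrite sqr_chord // subrK.
- by right; lra.
- by right; lra.
- left; have -> : headv v = - chord (tailv v) by lra.
  have -> : (- chord (tailv v) + -1 * chord (tailv v)) / 2 = - chord (tailv v) by field.
  by rewrite sqrrN sqr_chord // subrK.
Qed.

Lemma unfold_half_disk s p (v : 'rV[R]_p.+1) : sqnorm v <= 1 ->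
  0 <= sg s * headv v -> sqnorm (unfold_half s v) <= 1.
Proof.
move=> /sqnorm_le1P[t1 h] h0; apply/sqnorm_le1P.
rewrite /unfold_half tailv_cons headv_cons; split => //.
have := chord_ge0 (tailv v); move: h h0; rewrite !ler_norml.
by rewrite /sg; case: s => /andP[h1 h2] h3 h4; apply/andP; lra.
Qed.

Lemma unfold_half_interior s p (v : 'rV[R]_p.+1) : sqnorm v < 1 ->
  0 < sg s * headv v -> sqnorm (unfold_half s v) < 1.
Proof.
move=> v1 h0; have t1 := le_trans (sqnorm_tail_le v) (ltW v1).
rewrite sqnorm_lt1P /unfold_half tailv_cons ?headv_cons //.
move: v1 h0; rewrite sqnorm_lt1P // !ltr_norml.
by rewrite /sg; case: s => /andP[h1 h2] h3; apply/andP; lra.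
Qed.

Lemma half_disk_mem s p (v : disk R p.+1) : fold_half s (val v) \in disk_set R p.+1.
Proof. by apply/mem_set; have [] := fold_half_disk s (diskP v). Qed.

Definition half_disk s p (v : disk R p.+1) : disk R p.+1 :=
  exist _ (fold_half s (val v)) (half_disk_mem s v).

Lemma half_disk_continuous s p : continuous (@half_disk s p).
Proof.
apply: cont_disk; exact: continuous_comp_all (@disk_val_continuous _ _) (@fold_half_continuous s p).
Qed.

Lemma equator_mem p (w : disk R p) : consv 0 (val w) \in disk_set R p.+1.
Proof.
by apply/mem_set; rewrite /disk_set /= sqnorm_cons expr0n add0r; exact: diskP.
Qed.

Definition equator p (w : disk R p) : disk R p.+1 :=
  exist _ (consv 0 (val w)) (equator_mem w).

Lemma equator_continuous p : continuous (@equator p).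
Proof.
apply: cont_disk; apply: cont_consv; first exact: cont_cst.
exact: disk_val_continuous.
Qed.

End ConsVectors.

Lemma closed_preimage (T U : topologicalType) (f : T -> U) (C : set U) :
  continuous f -> closed C -> closed (f @^-1` C).
Proof. by move=> /continuous_closedP; apply. Qed.

Lemma cont_snd_comp (T U V : topologicalType) (f : U -> V) :
  continuous f -> continuous (fun q : T * U => f q.2).
Proof. exact: continuous_comp_all (@continuous_snd T U). Qed.

(** * Complexes with cells of a single dimension *)

Section PureComplex.
Context {R : realType} {G : topGroupType} (Q : gspace G) (k : nat) (I : finType)
  (st : I -> closed_subgroup G) (mp : forall i : I, Defs.orbit (st i) * disk R k -> Q).
Arguments mp : clear implicits.
Local Notation D := (@CWData R G Q I (fun=> k) st mp).
Context (ax : is_cw D).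

Lemma pure_pointP x : x = gpt \/
  exists i c (v : disk R k), sqnorm (val v) < 1 /\ x = mp i (c, v).
Proof.
have [->|[i [[c v] [pI ->]]]] := @cw_pointP R G (FiniteGCW ax) x; first by left.
by right; exists i, c, v.
Qed.

Lemma pure_skeleton x n : (n <= k)%N -> skeleton D n x -> x = gpt.
Proof. by move=> nk [//|[i /= ki _]]; move: (leq_trans ki nk); rewrite ltnn. Qed.

(** No cell has dimension below [k], so the base point is all that a cell can be attached to. *)
Lemma pure_boundary i c (v : disk R k) : sqnorm (val v) = 1 -> mp i (c, v) = gpt.
Proof.
move=> v1; apply: (@pure_skeleton _ k (leqnn k)).
by apply: (cell_map_boundary ax (i := i)); exists (c, v).
Qed.

Lemma pure_pt i c (v : disk R k) : sqnorm (val v) < 1 -> mp i (c, v) <> gpt.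
Proof.
by move=> v1 E; apply: (open_cell_pt ax (i := i)); rewrite -E; exists (c, v).
Qed.

Lemma pure_inj i j c c' (v v' : disk R k) : sqnorm (val v) < 1 -> sqnorm (val v') < 1 ->
  mp i (c, v) = mp j (c', v') ->
  v = v' /\ existT (fun i => Defs.orbit (st i)) i c = existT (fun i => Defs.orbit (st i)) j c'.
Proof.
move=> v1 v'1 E; have ij : i = j.
  apply: (@open_cell_inj R G (FiniteGCW ax) i j (mp i (c, v))); first by exists (c, v).
  by rewrite E; exists (c', v').
subst j; have cI : cell_interior (D := D) i (c, v) by [].
have c'I : cell_interior (D := D) i (c', v') by [].
by have [-> ->] := cell_map_inj ax (mem_set cI) (mem_set c'I) E.
Qed.

Lemma pure_inj1 i c c' (v v' : disk R k) : sqnorm (val v) < 1 -> sqnorm (val v') < 1 ->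
  mp i (c, v) = mp i (c', v') -> c = c' /\ v = v'.
Proof.
move=> v1 v'1 E; have cI : cell_interior (D := D) i (c, v) by [].
have c'I : cell_interior (D := D) i (c', v') by [].
by have [-> ->] := cell_map_inj ax (mem_set cI) (mem_set c'I) E.
Qed.

Lemma pure_continuous i : continuous (mp i).
Proof. exact: (cell_map_continuous ax (i := i)). Qed.

Lemma pure_equivariant i g c v : mp i (orbit_act g c, v) = gact g (mp i (c, v)).
Proof. exact: (cell_map_equivariant ax (i := i)). Qed.

Lemma pure_closed (C : set Q) : (forall i, closed (mp i @^-1` C)) -> closed C.
Proof.
by move=> cC; apply: (cells_closed (X := FiniteGCW ax) (P := fun _ => True)).
Qed.

End PureComplex.

Section Refinement.
Context {R : realType} {G : topGroupType} (Q : gspace G) (p : nat) (I : finType)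
  (st : I -> closed_subgroup G)
  (mp : forall i : I, Defs.orbit (st i) * disk R p.+1 -> Q).
Arguments mp : clear implicits.
Local Notation D := (@CWData R G Q I (fun=> p.+1) st mp).
Context (ax : is_cw D).

Definition refined_dim (x : I * option bool) : nat :=
  if x.2 is Some _ then p.+1 else p.

(** Each cell is cut along the equator of its disk: [(i, None)] is the
    equatorial cell, [(i, Some s)] the half [0 < sg s * headv]. *)
Definition refined_map (x : I * option bool) :
    Defs.orbit (st x.1) * disk R (refined_dim x) -> Q :=
  match x return Defs.orbit (st x.1) * disk R (refined_dim x) -> Q with
  | (i, Some s) => fun q => mp i (q.1, half_disk s q.2)
  | (i, None) => fun q => mp i (q.1, equator q.2)
  end.

Definition refined_data : cw_data R Q :=
  @CWData R G Q (I * option bool)%type refined_dim (fun x => st x.1) refined_map.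

Definition side (o : option bool) (t : R) : Prop :=
  if o is Some s then 0 < sg s * t else t = 0.

Lemma side_inj (o o' : option bool) (t : R) : side o t -> side o' t -> o = o'.
Proof.
by case: o o' => [[]|] [[]|] //= h1 h2; exfalso; move: h1 h2; rewrite /sg; lra.
Qed.

Lemma side_ex (t : R) : exists o : option bool, side o t.
Proof.
have [t0|t0|t0] := ltgtP t 0; [exists (Some false)|exists (Some true)|exists None];
  rewrite /= /sg //; lra.
Qed.

Lemma refined_open_cell (i : I) (o : option bool) x : open_cell (D := refined_data) (i, o) x <->
  exists c (v : disk R p.+1), [/\ sqnorm (val v) < 1, side o (headv (val v)) & x = mp i (c, v)].
Proof.
case: o => [s|]; split.
- move=> [[c v] /= vI <-]; exists c, (half_disk s v).
  by have [] := fold_half_interior s vI.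
- move=> [c [v [vI vs ->]]].
  have uI := unfold_half_interior vI vs.
  have um : unfold_half s (val v) \in disk_set R p.+1 by apply/mem_set; exact: ltW.
  exists (c, exist _ (unfold_half s (val v)) um : disk R p.+1) => //=.
  by congr (mp i (c, _)); apply: val_inj; exact: unfold_halfK.
- move=> [[c w] /= wI <-]; exists c, (equator w).
  by rewrite /= sqnorm_cons headv_cons expr0n add0r.
- move=> [c [v [vI /= v0 ->]]].
  have tI : sqnorm (tailv (val v)) < 1 by apply: le_lt_trans vI; exact: sqnorm_tail_le.
  have tm : tailv (val v) \in disk_set R p by apply/mem_set; exact: ltW.
  exists (c, exist _ (tailv (val v)) tm : disk R p) => //=.
  congr (mp i (c, _)); apply: val_inj => /=.
  by rewrite -[RHS]consv_head_tail v0.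
Qed.

Lemma half_closed s : closed [set q : R | 0 <= sg s * q].
Proof.
have -> : [set q : R | 0 <= sg s * q] = (fun q => sg s * q) @^-1` [set t | 0 <= t] by [].
apply: closed_comp => [q _|]; last exact: closed_ge.
by apply: contM; [exact: cont_cst|move=> x].
Qed.

Lemma refined_is_cw : is_cw refined_data.
Proof.
pose pc i := @pure_continuous _ _ _ _ _ _ _ ax i.
have csnd (T U : topologicalType) := @continuous_snd T U.
have cfst (T U : topologicalType) := @continuous_fst T U.
split.
- move=> [i [s|]] /=; apply: continuous_comp_all (pc i);
    (apply: continuous_pairing; first exact: cfst);
    (apply: continuous_comp_all; first exact: csnd).
    exact: half_disk_continuous.
  exact: equator_continuous.
- by move=> [i [s|]] g c v /=; rewrite (pure_equivariant ax).
- move=> [i [s|]] [c v] [c' v'] /set_mem /= vI /set_mem /= v'I E.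
    have h (w : disk R p.+1) : sqnorm (val w) < 1 -> sqnorm (val (half_disk s w)) < 1.
      by move=> wI; have [] := fold_half_interior s wI.
    have [-> /(congr1 val)/= vv'] := pure_inj1 ax (h _ vI) (h _ v'I) E.
    by congr pair; apply: val_inj; rewrite -[LHS](fold_halfK s) vv' fold_halfK.
  have h (w : disk R p) : sqnorm (val w) < 1 -> sqnorm (val (equator w)) < 1.
    by rewrite /= sqnorm_cons expr0n add0r.
  have [-> /(congr1 val)/= vv'] := pure_inj1 ax (h _ vI) (h _ v'I) E.
  by congr pair; apply: val_inj; rewrite -[LHS](tailv_cons 0) vv' tailv_cons.
- move=> [i o] [j o'] _ _ [x [/refined_open_cell[c [v [vI vo ->]]]]].
  move=> /refined_open_cell[c' [v' [v'I v'o' E]]].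
  have [vv' /(congr1 (@projT1 _ _)) /= ->] := pure_inj ax vI v'I E.
  by rewrite vv' in vo; rewrite (side_inj vo v'o').
- move=> [i o] /refined_open_cell[c [v [vI _ E]]].
  exact: (pure_pt ax vI (esym E)).
- apply/seteqP; split => // x _; have [->|[i [c [v [vI ->]]]]] := pure_pointP ax x.
    by left.
  have [o vo] := side_ex (headv (val v)); right; exists (i, o) => //.
  by apply/refined_open_cell; exists c, v.
- move=> [i [s|]] x [[c v] /= vB <-] /=; last first.
    by left; apply: (pure_boundary ax); rewrite /= sqnorm_cons expr0n add0r.
  (* The round part of the boundary of a half goes to the base point; its flat part lies in the
     equatorial cell. *)
  have [v1|v0] := fold_half_boundary s vB; first by left; exact: (pure_boundary ax).
  have [hI|hB] := ltP (sqnorm (val (half_disk s v))) 1.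
    by right; exists (i, None) => //=; apply/refined_open_cell; exists c, (half_disk s v).
  left; apply: (pure_boundary ax); apply/eqP; rewrite eq_le hB andbT.
  exact: diskP.
- move=> n C Cn Ccl.
  (* With [n <= p] no refined cell has dimension below [n], and [C] contains at most the base
     point. *)
  have [np|np] := leqP n p.
    have Cpt x : C x -> x = gpt.
      by move=> /Cn[//|[[i o] /= ki _]]; exfalso; move: ki; rewrite /refined_dim; case: o => [s|] /=; lia.
    by apply: (cw_coherent ax (n := 0)) => // x /Cpt ->; left.
  apply: (pure_closed ax) => i.
  have Ecl : closed ((fun q : Defs.orbit (st i) * disk R p => mp i (q.1, equator q.2)) @^-1` C).
    exact: (Ccl (i, None)).
  have chead : continuous (fun q : Defs.orbit (st i) * disk R p.+1 => headv (val q.2)).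
    apply: (cont_snd_comp (f := fun v : disk R p.+1 => headv (val v))).
    by apply: continuous_comp_all; [exact: disk_val_continuous|exact: headv_continuous].
  (* Now [n] is [p.+1], and only equatorial cells count: the preimage of [C] is a closed part of the
     equator, together with the whole sphere if [C] contains the base point. *)
  have [np1|np1] := leqP n p.+1.
    pose A := [set q : Defs.orbit (st i) * disk R p.+1 | headv (val q.2) = 0] `&`
      (fun q => mp i (q.1, equator (projd (tailv (val q.2))))) @^-1` C.
    pose B := [set q : Defs.orbit (st i) * disk R p.+1 | sqnorm (val q.2) = 1 /\ C gpt].
    have -> : mp i @^-1` C = A `|` B.
      apply/seteqP; split => [[c v] /= Cv|[c v]]; last first.
        move=> [[/= v0]|[/= v1 Cpt]]; last by rewrite (pure_boundary ax).
        congr (C (mp i (c, _))); apply: val_inj => /=.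
        rewrite radproj_id; last by rewrite (le_trans (sqnorm_tail_le _)) // diskP.
        by rewrite -[RHS]consv_head_tail v0.
      have [vI|vB] := ltP (sqnorm (val v)) 1; last first.
        have v1 : sqnorm (val v) = 1 by apply/eqP; rewrite eq_le vB diskP.
        by right; split => //; rewrite (pure_boundary ax) in Cv.
      have [/(pure_pt ax vI)//|[[j o] /= jn /refined_open_cell[c' [v' [v'I v'o E]]]]] := Cn _ Cv.
      have [vv' _] := pure_inj ax vI v'I E.
      have v0 : headv (val v) = 0 by rewrite vv'; case: o jn v'o {E} => [s|] //=; rewrite /refined_dim /= => jn; exfalso; lia.
      left; split => //=; move: Cv; congr (C (mp i (c, _))); apply: val_inj => /=.
      rewrite radproj_id; last by rewrite (le_trans (sqnorm_tail_le _)) // diskP.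
      by rewrite -[LHS]consv_head_tail v0.
    apply: closedU.
      apply: closedI; first by apply: (closed_preimage (C := [set 0]) chead); exact: closed_eq.
      have ct : continuous (fun q : Defs.orbit (st i) * disk R p.+1 => (q.1, projd (tailv (val q.2)))).
        apply: continuous_pairing; first exact: cfst.
        apply: (cont_snd_comp (f := fun v : disk R p.+1 => projd (tailv (val v)))).
        apply: continuous_comp_all; last exact: projd_continuous.
        by apply: continuous_comp_all; [exact: disk_val_continuous|exact: tailv_continuous].
      exact: (closed_preimage ct Ecl).
    have [Cpt|nCpt] := pselect (C gpt); last first.
      rewrite (_ : B = set0); first exact: closed0.
      by apply/seteqP; split => // q [].
    rewrite (_ : B = (fun q => sqnorm (val q.2)) @^-1` [set 1]).
      apply: closed_preimage; last exact: closed_eq.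
      apply: (cont_snd_comp (f := fun v : disk R p.+1 => sqnorm (val v))).
      by apply: continuous_comp_all; [exact: disk_val_continuous|exact: sqnorm_continuous].
    by apply/seteqP; split => q //= [].
  (* Here all cells count, and the preimage is a union of two closed pieces, each read off through
     the unfolding of its half. *)
  have Hcl s : closed ((fun q : Defs.orbit (st i) * disk R p.+1 => mp i (q.1, half_disk s q.2)) @^-1` C).
    exact: (Ccl (i, Some s)).
  pose A s := [set q : Defs.orbit (st i) * disk R p.+1 | 0 <= sg s * headv (val q.2)] `&`
      (fun q => mp i (q.1, half_disk s (projd (unfold_half s (val q.2))))) @^-1` C.
  have AE s (c : Defs.orbit (st i)) (v : disk R p.+1) : 0 <= sg s * headv (val v) ->
      half_disk s (projd (unfold_half s (val v))) = v.
    move=> v0; apply: val_inj => /=; rewrite radproj_id ?unfold_halfK //.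
    by apply: unfold_half_disk => //; exact: diskP.
  have -> : mp i @^-1` C = A true `|` A false.
    apply/seteqP; split => [[c v] /= Cv|[c v]]; last first.
      by move=> [[/= v0]|[/= v0]]; rewrite AE.
    have [v0|v0] := leP 0 (headv (val v)).
      have s0 : 0 <= sg true * headv (val v) by rewrite /sg mul1r.
      by left; split => //=; rewrite AE.
    have s0 : 0 <= sg false * headv (val v) by rewrite /sg mulN1r oppr_ge0 ltW.
    by right; split => //=; rewrite AE.
  have Acl s : closed (A s).
    apply: closedI; first by apply: (closed_preimage (C := [set t | 0 <= sg s * t]) chead); exact: half_closed.
    have ct : continuous (fun q : Defs.orbit (st i) * disk R p.+1 => (q.1, projd (unfold_half s (val q.2)))).
      apply: continuous_pairing; first exact: cfst.
      apply: (cont_snd_comp (f := fun v : disk R p.+1 => projd (unfold_half s (val v)))).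
      apply: continuous_comp_all; last exact: projd_continuous.
      by apply: continuous_comp_all; [exact: disk_val_continuous|exact: unfold_half_continuous].
    exact: (closed_preimage ct (Hcl s)).
  by apply: closedU.
Qed.

Definition refined : finite_gcw R G := FiniteGCW refined_is_cw.

End Refinement.

Section QuotientMaps.
Context {G : topGroupType}.

Program Definition gincl (X : gspace G) (A : invariant_subset X) : gmap (sub_gspace A) X :=
  @GMap G (sub_gspace A) X val _ _ _.
Next Obligation. by move=> X A; exact: sub_val_continuous. Qed.
Next Obligation. by []. Qed.
Next Obligation. by []. Qed.

Program Definition gproj (X : gspace G) (A : invariant_subset X) : gmap X (quot_gspace A) :=
  @GMap G X (quot_gspace A) (\pi_(collapse A)) _ _ _.
Next Obligation. by move=> X A; exact: collapse_pi_continuous. Qed.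
Next Obligation. by move=> X A g x /=; rewrite collapse_act_pi. Qed.
Next Obligation. by []. Qed.

Section Factor.
Context (X Z : gspace G) (A : invariant_subset X) (f : gmap X Z)
  (fA : forall x, inv_set A x -> f x = gpt).

Lemma factor_pi x : f (repr (\pi_(collapse A) x)) = f x.
Proof.
have : \pi_(collapse A) (repr (\pi_(collapse A) x)) = \pi_(collapse A) x by rewrite reprK.
by move/collapse_piP => [->//|[h1 h2]]; rewrite !fA.
Qed.

Program Definition gfactor : gmap (quot_gspace A) Z :=
  @GMap G (quot_gspace A) Z (fun c : collapse A => f (repr c)) _ _ _.
Next Obligation.
apply: collapse_repr_continuous; first exact: gmap_continuous.
by move=> x y xA yA; rewrite !fA.
Qed.
Next Obligation.
by move=> g c; rewrite -[c in LHS]reprK /= collapse_act_pi factor_pi gmap_equivariant.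
Qed.
Next Obligation. by rewrite /= factor_pi gmap_pt. Qed.

Lemma gfactor_pi x : gfactor (gproj A x) = f x.
Proof. exact: factor_pi. Qed.

End Factor.

Lemma gmap_induced_pi (X : gspace G) (A : invariant_subset X) (f : gmap X X)
    (fA : set_fun A A f) x :
  gmap_induced fA (gproj A x) = gproj A (f x).
Proof.
apply/collapse_piP.
have : \pi_(collapse A) (repr (\pi_(collapse A) x)) = \pi_(collapse A) x by rewrite reprK.
move/collapse_piP => [->|[h1 h2]]; first by left.
by right; split; exact: fA.
Qed.

Lemma gproj_surj (X : gspace G) (A : invariant_subset X) (y : quot_gspace A) :
  exists x, y = gproj A x.
Proof. by exists (repr (y : collapse A)); rewrite /= reprK. Qed.

Program Definition gfam_restrict (L : topologicalType) (X : gspace G) (A : invariant_subset X)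
    (K : gfamily L X X) (KA : forall t, set_fun A A (K t)) :
    gfamily L (sub_gspace A) (sub_gspace A) :=
  @GFamily G L (sub_gspace A) (sub_gspace A)
    (fun t x => exist _ (K t (val x)) (mem_set (KA t _ (set_mem (valP x))))) _ _ _.
Next Obligation.
move=> L X A K KA; apply: Defs.sub_continuous.
apply: (continuous_comp_all (f := fun q : L * sub_gspace A => (q.1, val q.2)) _
  (@gfam_continuous _ _ _ _ K)).
apply: continuous_pairing; first exact: continuous_fst.
by apply: continuous_comp_all; [exact: continuous_snd|exact: sub_val_continuous].
Qed.
Next Obligation. by move=> *; apply: val_inj; rewrite /= gfam_equivariant. Qed.
Next Obligation. by move=> *; apply: val_inj; rewrite /= gfam_pt. Qed.

End QuotientMaps.

(** * The two halves and their equator *)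

Section Halves.
Context {R : realType} {G : topGroupType} (Q : gspace G) (p : nat) (I : finType)
  (st : I -> closed_subgroup G)
  (mp : forall i : I, Defs.orbit (st i) * disk R p.+1 -> Q).
Arguments mp : clear implicits.
Local Notation D := (@CWData R G Q I (fun=> p.+1) st mp).
Context (ax : is_cw D).
Local Notation Y := (refined ax).

Definition half_set s : set Q := [set x | x = gpt \/ exists i c (v : disk R p.+1),
  0 <= sg s * headv (val v) /\ x = mp i (c, v)].

Lemma half_setP s i c (v : disk R p.+1) : sqnorm (val v) < 1 ->
  half_set s (mp i (c, v)) <-> 0 <= sg s * headv (val v).
Proof.
move=> vI; split=> [[/(pure_pt ax vI)//|[j [c' [v' [v'0 E]]]]]|v0].
  have [v'I|v'B] := ltP (sqnorm (val v')) 1.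
    by have [-> _] := pure_inj ax vI v'I E.
  have v'1 : sqnorm (val v') = 1 by apply/eqP; rewrite eq_le v'B diskP.
  by move: E; rewrite (pure_boundary ax _ v'1) => /(pure_pt ax vI).
by right; exists i, c, v.
Qed.

Lemma side_ge0 s o t : side (R := R) o t -> 0 <= sg s * t -> o = None \/ o = Some s.
Proof.
case: o => [s'|]; last by left.
by case: s s' => [] [] /= h1 h2; [right|exfalso|exfalso|right] => //;
  move: h1 h2; rewrite /sg; lra.
Qed.

Lemma half_cell s i o (q : Defs.orbit (st (i, o).1) * disk R (refined_dim p (i, o))) :
  o = None \/ o = Some s -> half_set s (refined_map mp q).
Proof.
move=> [Eo|Eo]; subst o; case: q => c v.
  right; exists i, c, (equator v); split => //=.
  by rewrite headv_cons mulr0.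
right; exists i, c, (half_disk s v); split => //=.
by have [_] := fold_half_disk s (diskP v).
Qed.

Lemma half_sc_cells s x : half_set s x -> x = gpt \/
  exists i : cell (gcw_data Y), open_cell i x /\ closed_cell i `<=` half_set s.
Proof.
move=> [->|[i [c [v [v0 ->]]]]]; first by left.
have [vI|vB] := ltP (sqnorm (val v)) 1; last first.
  have v1 : sqnorm (val v) = 1 by apply/eqP; rewrite eq_le vB diskP.
  by left; exact: (pure_boundary ax).
have [o vo] := side_ex (headv (val v)).
right; exists (i, o); split; first by apply/(refined_open_cell mp); exists c, v.
by move=> _ [q _ <-]; apply: half_cell; exact: side_ge0 v0.
Qed.

Definition half_complex s : subcomplex Y :=
  @Subcomplex R G Y (half_set s) (or_introl erefl) (half_sc_cells (s := s)).

Lemma half_cover x : half_set true x \/ half_set false x.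
Proof.
have [->|[i [c [v [vI ->]]]]] := pure_pointP ax x; first by left; left.
have [v0|v0] := leP 0 (headv (val v)); [left|right]; apply/half_setP => //.
  by rewrite mul1r.
by rewrite mulN1r oppr_ge0 ltW.
Qed.

Lemma in_half s i o : in_sc (half_complex s) (i, o) -> o = None \/ o = Some s.
Proof.
move=> /asboolP iA; case: o iA => [s'|] iA; last by left.
have := open_cell_center (X := Y) (i := (i, Some s')) (\pi_(Defs.orbit (st i)) 1%g).
set x := cell_map _ _ => ix.
have Ax : half_set s x by apply: iA; exact: open_cell_closed_cell.
have [c [v [vI vs xE]]] := (refined_open_cell mp i (Some s') x).1 ix.
by apply: (side_ge0 vs); rewrite xE in Ax; have := (half_setP s c vI).1 Ax.
Qed.

(** Points slide along vertical chords and leave the disk on side [s], where the boundary is the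
    base point. The motion is defined on the whole complex and then restricted to the half. *)
Lemma half_contraction s : exists K : gfamily R (sub_gcw (half_complex s)) (sub_gcw (half_complex s)),
  (forall x, K 0 x = x) /\ (forall x, K 1 x = gpt).
Proof.
(* The speed vanishes at the far end of each chord, so that no boundary point enters the interior.
   The factor 2 is generous: with [sg s * headv v >= 0], a point has passed the near end at time
   1. *)
pose tau (t : R) (v : 'rV[R]_p.+1) : R := 2 * Num.max 0 t * (chord (tailv v) + sg s * headv v).
pose w (t : R) (v : 'rV[R]_p.+1) := consv (headv v + sg s * tau t v) (tailv v).
have tau_ge0 t v : sqnorm v <= 1 -> 0 <= tau t v.
  move=> /sqnorm_le1P[t1]; rewrite ler_norml => /andP[h1 h2].
  rewrite mulr_ge0 ?mulr_ge0 ?le_max ?lexx // /sg; case: (s); lra.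
have cw : continuous (fun q : R * disk R p.+1 => w q.1 (val q.2)).
  have cv : continuous (fun q : R * disk R p.+1 => val q.2).
    by apply: cont_snd_comp; exact: disk_val_continuous.
  have ch := continuous_comp_all cv (@headv_continuous R p).
  have ct := continuous_comp_all cv (@tailv_continuous R p).
  apply: cont_consv => //; apply: contD => //; apply: contM; first exact: cont_cst.
  apply: contM.
    apply: contM; first exact: cont_cst.
    by apply: cont_max; [exact: cont_cst|exact: continuous_fst].
  apply: contD; first exact: continuous_comp_all ct (@chord_continuous R p).
  by apply: contM; [exact: cont_cst|].
have w_ge1 t (v : 'rV[R]_p.+1) : sqnorm (tailv v) <= 1 ->
    chord (tailv v) <= sg s * headv v + tau t v -> 1 <= sqnorm (w t v).
  move=> t1 h; rewrite /w sqnorm_cons -lerBlDr -sqr_chord //.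
  have -> : (headv v + sg s * tau t v) ^+ 2 = (sg s * headv v + tau t v) ^+ 2.
    by rewrite /sg; case: (s); ring.
  by rewrite ler_sqr ?nnegrE ?(le_trans _ h) // chord_ge0.
have [||||||K [KS _]] := @move_cells R G (FiniteGCW ax) R (fun=> True) p.+1
  (fun i t v => projd (w t (val v))).
- exact: locally_compactR.
- exact: norm_hausdorff.
- by [].
- by [].
- by move=> i _; apply: continuous_comp_all; last exact: projd_continuous.
- move=> i t c v _ v1; change (mp i (c, projd (w t (val v))) = mp i (c, v)).
  rewrite (pure_boundary ax _ v1); apply: (pure_boundary ax).
  apply: sqnorm_radproj1; have /sqnorm_le1P[t1 _] := diskP v.
  have := sqr_chord t1; have := tau_ge0 t (val v) (diskP v).
  have hd : (sg s * headv (val v) - chord (tailv (val v))) *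
            (sg s * headv (val v) + chord (tailv (val v))) = 0.
    rewrite -subr_sqr sqr_chord // -v1 sqnorm_head_tail exprMn.
    by rewrite expr2 sg_sqr; ring.
  move=> tau0 _; move/eqP: hd; rewrite mulf_eq0 => /orP[]/eqP hd.
    by apply: w_ge1 => //; lra.
  have tE : tau t (val v) = 0 by rewrite /tau [X in _ * X](_ : _ = 0) ?mulr0; lra.
  by rewrite /w tE mulr0 addr0 consv_head_tail v1.
have {}KS i t c v : K t (mp i (c, v)) = mp i (c, projd (w t (val v))) by exact: KS.
have KA t : set_fun (half_set s) (half_set s) (K t).
  move=> x [->|[i [c [v [v0 ->]]]]]; first by rewrite gfam_pt; left.
  rewrite KS; right; exists i, c, (projd (w t (val v))); split => //.
  rewrite /= /radproj /headv mxE -/(headv _) headv_cons mulrCA.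
  apply: mulr_ge0; first by rewrite invr_ge0 le_max ler01.
  by rewrite mulrDr mulrA sg_sqr mul1r addr_ge0 // tau_ge0 // diskP.
exists (gfam_restrict (A := sc_invariant (half_complex s)) KA); split => -[x xA]; apply: val_inj => /=.
  have [->|[i [c [v [vI ->]]]]] := pure_pointP ax x; first by rewrite gfam_pt.
  rewrite KS; congr (mp i (c, _)).
  by rewrite /w /tau maxxx mulr0 mul0r mulr0 addr0 consv_head_tail projdK.
have [->|[i [c [v [v0 ->]]]]] := set_mem xA; first by rewrite gfam_pt.
rewrite KS; apply: (pure_boundary ax); apply: sqnorm_radproj1.
have /sqnorm_le1P[t1 _] := diskP v; apply: w_ge1 => //.
rewrite /tau max_r // mulr1; have := chord_ge0 (tailv (val v)); lra.
Qed.

End Halves.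

Section SplitHalves.
Context {R : realType} {G : topGroupType} {B : zmodType} (l : assignment R G B)
  (la : lefschetz_axioms l).
Context (Q : gspace G) (p : nat) (I : finType) (st : I -> closed_subgroup G)
  (mp : forall i : I, Defs.orbit (st i) * disk R p.+1 -> Q).
Arguments mp : clear implicits.
Local Notation D := (@CWData R G Q I (fun=> p.+1) st mp).
Context (ax : is_cw D).
Local Notation Y := (refined ax).
Local Notation upper := (half_complex ax true).
Local Notation lower := (half_complex ax false).

Lemma half_half_cells (x : sub_gcw upper) : half_set mp false (val x) -> x = gpt \/
  exists i : cell (gcw_data (sub_gcw upper)),
    open_cell i x /\ closed_cell i `<=` [set y | half_set mp false (val y)].
Proof.
case: x => x xU /= [xE|[i [c [v [v0 xE]]]]]; first by left; apply: val_inj.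
have [vI|vB] := ltP (sqnorm (val v)) 1; last first.
  have v1 : sqnorm (val v) = 1 by apply/eqP; rewrite eq_le vB diskP.
  by left; apply: val_inj; rewrite /= xE; exact: (pure_boundary ax).
have v0' : 0 <= sg true * headv (val v).
  by apply/(half_setP ax true c vI); rewrite -xE; exact: set_mem.
have vE : headv (val v) = 0 by move: v0 v0'; rewrite /sg; lra.
have iU : in_sc upper (i, None).
  by apply/asboolP => _ [q _ <-]; apply: half_cell; left.
right; exists (exist _ ((i, None) : cell (gcw_data Y)) iU); split.
  apply/(sub_open_cell (A := upper)) => /=.
  by apply/(refined_open_cell mp); exists c, v.
move=> _ [q _ <-] /=; exact: (@half_cell _ _ _ _ _ _ mp false i None q (or_introl erefl)).
Qed.

(** The equator, as a subcomplex of the upper half: this presentation lets the cofibration axiom be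
    applied to the upper half. *)
Definition half_half : subcomplex (sub_gcw upper) :=
  @Subcomplex R G (sub_gcw upper) [set y | half_set mp false (val y)] (or_introl erefl)
    half_half_cells.

Lemma half_half_dim (i : cell (gcw_data (sub_gcw half_half))) : cell_dim i = p.
Proof.
case: i => -[[i o] iU] iL /=.
have [->//|Eo] := in_half iU; subst o.
have := open_cell_center (X := sub_gcw upper)
  (i := exist _ ((i, Some true) : cell (gcw_data Y)) iU) (\pi_(Defs.orbit (st i)) 1%g).
set x := cell_map _ _ => ix.
have Ax : half_set mp false (val x).
  by move/asboolP: iL; apply; exact: open_cell_closed_cell.
have /(refined_open_cell mp)[c [v [vI vs xE]]] := (sub_open_cell (A := upper) _ x).1 ix.
have := (half_setP ax false c vI).1; rewrite -xE => /(_ Ax).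
by move=> v0; exfalso; move: vs v0; rewrite /= /sg; lra.
Qed.

Local Notation AU := (sc_invariant upper).
Local Notation AL := (sc_invariant lower).
Local Notation AE := (sc_invariant half_half).

(** Excision: [a] is induced by the inclusion of the upper half. Its inverse comes from the map on
    [Q] that projects the upper half and sends the lower one to the base point; this map is
    continuous because it is so on each refined cell. *)
Lemma upper_to_quotient_equiv :
  exists (a : gmap (quot_gcw half_half) (quot_gcw lower))
         (b : gmap (quot_gcw lower) (quot_gcw half_half)),
    [/\ cancel a b, cancel b a
      & forall x : sub_gspace AU, a (gproj AE x) = gproj AL (val x)].
Proof.
have a0 (x : sub_gspace AU) : inv_set AE x -> gcomp (gproj AL) (gincl AU) x = gpt.
  by move=> Ax; apply/quot_ptP.
pose a : gmap (quot_gcw half_half) (quot_gcw lower) := gfactor a0.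
pose b0 (x : Q) : quot_gcw half_half :=
  if pselect (half_set mp true x) is left h then
    gproj AE (exist _ x (mem_set h) : sub_gspace AU) else gpt.
have b0U (x : sub_gspace AU) : b0 (val x) = gproj AE x.
  rewrite /b0; case: pselect => [h|[]]; last exact: set_mem (valP x).
  by congr (gproj AE _); exact: val_inj.
have b0L (x : Q) : half_set mp false x -> b0 x = gpt.
  by rewrite /b0 => xL; case: pselect => [h|//]; apply/quot_ptP.
have b0c : continuous b0.
  apply: (@cw_continuous _ _ Y) => -[i o].
  have [[s Eo]|Eo] : (exists s, o = Some s) \/ o = None.
    by case: (o) => [s|]; [left; exists s|right].
  - subst o; case: s => [|].
      have iU q : half_set mp true (cell_map ((i, Some true) : cell (gcw_data Y)) q).
        by apply: half_cell; right.
      pose e q : sub_gspace AU :=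
        exist _ (cell_map ((i, Some true) : cell (gcw_data Y)) q) (mem_set (iU q)).
      apply: (@eq_continuous _ _ _ (fun q => gproj AE (e q))).
        by move=> q; rewrite -b0U.
      apply: (continuous_comp_all (f := e) _ (@gmap_continuous _ _ _ (gproj AE))).
      by apply: Defs.sub_continuous; exact: (cell_map_continuous (gcw_axioms Y) (i := (i, Some true))).
    apply: (@eq_continuous _ _ _ (fun=> gpt)); last exact: cont_cst.
    by move=> q; rewrite b0L //; apply: half_cell; right.
  - subst o; apply: (@eq_continuous _ _ _ (fun=> gpt)); last exact: cont_cst.
    by move=> q; rewrite b0L //; apply: half_cell; left.
have b0e g x : b0 (gact g x) = gact g (b0 x).
  have [xU|xL] := half_cover ax x; last first.
    by rewrite !b0L ?gact_pt //; exact: (sc_act (A := lower)).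
  pose x' : sub_gspace AU := exist _ x (mem_set xU).
  rewrite (b0U (gact g x')) (b0U x') [in LHS]gmap_equivariant //.
have b0pt : b0 gpt = gpt by rewrite b0L //; left.
pose bm : gmap Q (quot_gcw half_half) := GMap b0c b0e b0pt.
have bmL x : inv_set AL x -> bm x = gpt by exact: b0L.
pose b : gmap (quot_gcw lower) (quot_gcw half_half) := gfactor bmL.
have aP (x : sub_gspace AU) : a (gproj AE x) = gproj AL (val x) by exact: gfactor_pi.
have bP (x : Q) : b (gproj AL x) = b0 x by exact: gfactor_pi.
exists a, b; split => //.
- move=> y; have [x ->] := gproj_surj (y : quot_gspace AE).
  by rewrite aP bP b0U.
- move=> y; have [x ->] := gproj_surj (y : quot_gspace AL).
  rewrite bP; have [xU|xL] := half_cover ax x.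
    by rewrite (b0U (exist _ x (mem_set xU))) aP.
  by rewrite b0L // gmap_pt; apply/esym/quot_ptP.
Qed.

(* Writing [L], [U] for the halves and [E] for the equator, [l] vanishes on the
   contractible [L] and [U], so [l f] is the value on [Y/L], i.e. on [U/E],
   which is opposite to the value on [E]. *)
Lemma la_split_halves (f : gmap Y Y) :
  (forall (X : finite_gcw R G) (h : gmap X X),
     (forall i : cell (gcw_data X), cell_dim i = p) -> l h = 0) ->
  (forall s, set_fun (half_set mp s) (half_set mp s) f) -> l f = 0.
Proof.
move=> IH fs.
have fL : set_fun (sc_set lower) (sc_set lower) f by exact: fs.
have fU : set_fun (sc_set upper) (sc_set upper) f by exact: fs.
have [KL [KL0 KL1]] := half_contraction ax false.
have [KU [KU0 KU1]] := half_contraction ax true.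
rewrite (la_cofibration la fL) (la_contractible la _ KL0 KL1) add0r.
pose fu : gmap (sub_gcw upper) (sub_gcw upper) := gmap_restrict (A := AU) fU.
have fE : set_fun (sc_set half_half) (sc_set half_half) fu by move=> x; exact: fL.
have := la_cofibration la fE.
rewrite (la_contractible la fu KU0 KU1) IH; last exact: half_half_dim.
rewrite add0r => ->; have [a [b [ab ba aP]]] := upper_to_quotient_equiv.
apply/esym; apply: (la_conj la ab ba) => y.
have [x ->] := gproj_surj (y : quot_gspace AE).
rewrite (gmap_induced_pi (A := AE) fE) !aP (gmap_induced_pi (A := AL) fL).
by [].
Qed.

End SplitHalves.

(** * Deforming a map so that it respects both halves *)

Section DiskSeparation.
Context {R : realType}.

Lemma le_norm_row_mx m n (u : 'rV[R]_m) (v : 'rV[R]_n) (e : R) : 0 <= e ->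
  (`|row_mx u v| <= e) = (`|u| <= e) && (`|v| <= e).
Proof.
move=> e0; apply/idP/andP => [h|[h1 h2]].
  split; apply: norm_le_coord => // j; apply: le_trans h.
    by have := le_coord_norm (row_mx u v) (lshift n j); rewrite row_mxEl.
  by have := le_coord_norm (row_mx u v) (rshift m j); rewrite row_mxEr.
apply: norm_le_coord => // j; rewrite mxE; case: (fintype.split j) => j' /=.
  exact: le_trans (le_coord_norm _ _) h1.
exact: le_trans (le_coord_norm _ _) h2.
Qed.

(* The pairs of points of the disk on a common vertical line form a space of
   dimension [p + 2], mapped by [w true, w false] to a space of dimension
   [2 p + 2]; since [p > 0], the map can be made to miss a neighbourhood of the
   origin, i.e. the sets where [w true] and [w false] are small have disjoint
   vertical projections. *)
Lemma disk_separation p (h : bool -> 'rV[R]_p.+1 -> 'rV[R]_p.+1) (d : R) :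
  (0 < p)%N -> 0 < d -> (forall s, continuous (h s)) ->
  exists (w : bool -> 'rV[R]_p.+1 -> 'rV[R]_p.+1) (tau : 'rV[R]_p -> R) (e : R),
    [/\ 0 < e, (forall s, continuous (w s)), continuous tau,
      (forall s v, sqnorm v <= 1 -> `|w s v - h s v| <= d)
    & (forall s v, sqnorm v <= 1 -> `|w s v| < e -> tau (tailv v) = - sg s)].
Proof.
move=> p0 d0 ch; have d2 : 0 < d / 2 by rewrite divr_gt0.
have lip s : exists L : 'rV[R]_p.+1 -> 'rV[R]_p.+1,
    (exists2 C, 0 <= C & lipschitz_map C L) /\
    forall v, sqnorm v <= 1 -> `|L v - h s v| <= d / 2.
  have [|L [C [C0 LC Lh]]] := lipschitz_approx (@disk_set_compact R _) _ (ch s) d2.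
    by exists 0; rewrite /disk_set /= sqnorm0.
  by exists L; split => //; exists C.
have [L LP] := choice lip.
have [[Ct Ct0 LCt] _] := LP true; have [[Cf Cf0 LCf] _] := LP false.
pose C := Num.max Ct Cf; have C0 : 0 <= C by rewrite le_max Ct0.
have LC s : lipschitz_map C (L s).
  move=> x y; case: s.
    by rewrite (le_trans (LCt x y)) // ler_wpM2r // le_max lexx.
  by rewrite (le_trans (LCf x y)) // ler_wpM2r // le_max lexx orbT.
(* A vector [z] lists two heights followed by the common vertical projection of two points. *)
pose Phi (z : 'rV[R]_p.+2) : 'rV[R]_(p.+1 + p.+1) :=
  row_mx (L true (consv (headv z) (tailv (tailv z))))
         (L false (consv (headv (tailv z)) (tailv (tailv z)))).
have PhiC : lipschitz_map C Phi.
  move=> z z'; rewrite /Phi opp_row_mx add_row_mx le_norm_row_mx ?mulr_ge0 //.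
  have zz : `|headv z - headv z'| <= `|z - z'| /\
      `|headv (tailv z) - headv (tailv z')| <= `|z - z'| /\
      `|tailv (tailv z) - tailv (tailv z')| <= `|z - z'|.
    have := lexx `|z - z'|; rewrite -{1}(consv_head_tail z) -{1}(consv_head_tail z').
    rewrite -{1}(consv_head_tail (tailv z)) -{1}(consv_head_tail (tailv z')).
    by rewrite !consvB !norm_consv // => /and3P[].
  move: zz => [z1 [z2 z3]].
  by apply/andP; split; apply: (le_trans (LC _ _ _)); rewrite ler_wpM2l // consvB norm_consv // ?z1 ?z2 ?z3.
have [|z [e [zd e0 z_miss]]] := lipschitz_miss 0 _ C0 PhiC d2.
  by rewrite addSn ltnS addnS; lia.
have /andP[at_d af_d] : (`|lsubmx z| <= d / 2) && (`|rsubmx z| <= d / 2).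
  by rewrite -(le_norm_row_mx _ _ (ltW d2)) hsubmxK; move: zd; rewrite subr0.
pose a s : 'rV[R]_p.+1 := if s then lsubmx z else rsubmx z.
have ad s : `|a s| <= d / 2 by case: s.
pose w s v := L s v - a s.
have wC s : lipschitz_map C (w s).
  by move=> x y; rewrite /w opprB subrKA; exact: LC.
have sep t t' x : `|t| <= 1 -> `|t'| <= 1 -> `|x| <= 1 ->
    `|w true (consv t x)| < e -> `|w false (consv t' x)| < e -> False.
  move=> t1 t'1 x1 h1 h2.
  have := z_miss (consv t (consv t' x)); rewrite !norm_consv // t1 t'1 x1 => /(_ isT).
  rewrite leNgt => /negP; apply; rewrite /Phi !tailv_cons !headv_cons.
  rewrite -[X in _ - X](hsubmxK z) opp_row_mx add_row_mx.
  apply: (@le_lt_trans _ _ (Num.max `|w true (consv t x)| `|w false (consv t' x)|)).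
    by rewrite le_norm_row_mx ?le_max ?lexx ?orbT // normr_ge0.
  by rewrite gt_max h1.
(* The least size of [w s] on a vertical segment containing the chord over [x]; as an infimum of
   Lipschitz functions it depends continuously on [x]. *)
pose gg s (x : 'rV[R]_p) := inf [set `|w s (consv t x)| | t in [set t | `|t| <= 1]].
have gg_lb s x : has_lbound [set `|w s (consv t x)| | t in [set t | `|t| <= 1]].
  by exists 0 => _ [t _ <-].
have set0ne : [set t : R | `|t| <= 1] !=set0 by exists 0; rewrite /= normr0.
have ggC s : lipschitz_map C (gg s : 'rV[R]_p -> R).
  move=> x x'; apply: (@inf_lipschitz R _ R _ (fun t x => `|w s (consv t x)|)) => // t y y' _.
  rewrite -lerBlDl (le_trans (lerB_dist _ _)) // (le_trans (wC s _ _)) //.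
  by rewrite ler_wpM2l // consvB subrr norm_consv // normr0 normr_ge0 lexx.
(* Over a point of the disk where [w s] is smaller than [e / 2], also [gg s] is smaller than
   [e / 2], and [gg (~~ s)] is at least [e] by [sep]. The factor [2 / e] then saturates the
   truncation. *)
pose tau x := Num.max (-1) (Num.min 1 ((gg true x - gg false x) * (2 / e))).
have tau_true x : e <= gg false x -> gg true x < e / 2 -> tau x = -1.
  move=> h1 h2; rewrite /tau max_l // ge_min; apply/orP; right.
  rewrite mulrA ler_pdivrMr //; lra.
have tau_false x : e <= gg true x -> gg false x < e / 2 -> tau x = 1.
  move=> h1 h2; rewrite /tau min_l; first by rewrite max_r //; lra.
  by rewrite mulrA ler_pdivlMr //; lra.
exists w, tau, (e / 2); split.
- by rewrite divr_gt0.
- by move=> s; exact: lipschitz_continuous C0 (wC s).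
- apply: cont_max; first exact: cont_cst.
  apply: cont_min; first exact: cont_cst.
  apply: contM; last exact: cont_cst.
  apply: contD; first exact: lipschitz_continuous C0 (ggC true).
  by apply: contN; exact: lipschitz_continuous C0 (ggC false).
- move=> s v v1; rewrite /w addrAC (le_trans (ler_normB _ _)) //.
  by have [_ /(_ v v1)] := LP s; have := ad s; lra.
move=> s v v1 small.
have v_n : `|v| <= 1.
  by rewrite -(@ler_pXn2r _ 2) ?nnegrE // expr1n (le_trans (norm_le_sqnorm v)).
have /andP[t1 x1] : (`|headv v| <= 1) && (`|tailv v| <= 1).
  by rewrite -norm_consv // consv_head_tail.
have small_e : `|w s v| < e by rewrite (lt_trans small) // ltr_pdivrMr // ltr_pMr // ltr1n.
have gs : gg s (tailv v) < e / 2.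
  apply: le_lt_trans small; apply: ge_inf => //.
  by exists (headv v) => //; rewrite consv_head_tail.
have gs' : e <= gg (~~ s) (tailv v).
  apply: lb_le_inf; first by exists `|w (~~ s) (consv 0 (tailv v))|, 0 => //=; rewrite normr0.
  move=> _ [t /= t'1 <-]; rewrite leNgt; apply/negP => small'.
  move: small_e small'; rewrite -{1}(consv_head_tail v).
  by case: (s) => /= h1 h2; [apply: (sep _ _ _ t1 t'1 x1 h1 h2)|apply: (sep _ _ _ t'1 t1 x1 h2 h1)].
by case: (s) gs gs' => /= h1 h2; rewrite /sg ?opprK; [exact: tau_true|exact: tau_false].
Qed.

(** Vertical lines with [tau = sg s] are pushed towards side [s]. A point of the half [s] at height
    [t] on a chord of half length [c] moves by [(c - t) * (c + t) / (1 - r)], which is at least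
    [c - t] once [1 - r <= c], so it is pushed out to the sphere. The factor [1 - sqnorm v] fixes
    the boundary. *)
Lemma disk_push p (tau : 'rV[R]_p -> R) (r : R) : continuous tau -> r < 1 ->
  exists phi : R -> disk R p.+1 -> disk R p.+1,
  [/\ continuous (fun q : R * disk R p.+1 => phi q.1 q.2), (forall v, phi 0 v = v),
    (forall t v, sqnorm (val v) = 1 -> phi t v = v)
  & forall s v, 0 <= sg s * headv (val v) -> sqnorm (val (phi 1 v)) < r ->
      tau (tailv (val (phi 1 v))) <> sg s].
Proof.
move=> ctau r1; have r0 : 0 < 1 - r by rewrite subr_gt0.
pose w (t : R) (v : 'rV[R]_p.+1) : 'rV[R]_p.+1 :=
  consv (headv v + t * (tau (tailv v) * ((1 - sqnorm v) / (1 - r)))) (tailv v).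
exists (fun t v => projd (w t (val v))); split.
- apply: continuous_comp_all; last exact: projd_continuous.
  have cv : continuous (fun q : R * disk R p.+1 => val q.2).
    by apply: cont_snd_comp; exact: disk_val_continuous.
  have ct := continuous_comp_all cv (@tailv_continuous R p).
  apply: cont_consv => //.
  apply: contD; first exact: continuous_comp_all cv (@headv_continuous R p).
  apply: contM; first exact: continuous_fst.
  apply: contM; first exact: continuous_comp_all ct ctau.
  apply: contM; last exact: cont_cst.
  apply: contD; first exact: cont_cst.
  by apply: contN; exact: continuous_comp_all cv (@sqnorm_continuous R _).
- by move=> v; rewrite /w mul0r addr0 consv_head_tail projdK.
- by move=> t v v1; rewrite /w v1 subrr mul0r mulr0 mulr0 addr0 consv_head_tail projdK.
move=> s v v0 /= small tauE.
have [w1 wE] := sqnorm_radproj_lt1 (lt_trans small r1).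
rewrite wE in small tauE; rewrite /w tailv_cons in tauE.
set x := tailv (val v) in tauE.
have /sqnorm_le1P[x1 _] := diskP v; rewrite -/x in x1.
have xr : sqnorm x < r by apply: le_lt_trans small; rewrite /w sqnorm_cons lerDr sqr_ge0.
have ch2 := sqr_chord x1; have ch0 := chord_ge0 x.
set c := chord x in ch2 ch0.
have c1 : c <= 1 by have := sqnorm_ge0 x; nra.
have Kc : 1 <= (1 - r)^-1 * c.
  by rewrite mulrC ler_pdivlMr // mul1r; nra.
move: w1; rewrite ltNge => /negP; apply.
rewrite /w sqnorm_cons -/x tauE mul1r -lerBlDr -ch2.
have tE : sqnorm (val v) = (sg s * headv (val v)) ^+ 2 + sqnorm x.
  by rewrite sqnorm_head_tail exprMn [sg s ^+ 2]expr2 sg_sqr mul1r.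
set t := sg s * headv (val v) in v0 tE.
have tc : t <= c.
  by rewrite -(@ler_pXn2r _ 2) ?nnegrE // ch2; have := diskP v; rewrite tE; lra.
have -> : (headv (val v) + sg s * ((1 - sqnorm (val v)) / (1 - r))) ^+ 2 =
          (t + (1 - sqnorm (val v)) / (1 - r)) ^+ 2.
  by rewrite -[LHS]mul1r -{1}(sg_sqr s) -expr2 -exprMn mulrDr mulrA sg_sqr mul1r.
have h : c <= t + (1 - sqnorm (val v)) / (1 - r).
  rewrite tE (_ : 1 - _ = (c - t) * (c + t)); last by rewrite -subr_sqr ch2; ring.
  have : (c - t) * 1 <= (c - t) * ((1 - r)^-1 * c) by rewrite ler_wpM2l // subr_ge0.
  have : 0 <= (c - t) * ((1 - r)^-1 * t).
    by apply: mulr_ge0; [rewrite subr_ge0|apply: mulr_ge0 => //; rewrite invr_ge0 ltW].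
  by rewrite -!mulrA; nra.
by rewrite ler_sqr ?nnegrE // (le_trans ch0).
Qed.

End DiskSeparation.

Section SeparateHalves.
Context {R : realType} {G : topGroupType}.
Context (Q : gspace G) (p : nat) (I : finType) (st : I -> closed_subgroup G)
  (mp : forall i : I, Defs.orbit (st i) * disk R p.+1 -> Q).
Arguments mp : clear implicits.
Local Notation D := (@CWData R G Q I (fun=> p.+1) st mp).
Context (ax : is_cw D) (p_gt0 : (0 < p)%N).
Local Notation Y := (refined ax).
Local Notation X0 := (FiniteGCW ax).

Lemma refined_dim_le (i : cell (gcw_data Y)) : (cell_dim i <= p.+1)%N.
Proof. by case: i => i [s|] /=; rewrite /refined_dim. Qed.

Lemma skeleton_half s y : skeleton (gcw_data Y) p.+1 y -> half_set mp s y.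
Proof.
move=> [->|[[i o] /= io [q _ <-]]]; first by left.
apply: half_cell; left; move: io; rewrite /refined_dim; case: o {q} => //= s'.
by rewrite ltnn.
Qed.

(** A measure of depth in the halves, above 1/2 near their centres. Composed with a self-map it
    vanishes on boundaries, so [disk_collar] gives a collar that is sent away from all centres. *)
Lemma radius_function : exists kappa : Q -> R, [/\ continuous kappa,
  (forall g x, kappa (gact g x) = kappa x), kappa gpt = 0
  & forall i s c (v : disk R p.+1),
      kappa (cell_map ((i, Some s) : cell (gcw_data Y)) (c, v)) = 1 - sqnorm (val v)].
Proof.
pose S (i : cell (gcw_data Y)) := cell_dim i = p.+1.
have S_dim i : S i -> cell_dim i = p.+1 by [].
pose g (i : cell (gcw_data Y)) (q : Defs.orbit (cell_stab i) * disk R (cell_dim i)) : R :=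
  1 - sqnorm (val q.2).
have gb i (q : Defs.orbit (cell_stab i) * disk R (cell_dim i)) :
    S i -> cell_boundary (D := gcw_data Y) i q -> g i q = (fun=> 0) (cell_map i q).
  by move=> _ qB; rewrite /g qB subrr.
pose kappa : Y -> R := cell_glue S g (fun=> 0).
have kS (i : cell (gcw_data Y)) q : S i -> kappa (cell_map i q) = g i q.
  by move=> Si; apply: (cell_glue_cell S_dim gb).
have kN (i : cell (gcw_data Y)) q : ~ S i -> kappa (cell_map i q) = 0.
  by move=> nSi; apply: (cell_glue_other _ _ S_dim _ nSi (refined_dim_le i)).
have k0 : kappa gpt = 0 by exact: cell_glue_pt.
exists kappa; split => //.
- apply: (@cw_continuous _ _ Y) => i; have [Si|nSi] := pselect (S i).
    apply: (@eq_continuous _ _ _ (g i)); first by move=> q; exact: kS.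
    apply: (cont_snd_comp (f := fun v : disk R (cell_dim i) => 1 - sqnorm (val v))).
    apply: contD; first exact: cont_cst.
    by apply: contN; apply: continuous_comp_all;
      [exact: disk_val_continuous|exact: sqnorm_continuous].
  by apply: (@eq_continuous _ _ _ (fun=> 0)); [move=> q; exact: kN|exact: cont_cst].
- move=> a x; have [->|[i [[c v] [pI ->]]]] := @cw_pointP _ _ Y x; first by rewrite gact_pt.
  rewrite -(cell_map_equivariant (gcw_axioms Y)).
  by have [Si|nSi] := pselect (S i); [rewrite !kS|rewrite !kN].
- by move=> i s c v; rewrite kS.
Qed.

(** Here [f1] perturbs [f] in the target, [f2] precomposes with the vertical push in the source, and
    [f3] expands around the centres of the halves. Expansion repairs every point except one sent
    close to the centre of a wrong half, and the push leaves no such point. *)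
Lemma separate_halves (f : gmap Q Q) : exists f1 f2 f3 : gmap Q Q,
  [/\ ghomotopic R f f1, ghomotopic R f1 f2, ghomotopic R f2 f3
    & forall s, set_fun (half_set mp s) (half_set mp s) f3].
Proof.
pose S s (x : cell (gcw_data Y)) := x.2 = Some s.
have S_dim s i : S s i -> cell_dim i = p.+1 by case: i => i o; rewrite /S /= => ->.
have [u uP] := choice (fun s => cell_perturbation refined_dim_le (S_dim s)).
have [T TP] := choice uP.
have cu s : continuous (u s) by have [] := TP s.
have uG s a x : u s (gact a x) = u s x by have [_ H _ _ _] := TP s; exact: H.
have T0 s x : T s 0 x = x by have [_ _ [H _] _ _] := TP s; exact: H.
pose base i : Defs.orbit (st i) := \pi_(Defs.orbit (st i)) 1%g.
have to_base i c (v : disk R p.+1) : exists g, mp i (c, v) = gact g (mp i (base i, v)).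
  exists (repr c); rewrite -(pure_equivariant ax) orbit_act_pi mulg1 reprK //.
have c_slice i c : continuous (fun v : disk R p.+1 => mp i (c, v)).
  apply: (continuous_comp_all (f := fun v : disk R p.+1 => (c, v)) _ (@pure_continuous _ _ _ _ _ _ _ ax i)).
  by apply: continuous_pairing; [exact: cont_cst|move=> v].
pose h i s v := u s (f (mp i (base i, projd v))).
have ch i s : continuous (h i s).
  apply: (@continuous_comp_all _ _ _ (@projd R p.+1) (fun v => u s (f (mp i (base i, v))))).
    exact: projd_continuous.
  apply: continuous_comp_all (cu s).
  exact: continuous_comp_all (c_slice i _) (@gmap_continuous _ _ _ f).
have hE i s c (v : disk R p.+1) : h i s (val v) = u s (f (mp i (c, v))).
  have [g ->] := to_base i c v.
  by rewrite gmap_equivariant uG /h projdK.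
have sep i := disk_separation p_gt0 (margin_gt0 p.+1) (ch i).
have [w wP] := choice sep; have [tau tauP] := choice wP; have [e eP] := choice tauP.
pose A i s (v : disk R p.+1) := w i s (val v) - h i s (val v).
have cA i s : continuous (A i s).
  have [_ cw _ _ _] := eP i; have cv := @disk_val_continuous R p.+1.
  apply: contD; first exact: continuous_comp_all cv (cw s).
  by apply: contN; exact: continuous_comp_all cv (ch i s).
(* Both perturbations are applied in turn, each with the correction computed from [f] itself. *)
pose z i (t : R) (q : Defs.orbit (st i) * disk R p.+1) : Q :=
  T true (t *: A i true q.2) (f (mp i q)).
pose g i (t : R) (q : Defs.orbit (st i) * disk R p.+1) : Q :=
  T false (t *: A i false q.2) (z i t q).
have cz i : continuous (fun q : R * (Defs.orbit (st i) * disk R p.+1) => z i q.1 q.2).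
  apply: (continuous_comp_all (f := fun q : R * (Defs.orbit (st i) * disk R p.+1) =>
    (q.1 *: A i true q.2.2, f (mp i q.2))) _ (@gfam_continuous _ _ _ _ (T true))).
  apply: continuous_pairing.
    apply: contZ; first exact: continuous_fst.
    apply: (cont_snd_comp (f := fun q : Defs.orbit (st i) * disk R p.+1 => A i true q.2)).
    by apply: cont_snd_comp; exact: cA.
  apply: (cont_snd_comp (f := fun q => f (mp i q))).
  apply: (continuous_comp_all (f := mp i) _ (@gmap_continuous _ _ _ f)).
  exact: (@pure_continuous _ _ _ _ _ _ _ ax i).
have cg i : continuous (fun q : R * (Defs.orbit (st i) * disk R p.+1) => g i q.1 q.2).
  apply: (continuous_comp_all (f := fun q : R * (Defs.orbit (st i) * disk R p.+1) =>
    (q.1 *: A i false q.2.2, z i q.1 q.2)) _ (@gfam_continuous _ _ _ _ (T false))).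
  apply: continuous_pairing; last exact: cz.
  apply: contZ; first exact: continuous_fst.
  apply: (cont_snd_comp (f := fun q : Defs.orbit (st i) * disk R p.+1 => A i false q.2)).
  by apply: cont_snd_comp; exact: cA.
have [|||||||K [KS _]] := @cell_glue_family R G X0 R Q (fun=> True) p.+1 g
  (const_family R (gzero Q Q)).
- exact: locally_compactR.
- exact: norm_hausdorff.
- by [].
- by [].
- by move=> i _; exact: cg.
- move=> i t a c v _; rewrite /g /z /= (pure_equivariant ax) gmap_equivariant.
  by rewrite !gfam_equivariant.
- move=> i t [c v] _ /= v1.
  by rewrite /g /z /= (pure_boundary ax _ v1) gmap_pt !gfam_pt.
have {}KS i t c v : K t (mp i (c, v)) = g i t (c, v) by exact: KS.
pose f1 := gfam_map K 1.
(* The two perturbations do not disturb each other near centres: one for side [s] that ends in a top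
   cell of the other side has not moved the point. So only the one belonging to the cell reached has
   acted, and its coordinate is [w i s]. *)
have f1_near i c (v : disk R p.+1) j s c' (v' : disk R p.+1) :
    f1 (mp i (c, v)) = cell_map ((j, Some s) : cell (gcw_data Y)) (c', v') ->
    `|val v'| < margin p.+1 -> `|w i s (val v)| = `|val v'|.
  rewrite /= KS /g /z /= !scale1r => E small.
  have [_ _ _ w_h _] := eP i; have wh s0 := w_h s0 (val v) (diskP v).
  have js : open_cell ((j, Some s) : cell (gcw_data Y)) (cell_map ((j, Some s) : cell (gcw_data Y)) (c', v')).
    exists (c', v') => //; rewrite /cell_interior /=.
    apply: (@le_lt_trans _ _ (1 ^+ 2 / 16)); last by lra.
    by apply: sqnorm_margin; rewrite ?mul1r ?ltW.
  have {}E' : T s (A i s v) (f (mp i (c, v))) =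
      cell_map ((j, Some s) : cell (gcw_data Y)) (c', v').
    have [_ _ [_ outF] _ sepF] := TP false; have [_ _ [_ outT] _ sepT] := TP true.
    case: s c' v' E small js => c' v' E small js.
      by apply: (etrans (esym (sepF (j, Some true) _ _ _ _ _)) E) => //; rewrite E.
    set zz := T true (A i true v) (f (mp i (c, v))) in E.
    suff zE : zz = f (mp i (c, v)) by rewrite -{1}zE.
    have [j' [Sj' j'z]] : exists j', S false j' /\ open_cell j' zz.
      apply: contrapT => nz; apply: (nz); exists (j, Some false); split => //.
      have : open_cell ((j, Some false) : cell (gcw_data Y)) (T false (A i false v) zz).
        by rewrite E.
      by rewrite outF // => j' Sj' j'z; apply: nz; exists j'.
    apply: sepT j'z; first exact: S_dim Sj'.
    by rewrite /S Sj'.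
  have [_ _ _ H _] := TP s.
  have := H (f (mp i (c, v))) (w i s (val v)) (j, Some s) c' v' erefl.
  rewrite -hE => /(_ (wh s) E' small) <-.
  by congr `|_|; exact: resize_id.
have [kappa [ck kG k0 kS]] := radius_function.
have f1_gpt i c (v : disk R p.+1) : sqnorm (val v) = 1 -> f1 (mp i (c, v)) = gpt.
  by move=> v1; rewrite (pure_boundary ax _ v1) gmap_pt.
have collar i : exists r : R, r < 1 /\ forall v : disk R p.+1, r <= sqnorm (val v) ->
    `|kappa (f1 (mp i (base i, v)))| < 1 / 2.
  have [|||r [r0 r1 rP]] := @disk_collar R p.+1
      (fun v => kappa (f1 (mp i (base i, v)))) (1 / 2).
  - apply: continuous_comp_all ck.
    exact: continuous_comp_all (c_slice i _) (@gmap_continuous _ _ _ f1).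
  - by rewrite divr_gt0.
  - by move=> v v1; rewrite f1_gpt.
  - by exists r.
have [r rP] := choice collar.
have [phi phiP] := choice (fun i => disk_push (let: And5 _ _ ctau _ _ := eP i in ctau) (rP i).1).
have [||||||M [MS _]] := @move_cells R G X0 R (fun=> True) p.+1 phi.
- exact: locally_compactR.
- exact: norm_hausdorff.
- by [].
- by [].
- by move=> i _; have [] := phiP i.
- by move=> i t c v _ v1; have [_ _ -> ] := phiP i.
have {}MS i t c v : M t (mp i (c, v)) = mp i (c, phi i t v) by exact: MS.
pose f2 := gcomp f1 (gfam_map M 1).
(* A single expansion radius has to serve all cells. *)
pose e0 := \big[Num.min/Num.min (margin p.+1) 1]_i e i.
have e0_gt0 : 0 < e0.
  rewrite /e0; elim/big_ind : _ => [|x y x0 y0|i _].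
  - by rewrite lt_min margin_gt0 ltr01.
  - by rewrite lt_min x0.
  - by have [] := eP i.
have e0i i : e0 <= e i by exact: bigmin_le_cond.
have : e0 <= Num.min (margin p.+1) 1 by exact: bigmin_le_id.
rewrite le_min => /andP[e0m e01].
have [E [E0 Esk Ecell]] := cell_expansion refined_dim_le e0_gt0 e01.
exists f1, f2, (gcomp (gfam_map E 1) f2); split.
- apply: (gfam_homotopic (K := K)) => // x.
  have [->|[i [c [v [vI ->]]]]] := pure_pointP ax x; first by rewrite gmap_pt gfam_pt.
  by rewrite KS /g /z /= !scale0r !T0.
- apply: (gfam_homotopic (K := gfam_post f1 M)) => // x /=.
  have [->|[i [c [v [vI ->]]]]] := pure_pointP ax x; first by rewrite !gfam_pt.
  by rewrite MS; have [_ -> _ _] := phiP i.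
- by apply: (gfam_homotopic (K := gfam_pre E f2)) => // x /=; rewrite E0.
move=> s x xs.
have [->|[i [c [v [v0 ->]]]]] := xs; first by rewrite gmap_pt; left.
rewrite /= MS; set v' := phi i 1 v.
change (half_set mp s (E 1 (f1 (mp i (c, v'))))); set y := f1 _.
have [->|[[j o] [[c1 v1] [v1I yE]]]] := @cw_pointP _ _ Y y; first by rewrite gfam_pt; left.
case: o c1 v1 v1I yE => [s'|] c1 v1 v1I yE; last first.
  have ysk : skeleton (gcw_data Y) p.+1 y.
    by right; exists (j, None); [rewrite /= /refined_dim|exists (c1, v1)].
  by rewrite Esk //; exact: skeleton_half.
have [v2 [E1y v2e]] := Ecell (j, Some s') c1 v1 erefl.
rewrite yE E1y.
(* In the right half the expansion stays in the closed cell. Near the centre of a wrong half [s'],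
   [tau] takes the value [- sg s'], that is [sg s], while the collar forces [v'] inside the radius;
   this is the case excluded by [push]. *)
have [ss'|ss'] := eqVneq s' s; first by apply: half_cell; right; rewrite ss'.
have [/v2e v2B|small] := leP e0 `|val v1|.
  apply: skeleton_half.
  by apply: (cell_map_boundary (gcw_axioms Y) (i := (j, Some s'))); exists (c1, v2).
have wE := f1_near _ _ _ _ _ _ _ yE (lt_le_trans small e0m).
have sgE : - sg s' = sg s :> R.
  by clear -ss'; case: s s' ss' => [] [] //; rewrite /sg ?opprK.
have [_ _ _ _ tau_near] := eP i; have [_ _ _ push] := phiP i.
have v'r : sqnorm (val v') < r i.
  rewrite ltNge; apply/negP => /(rP i).2.
  have -> : kappa (f1 (mp i (base i, v'))) = kappa y.
    by have [a av] := to_base i c v'; rewrite /y av gmap_equivariant kG.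
  rewrite yE kS ltr_norml => /andP[_]; apply/negP; rewrite -leNgt.
  have : sqnorm (val v1) <= 1 ^+ 2 / 16.
    by apply: sqnorm_margin; rewrite ?mul1r // ltW // (lt_le_trans small).
  lra.
case: (push s v v0 v'r); rewrite -sgE; apply: tau_near; first exact: diskP.
by rewrite wE (lt_le_trans small).
Qed.

End SeparateHalves.

(** Transport of a dependent family along a bijection; no cast is left in the equation because
    identity proofs in an [eqType] are unique. *)
Lemma dep_bijection (J I : eqType) (en : J -> I) (P : I -> Type) (gg : forall k, P (en k)) :
  injective en -> (forall i, exists k, en k = i) ->
  exists g : forall i, P i, forall k, g (en k) = gg k.
Proof.
move=> en_inj surj.
exists (fun i => eq_rect _ P (gg (sval (cid (surj i)))) i (proj2_sig (cid (surj i)))).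
move=> k; case: (cid (surj (en k))) => k' /= E.
have kk : k' = k by exact: en_inj.
subst k'; rewrite (eq_irrelevance E (erefl _)); exact: erefl.
Qed.

Lemma paste_continuous (T U : topologicalType) (A A' : set T) (f f1 f2 : T -> U) :
  closed A -> closed A' -> (forall x, A x \/ A' x) ->
  (forall x, A x -> f x = f1 x) -> (forall x, A' x -> f x = f2 x) ->
  continuous f1 -> continuous f2 -> continuous f.
Proof.
move=> cA cA' AA' fA fA' c1 c2; apply/continuous_closedP => C cC.
rewrite (_ : f @^-1` C = (A `&` f1 @^-1` C) `|` (A' `&` f2 @^-1` C)).
  by apply: closedU; apply: closedI => //; apply: closed_preimage.
apply/seteqP; split => x /=.
  by move=> Cx; have [Ax|Ax] := AA' x; [left; rewrite -fA|right; rewrite -fA'].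
by move=> [[Ax]|[Ax]]; [rewrite fA|rewrite fA'].
Qed.

Lemma add_point_prod_continuous (T S U : topologicalType) (f : add_point T * S -> U) :
  continuous (fun q : T * S => f (Some q.1, q.2)) ->
  (forall u u', f (None, u) = f (None, u')) -> continuous f.
Proof.
move=> cf fN [[c|] u] V /= Vf.
  have [[P P'] /= [Pc P'u] PP'] := cf (c, u) _ Vf.
  exists ([set (Some c' : add_point T) | c' in P], P') => /=.
    split => //; move: Pc; rewrite !nbhsE => -[O [oO Oc] OP].
    exists [set (Some c' : add_point T) | c' in O]; last first.
      by move=> _ [c' Oc' <-]; exists c' => //; exact: OP.
    split; last by exists c.
    change (open (Some @^-1` [set (Some c' : add_point T) | c' in O])).
    rewrite (_ : Some @^-1` _ = O) //; apply/seteqP; split => c' /=.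
      by move=> [c'' Oc'' [<-]].
    by move=> Oc'; exists c'.
  by move=> [_ u'] /= [[c' Pc' <-] P'u']; exact: (PP' (c', u')).
exists ([set None], setT) => /=.
  split; last exact: filterT.
  rewrite nbhsE; exists [set None] => //; split => //.
  change (open (Some @^-1` [set None : add_point T])).
  have -> : Some @^-1` [set None : add_point T] = set0 by apply/seteqP; split.
  exact: open0.
move=> [_ u'] /= [-> _]; rewrite (fN _ u); exact: nbhs_singleton Vf.
Qed.

(** * Dimension one *)

Section Circle.
Context {R : realType}.

Lemma sg_sign_ge0 (t : R) : 0 <= sg (0 <= t) * t.
Proof. by have [t0|t0] := leP 0 t; rewrite /sg ?mul1r // mulN1r oppr_ge0 ltW. Qed.

Lemma sphereP n (u : sphere R n) : sqnorm (val u) = 1.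
Proof. by case: u => u uP; exact: set_mem. Qed.

Definition circle_x (u : sphere R 1) : R := headv (val u).
Definition circle_y (u : sphere R 1) : R := headv (tailv (val u)).

Lemma circle_eq u : circle_x u ^+ 2 + circle_y u ^+ 2 = 1.
Proof.
rewrite -(sphereP u) /circle_x /circle_y [RHS]sqnorm_head_tail.
by rewrite [sqnorm (tailv _)]sqnorm_head_tail /sqnorm big_ord0 addr0.
Qed.

Lemma circle_inj u u' : circle_x u = circle_x u' -> circle_y u = circle_y u' -> u = u'.
Proof.
move=> x y; apply: val_inj.
rewrite /= -[LHS]consv_head_tail -[RHS]consv_head_tail; congr (consv _ _) => //.
rewrite -[LHS]consv_head_tail -[RHS]consv_head_tail; congr (consv _ _) => //.
by apply/rowP => -[].
Qed.

Lemma circle_continuous : continuous circle_x /\ continuous circle_y.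
Proof.
have cv : continuous (val : sphere R 1 -> 'rV[R]_2) by exact: initial_continuous.
split; first exact: continuous_comp_all cv (@headv_continuous R 1).
apply: continuous_comp_all (@headv_continuous R 0).
exact: continuous_comp_all cv (@tailv_continuous R 1).
Qed.

Lemma circle_pt : circle_x (sphere_pt R 1) = 1 /\ circle_y (sphere_pt R 1) = 0.
Proof.
split; first by rewrite /circle_x /headv mxE !eqxx.
by rewrite /circle_y /headv /tailv !mxE.
Qed.

Definition circle_wrap_vec (t : R) : 'rV[R]_2 :=
  consv (2 * t ^+ 2 - 1) (consv (2 * t * Num.sqrt (1 - t ^+ 2)) 0).

Lemma sqr_head1 (v : 'rV[R]_1) : sqnorm v = headv v ^+ 2.
Proof. by rewrite sqnorm_head_tail /sqnorm big_ord0 addr0. Qed.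

Lemma circle_wrap_mem (v : disk R 1) : circle_wrap_vec (headv (val v)) \in sphere_set R 1.
Proof.
apply/mem_set; rewrite /sphere_set /= !sqnorm_cons sqnorm0 addr0.
have := diskP v; rewrite sqr_head1; set t := headv _ => t1.
by rewrite exprMn sqr_sqrtr ?subr_ge0 //; ring.
Qed.

(** The interval wraps around the circle by angle doubling. *)
Definition circle_wrap (v : disk R 1) : sphere R 1 := exist _ (circle_wrap_vec (headv (val v))) (circle_wrap_mem v).

Lemma circle_wrapE v : circle_x (circle_wrap v) = 2 * headv (val v) ^+ 2 - 1 /\
  circle_y (circle_wrap v) = 2 * headv (val v) * Num.sqrt (1 - headv (val v) ^+ 2).
Proof. by rewrite /circle_x /circle_y /= tailv_cons !headv_cons. Qed.

Lemma circle_wrap_continuous : continuous circle_wrap.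
Proof.
apply: continuous_comp_initial.
have ch : continuous (fun v : disk R 1 => headv (val v)).
  exact: continuous_comp_all (@disk_val_continuous R 1) (@headv_continuous R 0).
apply: cont_consv.
  apply: contD; last exact: cont_cst.
  by apply: contM; [exact: cont_cst|exact: contX].
apply: cont_consv; last exact: cont_cst.
apply: contM; first by apply: contM; [exact: cont_cst|].
apply: cont_sqrt; apply: contD; first exact: cont_cst.
by apply: contN; exact: contX.
Qed.

Lemma circle_wrap_boundary v : sqnorm (val v) = 1 -> circle_wrap v = sphere_pt R 1.
Proof.
rewrite sqr_head1 => v1; have [x y] := circle_wrapE v; have [px py] := circle_pt.
by apply: circle_inj; rewrite ?px ?py ?x ?y v1; [ring|rewrite subrr sqrtr0 mulr0].
Qed.

(** The half-angle formula, where [s] selects the upper or the lower semicircle. *)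
Definition circle_unwrap (s : bool) (u : sphere R 1) : disk R 1 :=
  projd (consv (sg s * Num.sqrt ((1 + circle_x u) / 2)) 0).

Lemma circle_unwrap_continuous s : continuous (circle_unwrap s).
Proof.
apply: continuous_comp_all; last exact: projd_continuous.
apply: cont_consv; last exact: cont_cst.
apply: contM; first exact: cont_cst.
apply: cont_sqrt; apply: contM; last exact: cont_cst.
by apply: contD; [exact: cont_cst|exact: circle_continuous.1].
Qed.

Lemma circle_x_itv u : -1 <= circle_x u <= 1.
Proof. by have := circle_eq u; move=> E; apply/andP; split; nra. Qed.

Lemma circle_unwrapE s u : headv (val (circle_unwrap s u)) = sg s * Num.sqrt ((1 + circle_x u) / 2).
Proof.
have /andP[x1 x2] := circle_x_itv u.
rewrite /= radproj_id ?headv_cons // sqr_head1 headv_cons exprMn [sg s ^+ 2]expr2 sg_sqr mul1r.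
by rewrite sqr_sqrtr; lra.
Qed.

Lemma circle_unwrapK s u : 0 <= sg s * circle_y u -> circle_wrap (circle_unwrap s u) = u.
Proof.
move=> y0; have [x y] := circle_wrapE (circle_unwrap s u); have /andP[x1 x2] := circle_x_itv u.
have h0 : 0 <= (1 + circle_x u) / 2 by lra.
have t2 : headv (val (circle_unwrap s u)) ^+ 2 = (1 + circle_x u) / 2.
  by rewrite circle_unwrapE exprMn [sg s ^+ 2]expr2 sg_sqr mul1r sqr_sqrtr.
apply: circle_inj; first by rewrite x t2; field.
rewrite y t2 circle_unwrapE.
have h1 : 0 <= 1 - (1 + circle_x u) / 2 by lra.
have a2 := sqr_sqrtr h0; have b2 := sqr_sqrtr h1.
have a0 := sqrtr_ge0 ((1 + circle_x u) / 2).
have b0 := sqrtr_ge0 (1 - (1 + circle_x u) / 2).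
set a := Num.sqrt ((1 + circle_x u) / 2) in a2 a0 *.
set b := Num.sqrt (1 - (1 + circle_x u) / 2) in b2 b0 *.
have ab : 2 * a * b = sg s * circle_y u.
  have ab0 : 0 <= 2 * a * b by rewrite !mulr_ge0.
  apply/eqP; rewrite -(@eqrXn2 _ 2) //; apply/eqP.
  rewrite !exprMn a2 b2 [sg s ^+ 2]expr2 sg_sqr mul1r.
  have -> : circle_y u ^+ 2 = 1 - circle_x u ^+ 2 by rewrite -(circle_eq u); ring.
  by field.
by rewrite (_ : _ * b = sg s * (2 * a * b)); [rewrite ab mulrA sg_sqr mul1r|ring].
Qed.

Lemma circle_wrapK (v : disk R 1) s : 0 <= sg s * headv (val v) -> circle_unwrap s (circle_wrap v) = v.
Proof.
move=> v0; have [x _] := circle_wrapE v; apply: val_inj.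
rewrite -[LHS]consv_head_tail -[RHS]consv_head_tail; congr (consv _ _); last first.
  by apply/rowP => -[].
rewrite circle_unwrapE x (_ : (1 + _) / 2 = headv (val v) ^+ 2); last by field.
rewrite sqrtr_sqr -[RHS]mul1r -(sg_sqr s) -mulrA; congr (_ * _).
move: v0; rewrite /sg; case: s => h; first by rewrite ger0_norm; lra.
by rewrite ler0_norm; lra.
Qed.

End Circle.

Section WedgeOfSpheres.
Context {R : realType} {G : topGroupType} (Q : gspace G) (I : finType)
  (st : I -> closed_subgroup G)
  (mp : forall i : I, Defs.orbit (st i) * disk R 1 -> Q).
Arguments mp : clear implicits.
Local Notation D := (@CWData R G Q I (fun=> 1%N) st mp).
Context (ax : is_cw D) (n : nat) (en : 'I_n.+1 -> I).
Hypotheses (en_inj : injective en) (en_surj : forall i, exists k, en k = i).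

Local Notation sphere_space := (fun k : 'I_n.+1 => equivariant_1sphere R (st (en k))).
Local Notation W := (wedge_gspace sphere_space).
Local Notation circle := (@trivial_gspace G (sphere R 1) (sphere_pt R 1)).

(** The semicircles meet in two points. At [x = 1] both signs give an end of the interval, hence the
    base point, and at [x = -1] both give the midpoint. *)
Lemma mp_circle_unwrap i c (s s' : bool) u : circle_y u = 0 ->
  mp i (c, circle_unwrap s u) = mp i (c, circle_unwrap s' u).
Proof.
move=> y0; have := circle_eq u; rewrite y0 expr0n addr0 => /eqP.
rewrite sqrf_eq1 => /orP[]/eqP x.
  have b r : sqnorm (val (circle_unwrap r u)) = 1.
    by rewrite sqr_head1 circle_unwrapE x exprMn [sg r ^+ 2]expr2 sg_sqr mul1r sqr_sqrtr; lra.
  by rewrite !(pure_boundary ax).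
congr (mp i (c, _)); apply: val_inj.
rewrite -[LHS]consv_head_tail -[RHS]consv_head_tail; congr (consv _ _); last first.
  by apply/rowP => -[].
by rewrite !circle_unwrapE x subrr mul0r sqrtr0 !mulr0.
Qed.

Definition wedge_to_cell k (q : orbit_plus (st (en k)) * circle) : Q :=
  if q.1 is Some c then mp (en k) (c, circle_unwrap (0 <= circle_y q.2) q.2) else gpt.

Lemma wedge_to_cell_continuous k : continuous (@wedge_to_cell k).
Proof.
apply: add_point_prod_continuous => //.
pose P : Type := (Defs.orbit (st (en k)) * sphere R 1)%type.
have [_ cy] := @circle_continuous R.
have cys : continuous (fun q : Defs.orbit (st (en k)) * sphere R 1 => circle_y q.2).
  by apply: cont_snd_comp.
have cf s : continuous (fun q : Defs.orbit (st (en k)) * sphere R 1 => mp (en k) (q.1, circle_unwrap s q.2)).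
  apply: (continuous_comp_all (f := fun q : Defs.orbit (st (en k)) * sphere R 1 =>
    (q.1, circle_unwrap s q.2)) _ (@pure_continuous _ _ _ _ _ _ _ ax (en k))).
  apply: continuous_pairing; first exact: continuous_fst.
  by apply: cont_snd_comp; exact: circle_unwrap_continuous.
apply: (@paste_continuous _ _
  ((fun q : Defs.orbit (st (en k)) * sphere R 1 => circle_y q.2) @^-1` [set t | 0 <= t])
  ((fun q : Defs.orbit (st (en k)) * sphere R 1 => circle_y q.2) @^-1` [set t | t <= 0])
  _ _ _ _ _ _ _ _ (cf true) (cf false)).
- by apply: closed_preimage => //; exact: closed_ge.
- by apply: closed_preimage => //; exact: closed_le.
- by move=> q /=; have [|/ltW] := leP 0 (circle_y q.2); [left|right].
- by move=> q /= y0; rewrite /wedge_to_cell /= y0.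
- move=> q /= y0; rewrite /wedge_to_cell /=.
  have [y0'|//] := boolP (0 <= circle_y q.2).
  by apply: mp_circle_unwrap; apply/eqP; rewrite eq_le y0 y0'.
Qed.

Program Definition wedge_to_cell_map k : gmap (prod_gspace (orbit_plus (st (en k))) circle) Q :=
  @GMap G (prod_gspace (orbit_plus (st (en k))) circle) Q (@wedge_to_cell k) _ _ _.
Next Obligation. exact: wedge_to_cell_continuous. Qed.
Next Obligation.
move=> k g [[c|] u] //=; last by rewrite /wedge_to_cell /= gact_pt.
by rewrite /wedge_to_cell /= (pure_equivariant ax).
Qed.
Next Obligation. by []. Qed.

Lemma wedge_to_cell_axes k q : inv_set (smash_axes (orbit_plus (st (en k))) circle) q ->
  wedge_to_cell_map k q = gpt.
Proof.
case: q => oc u /= [->|->] //; case: oc => [c|] //=.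
rewrite /wedge_to_cell /=; apply: (pure_boundary ax).
by rewrite sqr_head1 circle_unwrapE circle_pt.1 exprMn [sg _ ^+ 2]expr2 sg_sqr mul1r sqr_sqrtr; lra.
Qed.

Definition sphere_to_cell k : gmap (equivariant_1sphere R (st (en k))) Q :=
  gfactor (@wedge_to_cell_axes k).

Lemma sphere_to_cell_pt i j : sphere_to_cell i gpt = sphere_to_cell j gpt.
Proof. by rewrite !gmap_pt. Qed.

Definition wedge_to_complex (x : W) : Q := wedge_sigT.wedge_fun (fun k => sphere_to_cell k) x.

Lemma wedge_to_complexE k (x : sphere_space k) :
  wedge_to_complex (wedge_incl x) = sphere_to_cell k x.
Proof.
by rewrite /wedge_to_complex /wedge_incl wedge_sigT.wedge_lift_funE //; exact: sphere_to_cell_pt.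
Qed.

Program Definition wedge_to_complex_map : gmap W Q := @GMap G W Q wedge_to_complex _ _ _.
Next Obligation.
apply: wedge_sigT.wedge_fun_continuous; last exact: sphere_to_cell_pt.
by move=> k; exact: gmap_continuous.
Qed.
Next Obligation.
move=> g x; have [k [y ->]] := wedge_inclP x.
by rewrite /= wedge_act_incl !wedge_to_complexE gmap_equivariant.
Qed.
Next Obligation. by rewrite /= wedge_to_complexE gmap_pt. Qed.

Definition cell_to_wedge k (q : Defs.orbit (st (en k)) * disk R 1) : W :=
  @wedge_incl G n sphere_space k
    (gproj (smash_axes (orbit_plus (st (en k))) circle) (Some q.1, circle_wrap q.2)).

Lemma add_point_continuous (T : topologicalType) : continuous (Some : T -> add_point T).
Proof. by apply/continuousP => U. Qed.

Lemma cell_to_wedge_continuous k : continuous (@cell_to_wedge k).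
Proof.
apply: (continuous_comp_all (h := @wedge_incl G n sphere_space k)); last first.
  exact: wedge_sigT.wedge_lift_continuous.
apply: (continuous_comp_all (f := fun q : Defs.orbit (st (en k)) * disk R 1 =>
  (Some q.1 : add_point (Defs.orbit (st (en k))), circle_wrap q.2)) _
  (@gmap_continuous _ _ _ (gproj (smash_axes (orbit_plus (st (en k))) circle)))).
apply: continuous_pairing.
  by apply: continuous_comp_all; [exact: continuous_fst|exact: add_point_continuous].
by apply: cont_snd_comp; exact: circle_wrap_continuous.
Qed.

Lemma complex_to_wedge_ex : exists a : gmap Q W,
  forall k q, a (mp (en k) q) = @cell_to_wedge k q.
Proof.
(* Gluing is indexed by cells, the wedge by ordinals. *)
have [g gP] := @dep_bijection _ _ en
  (fun i => Defs.orbit (st i) * disk R 1 -> W) cell_to_wedge en_inj en_surj.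
have [|||||||K [KS _]] := @cell_glue_family R G (FiniteGCW ax) R W (fun=> True) 1
  (fun i _ => g i) (const_family R (gzero Q W)).
- exact: locally_compactR.
- exact: norm_hausdorff.
- by [].
- by [].
- move=> i _; have [k <-] := en_surj i.
  by apply: cont_snd_comp; rewrite gP; exact: cell_to_wedge_continuous.
- move=> i t a c v _ /=; have [k Ek] := en_surj i; subst i.
  rewrite !gP /cell_to_wedge /= [RHS]wedge_act_incl; apply: (congr1 (@wedge_incl G n sphere_space k)).
  by rewrite [RHS]collapse_act_pi.
- move=> i t [c v] _ /= v1; have [k Ek] := en_surj i; subst i.
  have E : gproj (smash_axes (orbit_plus (st (en k))) circle)
      (Some c, circle_wrap v) = gpt.
    apply/collapse_piP; right; split; [right|left] => //=.
    exact: circle_wrap_boundary.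
  rewrite gP /cell_to_wedge E.
  exact: (@wedge_incl_pt G n sphere_space k ord0).
exists (gfam_map K 0) => k q.
by have := KS (en k) 0 q Logic.I; rewrite gP.
Qed.

Lemma pure1_wedge : wedge_of_1spheres R Q.
Proof.
have [a aP] := complex_to_wedge_ex.
exists n, (fun k => st (en k)), a, wedge_to_complex_map; split.
  move=> x; have [->|[i [c [v [vI ->]]]]] := pure_pointP ax x; first by rewrite !gmap_pt.
  have [k Ek] := en_surj i; subst i.
  rewrite aP /= wedge_to_complexE /sphere_to_cell gfactor_pi /=.
  rewrite /wedge_to_cell /=; congr (mp (en k) (c, _)).
  have [_ y] := circle_wrapE v; move: vI; rewrite sqr_head1 => v1.
  have s0 : 0 < Num.sqrt (1 - headv (val v) ^+ 2) by rewrite sqrtr_gt0 subr_gt0.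
  have yE : (0 <= circle_y (circle_wrap v)) = (0 <= headv (val v)).
    by rewrite y pmulr_lge0 // pmulr_rge0.
  apply: circle_wrapK; rewrite yE.
  exact: sg_sign_ge0.
move=> x; have [k [y ->]] := wedge_inclP x.
rewrite /= wedge_to_complexE; have [[oc u] ->] := gproj_surj (y : quot_gspace _).
rewrite /sphere_to_cell gfactor_pi; case: oc => [c|]; last first.
  have -> : gproj (smash_axes (orbit_plus (st (en k))) circle) (None, u) = gpt.
    by apply/collapse_piP; right; split; left.
  rewrite /= /wedge_to_cell /= gmap_pt.
  exact: (@wedge_incl_pt G n sphere_space ord0 k).
rewrite /= /wedge_to_cell /= aP /cell_to_wedge /= circle_unwrapK //.
exact: sg_sign_ge0.
Qed.

End WedgeOfSpheres.

(** * Dimension zero *)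

Section Interval.
Context {R : realType}.

Definition itv_pt (t : R) : disk R 1 := projd (consv t 0).

Lemma itv_pt_continuous : continuous itv_pt.
Proof.
apply: continuous_comp_all (@projd_continuous R 1).
by apply: cont_consv; [move=> x|exact: cont_cst].
Qed.

Lemma itv_ptK (v : disk R 1) : itv_pt (headv (val v)) = v.
Proof.
rewrite /itv_pt (_ : consv _ _ = val v) ?projdK // -[RHS]consv_head_tail.
by congr (consv _ _); apply/rowP => -[].
Qed.

Lemma headv_itv_pt t : -1 <= t <= 1 -> headv (val (itv_pt t)) = t.
Proof.
move=> /andP[t1 t2]; rewrite /= radproj_id ?headv_cons // sqr_head1 headv_cons.
nra.
Qed.

Lemma headv_itv_le t : t <= -1 -> headv (val (itv_pt t)) = -1.
Proof.
move=> t1; rewrite /itv_pt /= (_ : consv t 0 = (- t) *: consv (-1) 0).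
  rewrite radproj_scale ?headv_cons //; first by lra.
  by rewrite sqr_head1 headv_cons; ring.
by apply/rowP => j; rewrite !mxE; case: unlift => [j'|]; rewrite ?mxE; ring.
Qed.

Lemma disk1_itv (v : disk R 1) : -1 <= headv (val v) <= 1.
Proof. by have := diskP v; rewrite sqr_head1 => h; apply/andP; split; nra. Qed.

Lemma disk1_inj (v v' : disk R 1) : headv (val v) = headv (val v') -> v = v'.
Proof. by move=> E; rewrite -(itv_ptK v) E itv_ptK. Qed.

Lemma disk0_unique (v v' : disk R 0) : v = v'.
Proof. by apply: val_inj; apply/rowP => -[]. Qed.

End Interval.

Section Cone.
Context {R : realType} {G : topGroupType} (I : finType) (st : I -> closed_subgroup G).

Definition cyl (i : I) : topologicalType := (Defs.orbit (st i) * disk R 1)%type.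

Definition cyl_act g (s : {i & cyl i}) : {i & cyl i} :=
  existT _ (projT1 s) (orbit_act g (projT2 s).1, (projT2 s).2).

Lemma add_point_sum_continuous (Z : topologicalType) (f : add_point {i & cyl i} -> Z) :
  (forall i, continuous (fun q : cyl i => f (Some (existT _ i q)))) -> continuous f.
Proof.
move=> cf; apply/continuousP => U oU.
suff : open ((fun s : {i & cyl i} => f (Some s)) @^-1` U) by [].
have /continuousP : continuous (fun s : {i & cyl i} => f (Some s)); last by apply.
by move=> [i q] V nV; apply: (@existT_continuous I (fun i => cyl i) i); exact: (cf i q V nV).
Qed.

Lemma cyl_incl_continuous i :
  continuous (fun q : cyl i => Some (existT cyl i q) : add_point {i & cyl i}).
Proof.
apply: (continuous_comp_all (f := existT cyl i)); first exact: existT_continuous.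
exact: add_point_continuous.
Qed.

Program Definition cylinder : gspace G :=
  @GSpace G (add_point {i & cyl i}) (fun g => omap (cyl_act g)) None _ _ _ _.
Next Obligation. by move=> [[i [c v]]|] //=; rewrite /cyl_act /= orbit_act1. Qed.
Next Obligation. by move=> g h [[i [c v]]|] //=; rewrite /cyl_act /= orbit_actM. Qed.
Next Obligation.
move=> g; apply: add_point_sum_continuous => i /=.
apply: (continuous_comp_all (f := fun q : cyl i => (orbit_act g q.1, q.2) : cyl i) _
  (@cyl_incl_continuous i)).
apply: continuous_pairing; last exact: continuous_snd.
apply: (continuous_comp_all (f := fst)); first exact: continuous_fst.
exact: orbit_act_continuous.
Qed.
Next Obligation. by []. Qed.

Definition bottom_set : set cylinder :=
  fun x => if x is Some s then headv (val (projT2 s).2) = -1 else True.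

Lemma bottom_act g x : bottom_set x -> bottom_set (gact g x).
Proof. by case: x => [[i [c v]]|]. Qed.

Definition cylinder_bottom : invariant_subset cylinder :=
  @InvariantSubset G cylinder bottom_set Logic.I bottom_act.

(** The cone on a disjoint union of orbits with a base point: collapsing the level -1 with the added
    point makes the base point the apex, and level 1 is a copy of the original complex. *)
Definition cone : gspace G := quot_gspace cylinder_bottom.

Definition cone_map i (q : Defs.orbit (st i) * disk R 1) : cone :=
  gproj cylinder_bottom (Some (existT cyl i q)).

Lemma cone_map_continuous i : continuous (@cone_map i).
Proof.
exact: (continuous_comp_all (@cyl_incl_continuous i)
  (@gmap_continuous _ _ _ (gproj cylinder_bottom))).
Qed.

Lemma cone_map_equivariant i g c v :
  cone_map (i := i) (orbit_act g c, v) = gact g (cone_map (c, v)).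
Proof. by rewrite /cone_map -gmap_equivariant. Qed.

Lemma cone_map_gpt i c v : cone_map (i := i) (c, v) = gpt <-> headv (val v) = -1.
Proof.
split=> [/collapse_piP[//|[/= ]]//|v1].
by apply/collapse_piP; right; split.
Qed.

Lemma cone_map_inj i j c c' v v' : headv (val v) <> -1 ->
  cone_map (i := i) (c, v) = cone_map (i := j) (c', v') ->
  existT cyl i (c, v) = existT cyl j (c', v').
Proof. by move=> v1 /collapse_piP[E|[/v1]//]; exact: Some_inj E. Qed.

Lemma cone_pointP x : x = gpt \/ exists i c v, headv (val v) <> -1 /\ x = cone_map (i := i) (c, v).
Proof.
have [[[i [c v]]|] ->] := gproj_surj (x : quot_gspace cylinder_bottom); last by left.
have [v1|v1] := eqVneq (headv (val v)) (-1); first by left; apply/(cone_map_gpt c).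
by right; exists i, c, v; split => //; exact/eqP.
Qed.

Lemma cone_closed (C : set cone) : (forall i, closed (@cone_map i @^-1` C)) -> closed C.
Proof.
move=> cC; rewrite -[C]setCK; apply: open_closedC.
suff : forall i, open ((fun q : cyl i => Some (existT cyl i q)) @^-1`
    ((gproj cylinder_bottom : cylinder -> cone) @^-1` ~` C)).
  move=> H; change (open (Some @^-1` ((gproj cylinder_bottom : cylinder -> cone) @^-1` ~` C))).
  by apply/sigT_openP => i; exact: H.
by move=> i; have := closed_openC (cC i).
Qed.

Definition cone_dim (x : I * bool) : nat := if x.2 then 1%N else 0%N.

(** The flag is [true] for the rays over an orbit and [false] for their upper ends. *)
Definition cone_cell (x : I * bool) : Defs.orbit (st x.1) * disk R (cone_dim x) -> cone :=
  match x return Defs.orbit (st x.1) * disk R (cone_dim x) -> cone with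
  | (i, true) => fun q => cone_map (i := i) q
  | (i, false) => fun q => cone_map (i := i) (q.1, itv_pt 1)
  end.

Definition cone_data : cw_data R cone :=
  @CWData R G cone (I * bool)%type cone_dim (fun x => st x.1) cone_cell.

Lemma top_neq : headv (val (itv_pt (1 : R))) <> -1.
Proof. by rewrite headv_itv_pt; [move=> E|]; lra. Qed.

Lemma disk1_interior (v : disk R 1) : (sqnorm (val v) < 1) = (-1 < headv (val v) < 1).
Proof. by rewrite sqr_head1; apply/idP/andP => [h|[h1 h2]]; [split|]; nra. Qed.

Lemma disk0_sqnorm (v : disk R 0) : sqnorm (val v) = 0.
Proof. by rewrite (disk0_unique v (disk_center 0)) sqnorm_center. Qed.

Lemma cone_open_cell i b x : open_cell (D := cone_data) (i, b) x <->
  exists c (v : disk R 1), [/\ headv (val v) <> -1, b = (headv (val v) != 1)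
    & x = cone_map (i := i) (c, v)].
Proof.
case: b; split.
- move=> [[c v] /= vI <-]; exists c, v; move: vI.
  rewrite /cell_interior /= disk1_interior => /andP[v1 v2].
  by split => //; [lra|rewrite lt_eqF].
- move=> [c [v [v1 v2 ->]]]; exists (c, v) => //=.
  rewrite /cell_interior /= disk1_interior; have /andP[h1 h2] := disk1_itv v.
  by rewrite !lt_neqAle h1 h2 -v2 !andbT eq_sym; apply/eqP.
- move=> [[c v] /= vI <-]; exists c, (itv_pt 1); split => //; first exact: top_neq.
  by rewrite headv_itv_pt ?eqxx //; lra.
- move=> [c [v [v1 /esym/negbFE/eqP v2 ->]]]; exists (c, disk_center 0) => /=.
    by rewrite /cell_interior /= radproj_id sqnorm0 ?ltr01 ?ler01.
  congr cone_map; congr pair; apply: disk1_inj.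
  by rewrite v2 headv_itv_pt //; lra.
Qed.

Lemma cone_is_cw : is_cw cone_data.
Proof.
split.
- move=> [i []] /=; first exact: cone_map_continuous.
  apply: (continuous_comp_all (f := fun q : Defs.orbit (st i) * disk R 0 => (q.1, itv_pt 1))).
    by apply: continuous_pairing; [exact: continuous_fst|exact: cont_cst].
  exact: cone_map_continuous.
- by move=> [i []] g c v /=; rewrite cone_map_equivariant.
- move=> [i []] [c v] [c' v'] /set_mem /= vI /set_mem /= v'I E.
    move: vI; rewrite /cell_interior /= disk1_interior => /andP[v1 _].
    have : headv (val v) <> -1 by lra.
    by move=> /cone_map_inj/(_ E)/eqP; rewrite -tag_eqE /tag_eq eqxx /= tagged_asE => /eqP.
  have := cone_map_inj top_neq E => /eqP; rewrite -tag_eqE /tag_eq eqxx /= tagged_asE => /eqP.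
  by move=> [->]; rewrite (disk0_unique v v').
- move=> [i b] [j b'] _ _ [x [/cone_open_cell[c [v [v1 -> ->]]]]].
  move=> /cone_open_cell[c' [v' [v'1 -> E]]].
  have E' := cone_map_inj v1 E.
  have -> : i = j := congr1 (@projT1 _ _) E'.
  by have -> : headv (val v) = headv (val v') :=
    congr1 (fun s : {i & cyl i} => headv (val (projT2 s).2)) E'.
- move=> [i []] [[c v] /= vI /cone_map_gpt v1]; last exact: top_neq v1.
  by move: vI; rewrite /cell_interior /= disk1_interior v1 ltxx.
- apply/seteqP; split => // x _; have [->|[i [c [v [v1 ->]]]]] := cone_pointP x; first by left.
  right; exists (i, headv (val v) != 1) => //.
  by apply/cone_open_cell; exists c, v.
- move=> [i []] x [[c v] /= vB <-]; last first.
    by move: vB; rewrite /cell_boundary /= disk0_sqnorm => /esym/eqP; rewrite oner_eq0.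
  have [v1|v1] := eqVneq (headv (val v)) (-1); first by left; apply/cone_map_gpt.
  right; exists (i, false) => //; apply/cone_open_cell; exists c, v.
  split => //; first exact/eqP.
  move: vB; rewrite /cell_boundary /= sqr_head1 => /eqP.
  by rewrite sqrf_eq1 (negbTE v1) orbF => ->.
- move=> n C Cn Ccl; apply: cone_closed => i.
  have chead : continuous (fun q : Defs.orbit (st i) * disk R 1 => headv (val q.2)).
    apply: (cont_snd_comp (f := fun v : disk R 1 => headv (val v))).
    by apply: continuous_comp_all; [exact: disk_val_continuous|exact: headv_continuous].
  have [n2|n1] := ltnP 1 n; first exact: (Ccl (i, true) n2).
  (* For [n <= 1] the skeleton is the base point with, if [n = 1], the upper ends; so [C] meets a
     cylinder in its two end levels only. *)
  pose A := [set q : Defs.orbit (st i) * disk R 1 | headv (val q.2) = 1 /\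
    C (cone_map (i := i) (q.1, itv_pt 1))].
  pose A' := [set q : Defs.orbit (st i) * disk R 1 | headv (val q.2) = -1 /\ C gpt].
  have itv1 (v : disk R 1) : headv (val v) = 1 -> itv_pt 1 = v.
    by move=> v1; rewrite -v1 itv_ptK.
  have -> : @cone_map i @^-1` C = A `|` A'.
    apply/seteqP; split => [[c v] /= Cv|[c v] [[/= v1]|[/= v1 Cpt]]].
    - have [v1|v1] := eqVneq (headv (val v)) (-1).
        by right; split => //; rewrite -(cone_map_gpt c) in v1; rewrite -v1.
      have [/cone_map_gpt E|[[j b] /= jn]] := Cn _ Cv; first by rewrite E eqxx in v1.
      move=> /cone_open_cell[c' [v' [_ bE E]]]; left.
      have /esym/(congr1 (fun s : {i & cyl i} => headv (val (projT2 s).2))) /= vE :=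
        cone_map_inj (elimN eqP v1) E.
      have vt : headv (val v) = 1.
        rewrite -vE; apply/eqP; apply: negbFE; rewrite -bE.
        by apply/negbTE/negP => b1; move: jn; rewrite /cone_dim /= b1; lia.
      by split => //=; rewrite (itv1 v vt).
    - by rewrite -(itv1 v v1).
    - by rewrite /= (cone_map_gpt c v).2.
  apply: closedU; last first.
    have [Cpt|nCpt] := pselect (C gpt); last first.
      by rewrite (_ : A' = set0); [exact: closed0|apply/seteqP; split => // q []].
    rewrite (_ : A' = (fun q => headv (val q.2)) @^-1` [set -1]).
      by apply: (closed_preimage chead); exact: closed_eq.
    by apply/seteqP; split => q //= [].
  case: n n1 Cn Ccl => [|n] n1 Cn Ccl.
    rewrite (_ : A = set0); first exact: closed0.
    apply/seteqP; split => // -[c v] [/= _ /Cn[/cone_map_gpt|[j /=]]] //.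
    exact: top_neq.
  have Ecl := Ccl (i, false) isT.
  have cp : continuous (fun q : Defs.orbit (st i) * disk R 1 => (q.1, disk_center (R := R) 0)).
    by apply: continuous_pairing; [exact: continuous_fst|exact: cont_cst].
  have c1 : closed ((fun q : Defs.orbit (st i) * disk R 1 => headv (val q.2)) @^-1` [set (1 : R)]).
    by apply: (closed_preimage chead); exact: closed_eq.
  exact: (closedI c1 (closed_preimage cp Ecl)).
Qed.

Definition cone_complex : finite_gcw R G := FiniteGCW cone_is_cw.

End Cone.

Arguments cyl R {G I} st.
Arguments cylinder R {G I} st.
Arguments cylinder_bottom R {G I} st.
Arguments cone R {G I} st.
Arguments cone_complex R {G I} st.

Section ConeMaps.
Context {R : realType} {G : topGroupType} (I : finType) (st : I -> closed_subgroup G).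
Local Notation C := (cone_complex R st).
Local Notation cmap i := (@cone_map R G I st i).

Lemma cone_factor (Z : gspace G) (g : forall i, Defs.orbit (st i) * disk R 1 -> Z) :
  (forall i, continuous (g i)) ->
  (forall i a c v, g i (orbit_act a c, v) = gact a (g i (c, v))) ->
  (forall i c v, headv (val v) = -1 -> g i (c, v) = gpt) ->
  exists f : gmap (cone R st) Z, forall i q, f (cmap i q) = g i q.
Proof.
move=> cg eg g0.
pose f0 (x : cylinder R st) : Z := if x is Some s then g (projT1 s) (projT2 s) else gpt.
have f0c : continuous f0 by apply: add_point_sum_continuous => i; exact: cg.
have f0e a x : f0 (gact a x) = gact a (f0 x).
  by case: x => [[i [c v]]|] /=; [rewrite eg|rewrite gact_pt].
pose f0m : gmap (cylinder R st) Z := GMap f0c f0e erefl.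
have f0A x : inv_set (cylinder_bottom R st) x -> f0m x = gpt.
  by case: x => [[i [c v]]|] //= v1; exact: g0.
by exists (gfactor f0A) => i q; rewrite /cone_map gfactor_pi.
Qed.

Lemma cone_contraction : exists K : gfamily R (cone R st) (cone R st),
  (forall x, K 0 x = x) /\ (forall x, K 1 x = gpt).
Proof.
(* The interval has length 2, so every point has reached the apex at time 1. *)
pose low (t : R) (v : disk R 1) := itv_pt (headv (val v) - 2 * Num.max 0 t).
have clow : continuous (fun q : R * disk R 1 => low q.1 q.2).
  apply: (continuous_comp_all _ (@itv_pt_continuous R)).
  apply: contD.
    apply: (cont_snd_comp (f := fun v : disk R 1 => headv (val v))).
    by apply: continuous_comp_all; [exact: disk_val_continuous|exact: headv_continuous].
  apply: contN; apply: contM; first exact: cont_cst.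
  by apply: cont_max; [exact: cont_cst|exact: continuous_fst].
have k_ex t : exists f : gmap (cone R st) (cone R st),
    forall i q, f (cmap i q) = cmap i (q.1, low t q.2).
  apply: cone_factor => [i|i a c v|i c v v1].
  - apply: (continuous_comp_all (f := fun q : Defs.orbit (st i) * disk R 1 =>
      (q.1, low t q.2)) _ (@cone_map_continuous R G I st i)).
    apply: continuous_pairing; first exact: continuous_fst.
    apply: (cont_snd_comp (f := low t)).
    apply: (continuous_comp_all (f := fun v : disk R 1 => (t, v)) _ clow).
    by apply: continuous_pairing; [exact: cont_cst|move=> x].
  - exact: cone_map_equivariant.
  - apply/cone_map_gpt; apply: headv_itv_le; rewrite v1 gerDl oppr_le0.
    by rewrite mulr_ge0 // le_max lexx.
have [k kP] := choice k_ex.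
have ck : continuous (fun q : R * cone R st => k q.1 q.2).
  apply: (@cw_param_continuous R G C R _ (fun t => k t)) => [||[i b]|].
  - exact: locally_compactR.
  - exact: norm_hausdorff.
  - have cm : continuous (fun q : R * (Defs.orbit (st i) * disk R 1) => cmap i (q.2.1, low q.1 q.2.2)).
      apply: (continuous_comp_all (f := fun q : R * (Defs.orbit (st i) * disk R 1) =>
        (q.2.1, low q.1 q.2.2)) _ (@cone_map_continuous R G I st i)).
      apply: continuous_pairing; first by apply: cont_snd_comp; exact: continuous_fst.
      apply: (continuous_comp_all (f := fun q : R * (Defs.orbit (st i) * disk R 1) =>
        (q.1, q.2.2)) _ clow).
      apply: continuous_pairing; first exact: continuous_fst.
      by apply: cont_snd_comp; exact: continuous_snd.
    case: b.
      by apply: eq_continuous cm => q /=; rewrite kP.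
    apply: (@eq_continuous _ _ _ (fun q : R * (Defs.orbit (st i) * disk R 0) =>
      cmap i (q.2.1, low q.1 (itv_pt 1)))); first by move=> q /=; rewrite kP.
    apply: (continuous_comp_all (f := fun q : R * (Defs.orbit (st i) * disk R 0) =>
      (q.1, (q.2.1, itv_pt 1))) _ cm).
    apply: continuous_pairing; first exact: continuous_fst.
    apply: continuous_pairing; last exact: cont_cst.
    by apply: cont_snd_comp; exact: continuous_fst.
  - by apply: (@eq_continuous _ _ _ (fun=> gpt)); [move=> t; rewrite gmap_pt|exact: cont_cst].
have ek t a x : k t (gact a x) = gact a (k t x) by exact: gmap_equivariant.
have pk t : k t gpt = gpt by exact: gmap_pt.
exists (GFamily ck ek pk); split => x /=.
  have [->|[i [c [v [_ ->]]]]] := cone_pointP x; first exact: pk.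
  by rewrite kP /low maxxx mulr0 subr0 itv_ptK.
have [->|[i [c [v [_ ->]]]]] := cone_pointP x; first exact: pk.
rewrite kP; apply/cone_map_gpt; apply: headv_itv_le.
by have /andP[_] := disk1_itv v; rewrite max_r //; lra.
Qed.

Definition top_set : set (cone R st) :=
  [set x | x = gpt \/ exists i c, x = cmap i (c, itv_pt 1)].

Lemma top_cells x : top_set x -> x = gpt \/
  exists i : cell (gcw_data C), open_cell i x /\ closed_cell i `<=` top_set.
Proof.
move=> [->|[i [c ->]]]; first by left.
right; exists (i, false); split.
  apply/cone_open_cell; exists c, (itv_pt 1); split => //; first exact: top_neq.
  by rewrite headv_itv_pt ?eqxx //; lra.
by move=> _ [[c' v] _ <-]; right; exists i, c'.
Qed.

Definition cone_top : subcomplex C :=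
  @Subcomplex R G C top_set (or_introl erefl) top_cells.

Lemma in_cone_top i b : in_sc cone_top (i, b) = ~~ b.
Proof.
apply/asboolP/idP; case: b => //=.
- move=> iA; have /iA : closed_cell ((i, true) : cell (gcw_data C))
      (cmap i (\pi_(Defs.orbit (st i)) 1%g, itv_pt 0)).
    by exists (\pi_(Defs.orbit (st i)) 1%g, itv_pt 0).
  have h0 : headv (val (itv_pt (0 : R))) = 0 by rewrite headv_itv_pt //; lra.
  move=> [/cone_map_gpt|[j [c E]]]; first by rewrite h0; lra.
  have := congr1 (fun s : {i & cyl R st i} => headv (val (projT2 s).2)) (cone_map_inj _ E).
  by rewrite /= -/(itv_pt 0) -/(itv_pt 1) h0 headv_itv_pt; lra.
- by move=> _ _ [[c' v] _ <-]; right; exists i, c'.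
Qed.

End ConeMaps.

Arguments cone_contraction R {G I} st.
Arguments cone_top R {G I} st.

Section DimensionZero.
Context {R : realType} {G : topGroupType} {B : zmodType} (l : assignment R G B)
  (la : lefschetz_axioms l).
Hypothesis l_pure1 : forall (X : finite_gcw R G) (f : gmap X X),
  (forall i : cell (gcw_data X), cell_dim i = 1%N) -> l f = 0.
Context (Q : gspace G) (I : finType) (st : I -> closed_subgroup G)
  (mp : forall i : I, Defs.orbit (st i) * disk R 0 -> Q).
Arguments mp : clear implicits.
Local Notation D := (@CWData R G Q I (fun=> 0%N) st mp).
Context (ax : is_cw D).
Local Notation X0 := (FiniteGCW ax).
Local Notation C := (cone_complex R st).
Local Notation cmap i := (@cone_map R G I st i).
Local Notation center := (disk_center (R := R) 0).

Lemma cone_levels : exists Gam : gfamily R Q (cone R st),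
  forall i t c v, Gam t (mp i (c, v)) = cmap i (c, itv_pt t).
Proof.
have [|||||||K [KS _]] := @cell_glue_family R G X0 R (cone R st) (fun=> True) 0
  (fun i t q => cmap i (q.1, itv_pt t)) (const_family R (gzero Q (cone R st))).
- exact: locally_compactR.
- exact: norm_hausdorff.
- by [].
- by [].
- move=> i _; apply: (continuous_comp_all (f := fun q : R * (Defs.orbit (st i) * disk R 0) =>
    (q.2.1, itv_pt q.1)) _ (@cone_map_continuous R G I st i)).
  apply: continuous_pairing; first by apply: cont_snd_comp; exact: continuous_fst.
  by apply: (continuous_comp_all (f := fst)); [exact: continuous_fst|exact: itv_pt_continuous].
- by move=> i t a c v _ /=; rewrite cone_map_equivariant.
- by move=> i t [c v] _; rewrite /cell_boundary /= disk0_sqnorm => /esym/eqP; rewrite oner_eq0.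
by exists K => i t c v; exact: KS.
Qed.

Lemma la_pure0 (f : gmap Q Q) : l (f : gmap X0 X0) = 0.
Proof.
have [Gam GamE] := cone_levels.
have Q_point x : x = gpt \/ exists i c, x = mp i (c, center).
  have [->|[i [c [v [_ ->]]]]] := pure_pointP ax x; first by left.
  by right; exists i, c; rewrite (disk0_unique v center).
have Gam_low t x : t <= -1 -> Gam t x = gpt.
  move=> t1; have [->|[i [c ->]]] := Q_point x; first exact: gfam_pt.
  by rewrite GamE; apply/cone_map_gpt/headv_itv_le.
(* The cone on [f], acting level by level; at the apex it is well defined because [Gam (-1)] is
   constant. *)
have [F FE] : exists F : gmap (cone R st) (cone R st),
    forall i q, F (cmap i q) = Gam (headv (val q.2)) (f (mp i (q.1, center))).
  apply: cone_factor => [i|i a c v|i c v /= ->]; last exact: Gam_low.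
    apply: (continuous_comp_all (f := fun q : Defs.orbit (st i) * disk R 1 =>
      (headv (val q.2), f (mp i (q.1, center)))) _ (@gfam_continuous _ _ _ _ Gam)).
    apply: continuous_pairing.
      apply: (cont_snd_comp (f := fun v : disk R 1 => headv (val v))).
      by apply: continuous_comp_all; [exact: disk_val_continuous|exact: headv_continuous].
    apply: (continuous_comp_all (f := fun q : Defs.orbit (st i) * disk R 1 => mp i (q.1, center)) _
      (@gmap_continuous _ _ _ f)).
    apply: (continuous_comp_all (f := fun q : Defs.orbit (st i) * disk R 1 => (q.1, center)) _
      (@pure_continuous _ _ _ _ _ _ _ ax i)).
    by apply: continuous_pairing; [exact: continuous_fst|exact: cont_cst].
  by rewrite /= (pure_equivariant ax) gmap_equivariant gfam_equivariant.
have h1 : headv (val (itv_pt (1 : R))) = 1 by rewrite headv_itv_pt //; lra.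
have Gam_top x : top_set (Gam 1 x).
  have [->|[i [c ->]]] := Q_point x; first by left; exact: gfam_pt.
  by right; exists i, c; rewrite GamE.
have F_Gam x : F (Gam 1 x) = Gam 1 (f x).
  have [->|[i [c ->]]] := Q_point x; first by rewrite gfam_pt !gmap_pt gfam_pt.
  by rewrite GamE FE h1.
have top_Gam x : top_set x -> exists y, x = Gam 1 y.
  by move=> [->|[i [c ->]]]; [exists gpt; rewrite gfam_pt|exists (mp i (c, center)); rewrite GamE].
have FA : set_fun (sc_set (cone_top R st)) (sc_set (cone_top R st)) (F : gmap C C).
  by move=> _ /top_Gam[y ->]; rewrite F_Gam; exact: Gam_top.
have [K [K0 K1]] := cone_contraction R st.
have := la_cofibration la FA.
rewrite (la_contractible la (F : gmap C C) K0 K1) (@l_pure1 (quot_gcw (cone_top R st))); last first.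
  by move=> [[i []] iA] //; have := iA; rewrite in_cone_top.
rewrite addr0 => lf0; apply: (etrans _ (esym lf0)).
pose E := sub_gcw (cone_top R st).
pose aF : gfamily R Q (cone R st) := Gam.
have a0c : continuous (fun x : Q => exist _ (Gam 1 x) (mem_set (Gam_top x)) : E).
  by apply: Defs.sub_continuous; exact: (@gmap_continuous _ _ _ (gfam_map Gam 1)).
have a0e g x : exist _ (Gam 1 (gact g x)) (mem_set (Gam_top (gact g x))) =
    gact g (exist _ (Gam 1 x) (mem_set (Gam_top x)) : E) :> E.
  by apply: val_inj; rewrite /= gfam_equivariant.
have a0p : exist _ (Gam 1 gpt) (mem_set (Gam_top gpt)) = gpt :> E.
  by apply: val_inj; rewrite /= gfam_pt.
pose a : gmap X0 E := GMap a0c a0e a0p.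
have E_dim (j : cell (gcw_data E)) : cell_dim j = 0%N.
  by case: j => [[i []] iA] //=; have := iA; rewrite /= in_cone_top.
have [|||||||Kb [KbS _]] := @cell_glue_family R G E R Q (fun=> True) 0
  (fun j _ q => mp (val j).1 (q.1, center)) (const_family R (gzero E Q)).
- exact: locally_compactR.
- exact: norm_hausdorff.
- by move=> j _; exact: E_dim.
- by move=> j; rewrite E_dim.
- move=> j _; apply: (cont_snd_comp
    (f := fun q : Defs.orbit (cell_stab j) * disk R (cell_dim j) => mp (val j).1 (q.1, center))).
  apply: (continuous_comp_all (f := fun q : Defs.orbit (cell_stab j) * disk R (cell_dim j) =>
    (q.1, center)) _ (@pure_continuous _ _ _ _ _ _ _ ax (val j).1)).
  by apply: continuous_pairing; [exact: continuous_fst|exact: cont_cst].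
- by move=> j t g c v _ /=; exact: (pure_equivariant ax).
- move=> [[i []] iA] t [c v] _; first by have := iA; rewrite in_cone_top.
  by rewrite /cell_boundary /= disk0_sqnorm => /esym/eqP; rewrite oner_eq0.
pose b : gmap E X0 := gfam_map Kb 0.
have bE i c : b (a (mp i (c, center))) = mp i (c, center).
  have iA : in_sc (cone_top R st) (i, false) by rewrite in_cone_top.
  have := KbS (exist _ ((i, false) : cell (gcw_data C)) iA) 0 (c, center) Logic.I.
  move=> /= KbE; apply: etrans KbE; congr (Kb 0 _); apply: val_inj => /=.
  by rewrite GamE.
have ab : cancel a b.
  move=> x; have [->|[i [c ->]]] := Q_point x; last exact: bE.
  by rewrite !gmap_pt.
have ba : cancel b a.
  move=> y; have [x yE] := top_Gam _ (set_mem (valP y)).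
  have -> : y = a x by exact: val_inj.
  by rewrite ab.
apply: (la_conj la ab ba) => x; apply: val_inj => /=.
by rewrite F_Gam.
Qed.

End DimensionZero.

(** * Vanishing and uniqueness *)

Section Vanishing.
Context {R : realType} {G : topGroupType} {B : zmodType} (l : assignment R G B)
  (la : lefschetz_axioms l).

Lemma finite_gcw_uniform k (P : forall X : finite_gcw R G, gmap X X -> Prop) :
  (forall (Q : gspace G) (I : finType) (st : I -> closed_subgroup G)
     (mp : forall i : I, Defs.orbit (st i) * disk R k -> Q)
     (ax : is_cw (@CWData R G Q I (fun=> k) st mp)) (f : gmap Q Q),
     P (FiniteGCW ax) f) ->
  forall (X : finite_gcw R G) (f : gmap X X),
    (forall i : cell (gcw_data X), cell_dim i = k) -> P X f.
Proof.
move=> Puni [Q [I dm st mp] ax] f /= dmk.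
have E : dm = (fun=> k) by apply/funext => i; exact: dmk.
by subst dm; exact: Puni.
Qed.

Hypothesis l_wedge : forall (X : finite_gcw R G) (f : gmap X X),
  wedge_of_1spheres R X -> l f = 0.

Lemma la_pure1 (X : finite_gcw R G) (f : gmap X X) :
  (forall i : cell (gcw_data X), cell_dim i = 1%N) -> l f = 0.
Proof.
move: X f; apply: (finite_gcw_uniform (P := fun X f => l f = 0)) => Q I st mp ax f.
(* A wedge has at least one summand, so a complex without cells is treated apart, as a point. *)
case cardI: #|I| => [|n].
  apply: (la_point la) => x; have [//|[i _]] := pure_pointP ax x.
  by have := card0_eq cardI i; rewrite inE.
apply: l_wedge; pose en (k : 'I_n.+1) : I := enum_val (cast_ord (esym cardI) k).
apply: (pure1_wedge ax (en := en)).
  by move=> i j /enum_val_inj/cast_ord_inj.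
move=> i; exists (cast_ord cardI (enum_rank i)).
by rewrite /en cast_ordK enum_rankK.
Qed.

Lemma la_pure k (X : finite_gcw R G) (f : gmap X X) :
  (forall i : cell (gcw_data X), cell_dim i = k) -> l f = 0.
Proof.
elim: k X f => [|[|p] IH]; last 1 first.
- apply: (finite_gcw_uniform (P := fun X f => l f = 0)) => Q I st mp ax f.
  have [f1 [f2 [f3 [ff1 f12 f23 f3s]]]] := separate_halves ax (ltn0Sn p) f.
  pose X := FiniteGCW ax.
  rewrite (@la_homotopy _ _ _ _ la X f f1 ff1) (@la_homotopy _ _ _ _ la X f1 f2 f12).
  rewrite (@la_homotopy _ _ _ _ la X f2 f3 f23) -(la_split_halves la IH f3s).
  (* The identity of [Q] relates the two cell structures, so the refinement has the same value. *)
  exact: (@la_conj _ _ _ _ la X (refined ax) (gid Q) (gid Q)).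
- apply: (finite_gcw_uniform (P := fun X f => l f = 0)) => Q I st mp ax f.
  exact: (la_pure0 la la_pure1).
- exact: la_pure1.
Qed.

Lemma lefschetz_vanishing (X : finite_gcw R G) (f : gmap X X) : l f = 0.
Proof. by apply: (la_reduction la) => k; exact: la_pure. Qed.

End Vanishing.

Section Uniqueness.
Context {R : realType} {G : topGroupType} {B : zmodType}.
Implicit Type l : assignment R G B.

(** Invariance under homotopies of a self-map is the homotopy axiom for the identity equivalence. *)
Lemma eln_axioms l : equivariant_lefschetz_number l -> lefschetz_axioms l.
Proof.
move=> lN; split; [|exact: eln_commutativity|exact: eln_cofibration].
move=> X f h fh; apply: (eln_homotopy lN (k := gid X)).
  by exists (gid X); split; apply: eqfun_homotopic.
have [K [cK K0 K1 Ke Kp]] := fh.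
by exists K; split.
Qed.

Lemma lefschetz_axioms_unique l1 l2 : lefschetz_axioms l1 -> lefschetz_axioms l2 ->
  (forall (X : finite_gcw R G) (f : gmap X X), wedge_of_1spheres R X -> l1 X f = l2 X f) ->
  forall (X : finite_gcw R G) (f : gmap X X), l1 X f = l2 X f.
Proof.
move=> la1 la2 l12 X f; apply/eqP; rewrite -subr_eq0; apply/eqP.
apply: (@lefschetz_vanishing R G B (fun X f => l1 X f - l2 X f)); last first.
  by move=> Y h /l12 ->; rewrite subrr.
split=> [Y h h' hh'|Y Z h h'|Y A h hA].
- by rewrite (la_homotopy la1 hh') (la_homotopy la2 hh').
- by rewrite (la_commutativity la1) (la_commutativity la2).
- by rewrite (la_cofibration la1 hA) (la_cofibration la2 hA) opprD addrACA.
Qed.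

End Uniqueness.

Theorem corollary2p7 (R : realType) (G : topGroupType) (B : zmodType) :
  (forall l1 l2 : assignment R G B,
     equivariant_lefschetz_number l1 -> equivariant_lefschetz_number l2 ->
     (forall (X : finite_gcw R G) (f : gmap X X),
        wedge_of_1spheres R X -> l1 X f = l2 X f) ->
     forall (X : finite_gcw R G) (f : gmap X X), l1 X f = l2 X f)
  /\
  (forall L1 L2 : assignment R G B,
     equivariant_lefschetz_number L1 ->
     ((forall (X : finite_gcw R G) (f : gmap X X), L1 X f = L2 X f) <->
      [/\ (forall (X : finite_gcw R G) (f h : gmap X X),
             ghomotopic R f h -> L2 X f = L2 X h),
          (forall (X Y : finite_gcw R G) (f : gmap X Y) (h : gmap Y X),
             L2 Y (gcomp f h) = L2 X (gcomp h f)),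
          (forall (X : finite_gcw R G) (A : subcomplex X) (f : gmap X X)
             (fA : set_fun (sc_set A) (sc_set A) f),
             L2 X f = (L2 (sub_gcw A) (gmap_restrict (A := sc_invariant A) fA)
                       + L2 (quot_gcw A) (gmap_induced (A := sc_invariant A) fA))%R)
        & (forall (X : finite_gcw R G) (f : gmap X X),
             wedge_of_1spheres R X -> L2 X f = L1 X f)])).
Proof.
split=> [l1 l2 lN1 lN2|L1 L2 LN1].
  by apply: lefschetz_axioms_unique; exact: eln_axioms.
have la1 := eln_axioms LN1; split=> [E|[hL2 cL2 fL2 wL2]].
  split=> [X f h fh|X Y f h|X A f fA|X f _].
  - by rewrite -!E; exact: (la_homotopy la1 fh).
  - by rewrite -!E; exact: (la_commutativity la1).
  - by rewrite -!E; exact: (la_cofibration la1 fA).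
  - by rewrite E.
apply: (lefschetz_axioms_unique la1) => [|X f /wL2 ->//].
by split=> // X Y f h; exact: cL2.
Qed.
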